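(* Let $t\in D=\{s\in\mathbb{C}:\operatorname{Re}(s)>0\}$, and let $\zeta_+^{(t)}(-k_1,\ldots,-k_n)$ ($n\ge 1$, $k_1,\ldots,k_n\in\mathbb{N}=\{1,2,\ldots\}$) be the renormalised multiple zeta values defined in the context. a) The values $\zeta_+^{(t)}$ agree with the meromorphic continuation of multiple zeta values wherever the latter is defined: for every $n\ge 1$ and every $\mathbf{k}\in(\mathbb{Z}_{<0})^n\setminus\mathcal{S}_n$ one has $\zeta_+^{(t)}(\mathbf{k})=\zeta(\mathbf{k})\in\mathbb{Q}$. b) The values $\zeta_+^{(t)}$ satisfy the quasi-shuffle product: the $\mathbb{Q}$-linear map $\mathfrak{h}^-\to\mathbb{C}$ given by $\mathbf{1}\mapsto 1$ and $y_{-k_1}\cdots y_{-k_n}\mapsto\zeta_+^{(t)}(-k_1,\ldots,-k_n)$ is a morphism of algebras from $(\mathfrak{h}^-,* )$ to $(\mathbb{C},\cdot)$. c) The values $\zeta_+^{(t)}$ are rational functions in $t$ over $\mathbb{Q}$ without singularities in $D$: for every $n\ge1$ and all $k_1,\ldots,k_n\in\mathbb{N}$ there is a rational function $R\in\mathbb{Q}(T)$ having no poles in $D$ such that $\zeta_+^{(t)}(-k_1,\ldots,-k_n)=R(t)$ for all $t\in D$.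
   Context: Multiple zeta function: for $(s_1,\ldots,s_n)\in\mathbb{C}^n$ with $\sum_{i=1}^j\operatorname{Re}(s_i)>j$ for $j=1,\ldots,n$, $\zeta(s_1,\ldots,s_n)=\sum_{m_1>\cdots>m_n>0}m_1^{-s_1}\cdots m_n^{-s_n}$. It continues meromorphically to $\mathbb{C}^n$ (the continuation is also denoted $\zeta$), with singularity set $\mathcal{S}_n$ consisting of all $(s_1,\ldots,s_n)\in\mathbb{C}^n$ such that $s_1=1$, or ($n\ge 2$ and $s_1+s_2\in\{2,1,0,-2,-4,-6,\ldots\}$), or $s_1+\cdots+s_j\in\mathbb{Z}_{\le j}$ for some $3\le j\le n$. Algebra: let $Y^-=\{y_n:n\in\mathbb{Z}_{<0}\}$ and let $\mathfrak{h}^-=\mathbb{Q}\langle Y^-\rangle$ be the $\mathbb{Q}$-span of all words in $Y^-$ with empty word $\mathbf{1}$. The quasi-shuffle product $*$ on $\mathfrak{h}^-$ is the bilinear product with $\mathbf{1}*u=u*\mathbf{1}=u$ and $y_nu*y_mv=y_n(u*y_mv)+y_m(y_nu*v)+y_{n+m}(u*v)$ for words $u,v$ and letters $y_n,y_m$. Regularisation: for $0<q<1$ and $k_1,\ldots,k_n\in\mathbb{N}$ put $$\overline{\zeta}_q^{(t)}(y_{-k_1}\cdots y_{-k_n})=\sum_{m_1>\cdots>m_n>0}\ \prod_{j=1}^n q^{k_jm_jt}(1-q^{m_j})^{k_j}$$ (a convergent series; $q^{a}=e^{a\log q}$). Substituting $q=e^z$ (real $z<0$) gives a function of $z$ which extends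 meromorphically to a neighbourhood of $z=0$, and $\overline{\zeta}_{e^z}^{(t)}$ denotes its Laurent expansion at $z=0$. Let $\mathbb{C}[z^{-1},z]]$ be the algebra of formal Laurent series with finitely many negative powers. Define the $\mathbb{Q}$-linear map $\psi^{(t)}:\mathfrak{h}^-\to\mathbb{C}[z^{-1},z]]$ by $\psi^{(t)}(\mathbf{1})=1$ and $$\psi^{(t)}(y_{-k_1}\cdots y_{-k_n})(z)=\frac{(-1)^{k_1+\cdots+k_n}}{z^{k_1+\cdots+k_n}}\,\overline{\zeta}_{e^z}^{(t)}(y_{-k_1}\cdots y_{-k_n}).$$ Renormalisation (Birkhoff decomposition with minimal subtraction, for the deconcatenation coproduct): let $\pi$ be the projection $\pi(\sum_{n\ge -k}a_nz^n)=\sum_{n=-k}^{-1}a_nz^n$ on $\mathbb{C}[z^{-1},z]]$. The linear maps $\psi^{(t)}_\pm$ on $\mathfrak{h}^-$ are defined by $\psi_\pm^{(t)}(\mathbf{1})=1$ and, recursively on the length of a word $w=y_{-k_1}\cdots y_{-k_n}$, $n\ge1$, $$\psi_-^{(t)}(w)=-\pi(R(w)),\qquad \psi_+^{(t)}(w)=(\mathrm{Id}-\pi)(R(w)),$$ $$R(w)=\psi^{(t)}(w)+\sum_{j=1}^{n-1}\psi_-^{(t)}(y_{-k_1}\cdots y_{-k_j})\,\psi^{(t)}(y_{-k_{j+1}}\cdots y_{-k_n}).$$ Thus $\psi_+^{(t)}(w)\in\mathbb{C}[[z]]$. The renormalised multiple zeta values are $$\zeta_+^{(t)}(-k_1,\ldots,-k_n)=\lim_{z\to0}\psi_+^{(t)}(y_{-k_1}\cdots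 y_{-k_n})(z),$$ i.e. the constant term of $\psi_+^{(t)}(y_{-k_1}\cdots y_{-k_n})$. *)

(* Defs.v *)
From HB Require Import structures.
From mathcomp Require Import all_boot all_order all_algebra finmap.
From mathcomp Require Import all_classical all_reals all_analysis.
From mathcomp Require Import complex.
From mathcomp Require monalg.
(* The notations of monalg clash with those of MathComp-Analysis. *)
Import -(notations) monalg.
Set Implicit Arguments.
Unset Strict Implicit.
Unset Printing Implicit Defensive.
Import Order.TTheory GRing.Theory Num.Theory numFieldNormedType.Exports.
Local Open Scope classical_set_scope.
Local Open Scope ring_scope.
Local Open Scope complex_scope.

(* ^o selects the canonical topology and normed module structure of R[i]
   over itself; derivatives over C are therefore complex derivatives. *)
Notation "'CC' R" := ((R[i])^o) (at level 9, R at level 8, only parsing).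

(* The letter y_{-k} of Y^- is represented by the integer k > 0. *)
Definition letter := {k : nat | (0 < k)%N}.
Definition word := seq letter.

Lemma add_letter_subproof (a b : letter) : (0 < val a + val b)%N.
Proof. by rewrite addn_gt0 (valP a). Qed.

Definition add_letter (a b : letter) : letter :=
  exist _ (val a + val b)%N (add_letter_subproof a b).

(* Finitely supported maps word -> rat: the Q-vector space with basis the
   words. *)
Notation hminus := (malg word rat).

Definition of_word (w : word) : hminus := mkmalgU w 1.

(* The list stands for the sum of its entries, with multiplicity. *)
Fixpoint qsh (u : word) : word -> seq word :=
  if u is a :: u' then
    fix qsh_u (v : word) : seq word :=
      if v is b :: v' then
        [seq a :: w | w <- qsh u' v] ++
        [seq b :: w | w <- qsh_u v'] ++
        [seq add_letter a b :: w | w <- qsh u' v']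
      else [:: u]
  else fun v => [:: v].

Definition qsh_prod (x y : hminus) : hminus :=
  \sum_(u <- msupp x) \sum_(v <- msupp y)
    (mcoeff u x * mcoeff v y) *: \sum_(w <- qsh u v) of_word w.

(* nested_sum [:: f1; ...; fn] N is the sum of f1 m1 * ... * fn mn over
   N > m1 > ... > mn > 0. *)
Fixpoint nested_sum (K : pzSemiRingType) (fs : seq (nat -> K)) (N : nat) : K :=
  if fs is f :: fs' then \sum_(1 <= m < N) f m * nested_sum fs' m else 1.

Section Defs.
Variable R : realType.
Local Notation C := (CC R).

Definition cexp (s : C) : C :=
  (expR (complex.Re s))%:C * (cos (complex.Im s) +i* sin (complex.Im s)).

(* x ^ s, meant for x > 0 *)
Definition cpow (x : R) (s : C) : C := cexp (s * (ln x)%:C).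

(** Multiple zeta function *)

(* psum s j = s_1 + ... + s_j *)
Definition psum n (s : 'rV[C]_n) (j : nat) : C := \sum_(i < n | (i < j)%N) s 0 i.

Definition mzf_domain n : set 'rV[C]_n :=
  [set s | forall j : nat, (1 <= j <= n)%N -> j%:R < complex.Re (psum s j)].

Definition mzf_sing n : set 'rV[C]_n :=
  [set s | [\/ (1 <= n)%N /\ psum s 1 = 1,
     (2 <= n)%N /\ [\/ psum s 2 = 2, psum s 2 = 1 |
                      exists m : nat, psum s 2 = - (m.*2)%:R] |
     exists j : nat, (3 <= j <= n)%N /\
       exists m : int, m <= j%:Z /\ psum s j = m%:~R]].

(* On mzf_domain the series converges absolutely, so that its sum is the limit
   of the partial sums over m_1 < N. *)
Definition is_mzf_sum n (s : 'rV[C]_n) (l : C) : Prop :=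
  nested_sum [seq (fun m : nat => cpow m%:R (- s 0 i)) | i <- enum 'I_n] N
    @[N --> \oo] --> l.

(* Local quotient of holomorphic functions whose denominator is a nonzero
   germ; the values of Z on the nowhere dense set S are irrelevant. *)
Definition meromorphic_off n (S : set 'rV[C]_n) (Z : 'rV[C]_n -> C) : Prop :=
  forall a : 'rV[C]_n, exists g h : 'rV[C]_n -> C,
    [/\ \forall x \near a, differentiable g x /\ differentiable h x,
        ~ (\forall x \near a, h x = 0) &
        \forall x \near a, ~ S x -> h x * Z x = g x].

(* The complement of mzf_sing is open, connected and contains mzf_domain, so
   these conditions determine Z outside mzf_sing. *)
Definition is_mzf_continuation n (Z : 'rV[C]_n -> C) : Prop :=
  [/\ forall s, @mzf_domain n s -> is_mzf_sum s (Z s),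
      forall s, ~ @mzf_sing n s -> differentiable Z s &
      meromorphic_off (@mzf_sing n) Z].

Definition neg_point n (k : n.-tuple letter) : 'rV[C]_n :=
  \row_(i < n) - (val (tnth k i))%:R.

(** Formal Laurent series *)

(* Coefficient families; the series considered below vanish in all
   sufficiently negative degrees, although the type does not record it. *)
Definition laurent := int -> C.

Definition laurent1 : laurent := fun n => if n == 0 then 1 else 0.

(* Only finitely many terms are nonzero when a and b are Laurent series. *)
Definition laurent_mul (a b : laurent) : laurent :=
  fun n => \sum_(i \in [set: int]) a i * b (n - i).

Definition polar_part (a : laurent) : laurent :=
  fun n => if n < 0 then a n else 0.

(* f agrees on some interval ]-r, 0[ with the sum of the Laurent series a (which
   then converges on the punctured disc 0 < |z| < r). *)
Definition is_laurent_expansion (f : R -> C) (a : laurent) : Prop :=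
  exists N : nat, (forall n : int, n < - N%:Z -> a n = 0) /\
    \forall z \near (0 : R)^'-,
      \sum_(0 <= i < M) a (i%:Z - N%:Z) * (z%:C : C) ^ (i%:Z - N%:Z)
        @[M --> \oo] --> f z.

Definition laurent_expansion (f : R -> C) : laurent :=
  xget (fun=> 0) [set a | is_laurent_expansion f a].

(** Birkhoff decomposition of a map phi on words *)

Section Birkhoff.
Variable phi : word -> laurent.

Definition bprep (phim : word -> laurent) (w : word) : laurent :=
  fun n => phi w n +
    \sum_(1 <= j < size w) laurent_mul (phim (take j w)) (phi (drop j w)) n.

Fixpoint bminus_rec (m : nat) (w : word) : laurent :=
  if m is m'.+1 then
    if w is [::] then laurent1
    else fun n => - polar_part (bprep (bminus_rec m') w) n
  else laurent1.

Definition bminus (w : word) : laurent := bminus_rec (size w) w.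

Definition bplus (w : word) : laurent :=
  if w is [::] then laurent1
  else fun n => bprep bminus w n - polar_part (bprep bminus w) n.

Lemma bminus_recE m w : (size w <= m)%N -> bminus_rec m w = bminus w.
Proof.
rewrite /bminus; elim/ltn_ind: m w => -[|m] IHm w; first by case: w.
case: w => [//|a w] /= wm; apply/funext => n; congr (- polar_part _ n).
apply/funext => p; congr (_ + _); apply: eq_big_nat => j /andP[j0 jw].
have sj : (size (take j (a :: w)) <= size w)%N.
  by rewrite size_take /= jw -ltnS.
by rewrite (IHm m) ?(leq_trans sj) // (IHm (size w)).
Qed.

Lemma bminus_nil : bminus [::] = laurent1. Proof. by []. Qed.

Lemma bminusE w : w != [::] ->
  bminus w = fun n => - polar_part (bprep bminus w) n.
Proof.
case: w => [//|a w] _; rewrite {1}/bminus /=.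
apply/funext => n; congr (- polar_part _ n); apply/funext => p; congr (_ + _).
apply: eq_big_nat => j /andP[j0 jw]; rewrite bminus_recE //.
by rewrite size_take /= jw -ltnS.
Qed.

End Birkhoff.

(** Renormalised multiple zeta values *)

Section Renormalisation.
Variable t : C.

Definition qzeta (q : R) (w : word) : C :=
  lim (nested_sum
         [seq (fun m : nat =>
                 cpow q ((val k)%:R * m%:R * t) * ((1 - q ^+ m) ^+ val k)%:C)
         | k : letter <- w] N @[N --> \oo]).

Definition weight (w : word) : nat := (\sum_(k <- w) val k)%N.

(* Coefficient of z ^ n in (-1) ^ |w| z ^ (- |w|) times the expansion. *)
Definition psi (w : word) : laurent :=
  if w is [::] then laurent1
  else fun n => (-1) ^+ weight w *
    laurent_expansion (fun z => qzeta (expR z) w) (n + (weight w)%:Z).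

Definition zetaplus (w : word) : C := bplus psi w 0.

(* mmap f h x is the sum of f (mcoeff u x) * h u over the support of x. *)
Definition zetaplus_lin : hminus -> C := mmap (ratr : rat -> C) zetaplus.

End Renormalisation.

Definition is_qsh_morphism (f : hminus -> C) : Prop :=
  [/\ forall (c : rat) (x y : hminus), f (c *: x + y) = ratr c * f x + f y,
      f (of_word [::]) = 1 &
      forall x y : hminus, f (qsh_prod x y) = f x * f y].

End Defs.

Arguments mzf_domain {R n}.
Arguments mzf_sing {R n}.
Arguments neg_point R {n} k.

(* Main.v *)
(* Quasi-shuffle: nested sums multiply by the quasi-shuffle rule, so psi is a
   character. Deconcatenation is compatible with the product and polar parts
   (resp. power series) multiply to polar parts (resp. power series), so both
   Birkhoff factors are characters, and so is the constant term of the second.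

   Rationality: expanding (1 - q ^ m) ^ k and summing geometric series turns the
   q-zeta value at q = exp z into a combination of products of
   exp (al z) / (1 - exp (al z)), where al is a partial sum of terms k_j t + i_j
   with 0 <= i_j <= k_j. The coefficients are polynomials in al and 1 / al, and
   al <> 0 since Re t > 0.

   Comparison: a negative point avoids the singular set only in depth one, or in
   depth two with k_1 + k_2 odd. There psi_-(y_{-k_1}) contributes nothing to
   the constant term, and high finite differences leave only products of
   Bernoulli numbers; in depth two one uses, for X = exp (al z), Y = exp (be z)
   and e(X) = X / (1 - X), the identity
   e(X) e(XY) = e(X) e(Y) + e(XY) e(1 / Y).
   On the other side, Z is restricted to the line s_2 = - k_2. For Re s_1 large,
   Faulhaber's formula makes it a combination of shifted Riemann zeta functions,
   which the Euler-Maclaurin formula continues as locally uniform limits of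
   holomorphic functions h'. The difference h of the two sides is therefore a
   uniform limit of holomorphic functions off the possible real poles and
   vanishes for Re s_1 large. It is propagated to - k_1 along a horizontal and
   then a vertical rectangle by the maximum principle for
   h exp (q exp (c z)); the maximum principle itself follows from the mean value
   property, i.e. from Goursat's lemma in the coordinate log (z - w). *)
Require Import Defs.
From HB Require Import structures.
From mathcomp Require Import all_boot all_order all_algebra finmap.
From mathcomp Require Import all_classical all_reals all_analysis.
From mathcomp Require Import complex.
From mathcomp Require monalg.
Import -(notations) monalg.
From mathcomp Require Import ring lra zify.
Set Implicit Arguments.
Unset Strict Implicit.
Unset Printing Implicit Defensive.
Import Order.TTheory GRing.Theory Num.Theory numFieldNormedType.Exports.
Import Normc.
Local Open Scope classical_set_scope.
Local Open Scope ring_scope.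

(** * Quasi-shuffles and Birkhoff decomposition *)

Section QuasiShuffle.

(** A k-th finite difference of x ^ p at x = k t + i is 0 for p < k and (-1) ^ k k! for p = k: this
    is why t disappears from the values at nonsingular points. In depth two, expanding e(X) e(XY)
    directly would give a sum over powers of al, up to k_1; the identity trades it for one over
    powers of be, up to k_2, which is the shape in which Faulhaber's formula delivers the continued
    value. The parity of k_1 + k_2 enters through the vanishing of the odd Bernoulli numbers: it
    removes the negative powers in the expansions, on which finite differences say nothing, the
    Birkhoff correction, and the top-degree term of Faulhaber's formula. On the analytic side the
    obstacle is the real axis, which carries all possible poles of the slice. Hence the detour at
    height 1, and the descent inside a strip around - k_1 that is free of poles. The uniform limit h
    is never shown to be holomorphic: the maximum principle is applied to its approximants h', and
    the error is sent to 0 before the parameter q of the weight grows. *)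

Lemma qsh_nilr u : qsh u [::] = [:: u].
Proof. by case: u. Qed.

Lemma qsh_cons a u b v : qsh (a :: u) (b :: v) =
  [seq a :: w | w <- qsh u (b :: v)] ++ [seq b :: w | w <- qsh (a :: u) v] ++
  [seq add_letter a b :: w | w <- qsh u v].
Proof. by []. Qed.

Lemma big_qsh_cons (V : nmodType) a u b v (F : word -> V) :
  \sum_(w <- qsh (a :: u) (b :: v)) F w =
  \sum_(w <- qsh u (b :: v)) F (a :: w) + \sum_(w <- qsh (a :: u) v) F (b :: w)
  + \sum_(w <- qsh u v) F (add_letter a b :: w).
Proof. by rewrite qsh_cons !big_cat /= !big_map addrA. Qed.

Definition dec_sum (V : nmodType) (G : word -> word -> V) (w : word) : V :=
  \sum_(i < (size w).+1) G (take i w) (drop i w).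

Lemma dec_sum_cons (V : nmodType) (G : word -> word -> V) a w :
  dec_sum G (a :: w) = G [::] (a :: w) + dec_sum (fun x => G (a :: x)) w.
Proof. by rewrite /dec_sum big_ord_recl. Qed.

(** The (i, j) term of the product of the coproducts of u and v, taken in the tensor square; [G]
    plays the part of a linear form on that square. *)
Definition cell_sum (V : nmodType) (G : word -> word -> V) u v i j : V :=
  \sum_(x <- qsh (take i u) (take j v))
    \sum_(y <- qsh (drop i u) (drop j v)) G x y.

Section CellSum.
Variables (V : nmodType) (G : word -> word -> V).

Lemma cell_sum0S a u b v j : cell_sum G (a :: u) (b :: v) 0 j.+1 =
  cell_sum (fun x => G (b :: x)) (a :: u) v 0 j.
Proof. by rewrite /cell_sum !take0 !big_seq1. Qed.

Lemma cell_sumS0 a u b v i : cell_sum G (a :: u) (b :: v) i.+1 0 =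
  cell_sum (fun x => G (a :: x)) u (b :: v) i 0.
Proof. by rewrite /cell_sum !take0 !qsh_nilr !big_seq1. Qed.

Lemma cell_sumSS a u b v i j : cell_sum G (a :: u) (b :: v) i.+1 j.+1 =
  cell_sum (fun x => G (a :: x)) u (b :: v) i j.+1 +
  cell_sum (fun x => G (b :: x)) (a :: u) v i.+1 j +
  cell_sum (fun x => G (add_letter a b :: x)) u v i j.
Proof. by rewrite /cell_sum big_qsh_cons. Qed.

End CellSum.

(* Deconcatenation is a morphism for the quasi-shuffle product. *)
Lemma dec_sum_qsh (V : nmodType) (G : word -> word -> V) u v :
  \sum_(w <- qsh u v) dec_sum G w =
  \sum_(i < (size u).+1) \sum_(j < (size v).+1) cell_sum G u v i j.
Proof.
have [n le_n] := ubnP (size u + size v); elim: n => // n IHn in u v G le_n *.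
case: u v le_n => [|a u] [|b v] le_n.
- by rewrite /= /dec_sum /cell_sum /= !(big_ord1, big_seq1).
- rewrite /= big_seq1 big_ord1; apply: eq_bigr => j _.
  by rewrite /cell_sum !big_seq1.
- rewrite /= big_seq1; apply: eq_bigr => i _.
  by rewrite big_ord1 /cell_sum /= !qsh_nilr !big_seq1.
have [lt1 lt2 lt3] : [/\ (size u + (size v).+1 < n)%N,
  ((size u).+1 + size v < n)%N & (size u + size v < n)%N].
  by move: le_n => /=; split; lia.
have IH1 := IHn u (b :: v) (fun x => G (a :: x)) lt1.
have IH2 := IHn (a :: u) v (fun x => G (b :: x)) lt2.
have IH3 := IHn u v (fun x => G (add_letter a b :: x)) lt3.
rewrite big_qsh_cons.
have dec_sumE c r : \sum_(w <- r) dec_sum G (c :: w) =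
    \sum_(w <- r) G [::] (c :: w) + \sum_(w <- r) dec_sum (fun x => G (c :: x)) w.
  by rewrite -big_split; apply: eq_bigr => w _; rewrite dec_sum_cons.
rewrite !dec_sumE IH1 IH2 IH3 /=.
(* The corner cell (0, 0) collects the cuts before the first letter; every other cell is split
   according to the origin of the first letter of the left factor. *)
rewrite [RHS]big_ord_recl /= [X in _ = X + _]big_ord_recl /=.
have -> : cell_sum G (a :: u) (b :: v) 0 0 =
    \sum_(w <- qsh u (b :: v)) G [::] (a :: w) +
    \sum_(w <- qsh (a :: u) v) G [::] (b :: w) +
    \sum_(w <- qsh u v) G [::] (add_letter a b :: w).
  by rewrite /cell_sum big_seq1 big_qsh_cons.
rewrite [X in _ = _ + X](_ : _ =
    \sum_(i < (size u).+1) (cell_sum G (a :: u) (b :: v) i.+1 0 +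
      \sum_(j < (size v).+1) cell_sum G (a :: u) (b :: v) i.+1 j.+1)); last first.
  by apply: eq_bigr => i _; rewrite big_ord_recl.
rewrite [X in _ + X + _ + _](_ : _ = \sum_(i < (size u).+1)
    (cell_sum (fun x => G (a :: x)) u (b :: v) i 0 +
    \sum_(j < (size v).+1) cell_sum (fun x => G (a :: x)) u (b :: v) i j.+1));
  last by apply: eq_bigr => i _; rewrite big_ord_recl.
rewrite [X in _ + (_ + X) + _](@big_ord_recl _ _ _ (size u).+1) /=.
rewrite (eq_bigr _ (fun (j : 'I__) _ => cell_sum0S G a u b v j)).
have cellSS i : \sum_(j < (size v).+1) cell_sum G (a :: u) (b :: v) i.+1 j.+1 =
    \sum_(j < (size v).+1) cell_sum (fun x => G (a :: x)) u (b :: v) i j.+1 +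
    \sum_(j < (size v).+1) cell_sum (fun x => G (b :: x)) (a :: u) v i.+1 j +
    \sum_(j < (size v).+1) cell_sum (fun x => G (add_letter a b :: x)) u v i j.
  by rewrite -!big_split; apply: eq_bigr => j _; exact: cell_sumSS.
rewrite (eq_bigr _ (fun (i : 'I__) _ =>
  congr2 +%R (cell_sumS0 G a u b v i) (cellSS i))).
rewrite !big_split /=.
rewrite -!addrA; congr (_ + _).
by rewrite !addrA [LHS](ACl (3*6*4*1*2*5*7)).
Qed.
End QuasiShuffle.

(** * The ring of formal Laurent series *)

Section LaurentSeries.
Variable R : realType.
Local Notation C := (CC R).

Definition lbounded (N : nat) (a : laurent R) : Prop :=
  forall n : int, n < - N%:Z -> a n = 0.

Lemma lbounded_le N M a : (N <= M)%N -> lbounded N a -> lbounded M a.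
Proof. by move=> NM aN n nM; apply: aN; lia. Qed.

(** Only the indices from - N to n + M contribute, so any K beyond n + N + M gives the same finite
    sum. A K independent of the factors is what sums and parameters need later. *)
Lemma laurent_mulE N M a b (n : int) K : lbounded N a -> lbounded M b ->
  n + N%:Z + M%:Z < K%:Z ->
  laurent_mul a b n = \sum_(i < K) a (i%:Z - N%:Z) * b (n - (i%:Z - N%:Z)).
Proof.
move=> aN bM nK; rewrite /laurent_mul.
pose r := [seq i%:Z - N%:Z | i <- iota 0 K].
rewrite -(fsbig_widen [set` r]) //=; last first.
  move=> i [_ /= ir]; case: (ltrP i (- N%:Z)) => [iN|Ni].
    by rewrite aN // mul0r.
  rewrite bM ?mulr0 //.
  have [//|iM] := ltrP (n - i) (- M%:Z).
  case: ir; apply/mapP; exists (absz (i + N%:Z)); rewrite ?mem_iota; lia.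
rewrite -fsbig_seq; last first.
  by rewrite map_inj_uniq ?iota_uniq // => x y; lia.
rewrite big_map -[X in \sum_(_ <- iota 0 X) _](subn0 K).
by rewrite -/(index_iota 0 K) big_mkord.
Qed.

Lemma lbounded_mul N M a b : lbounded N a -> lbounded M b ->
  lbounded (N + M)%N (laurent_mul a b).
Proof.
move=> aN bM n nNM; rewrite (@laurent_mulE N M _ _ _ 0%N aN bM) ?big_ord0 //.
by lia.
Qed.

Lemma lbounded1 : lbounded 0 (laurent1 R).
Proof. by move=> n n0; rewrite /laurent1 ifF //; lia. Qed.

Definition is_laurent : {pred int -> C} :=
  [pred a | `[< exists N, lbounded N a >]].

Lemma is_laurentP a : reflect (exists N, lbounded N a) (a \in is_laurent).
Proof. exact: asboolP. Qed.

Fact is_laurent_zmod_closed : zmod_closed is_laurent.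
Proof.
split; first by apply/is_laurentP; exists 0%N.
move=> a b /is_laurentP[N aN] /is_laurentP[M bM]; apply/is_laurentP.
exists (N + M)%N => n nNM.
have -> : (a - b) n = a n - b n by [].
rewrite aN ?bM ?subrr //. by lia.
by lia.
Qed.

HB.instance Definition _ := GRing.isZmodClosed.Build (int -> C) is_laurent
  is_laurent_zmod_closed.

(** The finitely supported sum in [laurent_mul] is the true convolution only when supports are
    bounded below, so the ring structure is put on this subtype. *)
Record lser := LSer { lcoef :> int -> C; _ : lcoef \in is_laurent }.
HB.instance Definition _ := [isSub for lcoef].
HB.instance Definition _ := [Choice of lser by <:].
HB.instance Definition _ := [SubChoice_isSubZmodule of lser by <:].

Implicit Types a b c : lser.

Lemma lserP a : exists N, lbounded N a.
Proof. exact/is_laurentP/(valP a). Qed.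

Fact lmul_subproof a b : laurent_mul a b \in is_laurent.
Proof.
have [[N aN] [M bM]] := (lserP a, lserP b).
by apply/is_laurentP; exists (N + M)%N; exact: lbounded_mul.
Qed.
Definition lmul a b := LSer (lmul_subproof a b).

Fact lone_subproof : laurent1 R \in is_laurent.
Proof. by apply/is_laurentP; exists 0%N; exact: lbounded1. Qed.
Definition lone := LSer lone_subproof.

Lemma lcoefD a b n : lcoef (a + b) n = a n + b n. Proof. by []. Qed.
Lemma lcoefN a n : lcoef (- a) n = - a n. Proof. by []. Qed.
Lemma lcoef0 n : lcoef 0 n = 0. Proof. by []. Qed.

Lemma lser_eq a b : (forall n, a n = b n) -> a = b.
Proof. by move=> ab; apply/val_inj/funext. Qed.

(** Up to a shift of degrees a Laurent series is a polynomial to any given order; commutativity and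
    associativity are inherited from {poly C} this way. *)
Definition ltrunc N K (a : laurent R) : {poly C} :=
  \poly_(i < K) a (i%:Z - N%:Z).

Lemma coefM_low (p p' q q' : {poly C}) (K n : nat) : (n < K)%N ->
  (forall i, (i < K)%N -> p`_i = p'`_i) -> (forall i, (i < K)%N -> q`_i = q'`_i) ->
  (p * q)`_n = (p' * q')`_n.
Proof.
move=> nK pp' qq'; rewrite !coefM; apply: eq_bigr => i _.
by rewrite pp' ?qq' //; [lia | case: i => i /= ; lia].
Qed.

Lemma coef_ltrunc N K a n : (n < K)%N -> (ltrunc N K a)`_n = a (n%:Z - N%:Z).
Proof. by move=> nK; rewrite coef_poly nK. Qed.

Lemma laurent_mul_poly N M K a b n : lbounded N a -> lbounded M b -> (n < K)%N ->
  laurent_mul a b (n%:Z - (N + M)%N%:Z) = (ltrunc N K a * ltrunc M K b)`_n.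
Proof.
move=> aN bM nK; rewrite (laurent_mulE (K := n.+1) aN bM); last by lia.
rewrite coefM; apply: eq_bigr => -[i /= lt_in] _.
rewrite !coef_ltrunc; [|lia|lia].
by congr (_ * lcoef b _); lia.
Qed.

Lemma ltrunc_mul N M K a b : lbounded N a -> lbounded M b ->
  forall i, (i < K)%N ->
  (ltrunc (N + M)%N K (lmul a b))`_i = (ltrunc N K a * ltrunc M K b)`_i.
Proof. by move=> aN bM i iK; rewrite coef_ltrunc //= (laurent_mul_poly aN bM iK). Qed.

Lemma lser_eq_bounded N a b : lbounded N a -> lbounded N b ->
  (forall n : nat, a (n%:Z - N%:Z) = b (n%:Z - N%:Z)) -> a = b.
Proof.
move=> aN bN ab; apply: lser_eq => n.
have [nN|Nn] := ltrP n (- N%:Z); first by rewrite aN ?bN.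
by have := ab (absz (n + N%:Z)); rewrite (_ : _ - N%:Z = n) //; lia.
Qed.

Lemma lmulC : commutative lmul.
Proof.
move=> a b; have [[N aN] [M bM]] := (lserP a, lserP b).
apply: (@lser_eq_bounded (N + M)%N); first exact: lbounded_mul.
  by rewrite addnC; exact: lbounded_mul.
move=> n /=; rewrite (@laurent_mul_poly _ _ n.+1) //;
  try exact: lbounded_mul.
by rewrite addnC (@laurent_mul_poly _ _ n.+1) // mulrC.
Qed.

Lemma lmulA : associative lmul.
Proof.
move=> a b c; have [[N aN] [M bM]] := (lserP a, lserP b).
have [L cL] := lserP c.
have abB := lbounded_mul aN bM; have bcB := lbounded_mul bM cL.
apply: (@lser_eq_bounded (N + (M + L))%N); first exact: lbounded_mul.
  by rewrite addnA; exact: lbounded_mul.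
move=> n; rewrite /= -[laurent_mul a b]/(lcoef (lmul a b)).
rewrite -[laurent_mul b c]/(lcoef (lmul b c)).
rewrite (@laurent_mul_poly _ _ n.+1) //;
  try exact: lbounded_mul.
rewrite addnA (@laurent_mul_poly _ _ n.+1) //.
transitivity ((ltrunc N n.+1 a * (ltrunc M n.+1 b * ltrunc L n.+1 c))`_n).
  by apply: (coefM_low (ltnSn n)) => // i; exact: ltrunc_mul.
rewrite mulrA; symmetry.
by apply: (coefM_low (ltnSn n)) => // i; exact: ltrunc_mul.
Qed.

Lemma lmulDl : left_distributive lmul +%R.
Proof.
move=> a b c; have [[N aN] [M bM]] := (lserP a, lserP b).
have [L cL] := lserP c; apply: lser_eq => n /=.
have aNM : lbounded (N + M)%N a by apply: lbounded_le aN; rewrite leq_addr.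
have bNM : lbounded (N + M)%N b by apply: lbounded_le bM; rewrite leq_addl.
have abNM : lbounded (N + M)%N (a + b).
  by move=> i iN; rewrite lcoefD aNM ?bNM ?addr0.
have [K nK] : exists K : nat, n + (N + M)%N%:Z + L%:Z < K%:Z.
  by exists (absz (n + (N + M)%N%:Z + L%:Z)).+1; lia.
rewrite -[RHS]/(laurent_mul a c n + laurent_mul b c n) (laurent_mulE abNM cL nK)
  (laurent_mulE aNM cL nK).
rewrite (laurent_mulE bNM cL nK) -big_split /=.
by apply: eq_bigr => i _; rewrite mulrDl.
Qed.

Lemma lmul1l : left_id lone lmul.
Proof.
move=> a; have [N aN] := lserP a; apply: lser_eq => n /=.
have [K nK] : exists K : nat, n + 0%:Z + N%:Z < K.+1%:Z.
  by exists (absz (n + N%:Z)); lia.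
rewrite (laurent_mulE lbounded1 aN nK) big_ord_recl big1 ?addr0.
  by rewrite /laurent1 /= mul1r; congr (lcoef a _); lia.
move=> i _; rewrite [laurent1 _ _](_ : _ = 0) ?mul0r //.
Qed.

Lemma lone_neq0 : lone != 0.
Proof.
apply/eqP => /(congr1 (fun a : lser => a 0)) /eqP.
by rewrite lcoef0 /= /laurent1 eqxx oner_eq0.
Qed.

HB.instance Definition _ := GRing.Zmodule_isComNzRing.Build lser
  lmulA lmulC lmul1l lmulDl lone_neq0.

Lemma lcoefM a b n : lcoef (a * b) n = laurent_mul a b n. Proof. by []. Qed.
Lemma lcoef_sum I (r : seq I) (P : pred I) (F : I -> lser) n :
  lcoef (\sum_(i <- r | P i) F i) n = \sum_(i <- r | P i) F i n.
Proof. by elim/big_ind2: _ => //= x1 x2 y1 y2 <- <-. Qed.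

Fact polar_subproof a : polar_part a \in is_laurent.
Proof.
have [N aN] := lserP a; apply/is_laurentP; exists N => n nN.
by rewrite /polar_part aN // if_same.
Qed.
Definition lpolar a := LSer (polar_subproof a).

Definition lpolar_is_additive : additive lpolar.
Proof.
move=> a b; apply: lser_eq => n; rewrite lcoefD lcoefN /= /polar_part.
by case: ifP => //; rewrite subr0.
Qed.
HB.instance Definition _ :=
  GRing.isZmodMorphism.Build lser lser lpolar lpolar_is_additive.

Lemma lpolarP a : lpolar a = a <-> forall n : int, 0 <= n -> a n = 0.
Proof.
split=> [<- n n0 /=|an]; first by rewrite /polar_part ltNge n0.
apply: lser_eq => n /=; rewrite /polar_part.
by case: ltrP => // /an ->.
Qed.

Lemma lpolar0P a : lpolar a = 0 <-> lbounded 0 a.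
Proof.
split=> [a0 n n0|an].
  by have := congr1 (fun a : lser => a n) a0; rewrite /= /polar_part ifT.
apply: lser_eq => n /=; rewrite /polar_part.
by case: ltrP => // n0; apply: an; rewrite oppr0.
Qed.

Lemma lpolarM a b : lpolar a = a -> lpolar b = b -> lpolar (a * b) = a * b.
Proof.
move=> /lpolarP a0 /lpolarP b0; apply/lpolarP => n n0.
rewrite lcoefM /laurent_mul fsbig1 // => i _.
have [i0|i0] := lerP 0 i; first by rewrite a0 // mul0r.
by rewrite b0 ?mulr0 //; lia.
Qed.

Lemma lpolarM0 a b : lpolar a = 0 -> lpolar b = 0 -> lpolar (a * b) = 0.
Proof.
by move=> /lpolar0P a0 /lpolar0P b0; apply/lpolar0P; exact: lbounded_mul a0 b0.
Qed.

Lemma lcoefM0 a b : lbounded 0 a -> lbounded 0 b -> lcoef (a * b) 0 = a 0 * b 0.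
Proof.
move=> a0 b0; rewrite lcoefM (laurent_mulE (K := 1) a0 b0) //.
by rewrite big_ord1.
Qed.

End LaurentSeries.

(** * Birkhoff decomposition over a commutative ring *)

Section Birkhoff.
Variable A : comNzRingType.

Definition qsh_character (phi : word -> A) : Prop :=
  forall u v, phi u * phi v = \sum_(w <- qsh u v) phi w.

Definition conv (f g : word -> A) (w : word) : A :=
  dec_sum (fun x y => f x * g y) w.

(** Multiplicativity of [f] is asked for at this cell only: inside the induction of [minus_char] it
    is known just for shorter words. *)
Lemma sum_cell_mul (f g : word -> A) u v i j :
  qsh_character g -> f (take i u) * f (take j v) =
    \sum_(w <- qsh (take i u) (take j v)) f w ->
  cell_sum (fun x y => f x * g y) u v i j =
  f (take i u) * g (drop i u) * (f (take j v) * g (drop j v)).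
Proof.
move=> gch fm; rewrite mulrACA fm gch /cell_sum mulr_suml.
by apply: eq_bigr => x _; rewrite mulr_sumr.
Qed.

(** Abstract minimal subtraction: an additive idempotent whose image and whose kernel are both
    closed under products. *)
Variables (pi : {additive A -> A}).
Hypothesis piK : forall x, pi (pi x) = pi x.
Hypothesis piM : forall x y, pi x = x -> pi y = y -> pi (x * y) = x * y.
Hypothesis piM0 : forall x y, pi x = 0 -> pi y = 0 -> pi (x * y) = 0.

Variables phi minus plus : word -> A.
Hypothesis phi_char : qsh_character phi.
Hypothesis phi_nil : phi [::] = 1.
Hypothesis minus_nil : minus [::] = 1.
Hypothesis plus_nil : plus [::] = 1.
Let prep w := phi w + \sum_(1 <= j < size w) minus (take j w) * phi (drop j w).
Hypothesis minusE : forall w, w != [::] -> minus w = - pi (prep w).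
Hypothesis plusE : forall w, w != [::] -> plus w = prep w - pi (prep w).

(** [prep w] is the convolution without the cut after the last letter; that cut contributes
    [minus w], which is [- pi (prep w)]. *)
Lemma plus_conv w : plus w = conv minus phi w.
Proof.
case: w => [|a w]; first by rewrite plus_nil /conv /dec_sum big_ord1 /= phi_nil
  minus_nil mulr1.
rewrite plusE // -minusE // /prep /conv /dec_sum big_ord_recr big_ord_recl /=.
rewrite drop_size take_size phi_nil mulr1 minus_nil mul1r; congr (_ + _ + _).
by rewrite big_add1 big_mkord.
Qed.

Lemma prep_conv w : w != [::] -> prep w = conv minus phi w - minus w.
Proof. by move=> w0; rewrite -plus_conv plusE // minusE // opprK subrK. Qed.

Lemma qsh_neq_nil u v w : u != [::] -> w \in qsh u v -> w != [::].
Proof.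
case: u => // a u _; case: v => [|b v]; first by rewrite /= inE => /eqP->.
by rewrite qsh_cons !mem_cat => /or3P[] /mapP[? _ ->].
Qed.

(* Minimal subtraction: the product of the positive parts has no polar part,
   that of the negative parts is purely polar. *)
Lemma minus_char : qsh_character minus.
Proof.
move=> u v; have [n le_n] := ubnP (size u + size v).
elim: n => // n IHn in u v le_n *.
have [->|u0] := eqVneq u [::]; first by rewrite minus_nil mul1r /= big_seq1.
have [->|v0] := eqVneq v [::].
  by rewrite minus_nil mulr1 qsh_nilr big_seq1.
(* [G] drops the cut with empty right factor, so that its deconcatenation sum is [prep] and involves
   [minus] on shorter words only. *)
pose G (x y : word) := if y == [::] then 0 else minus x * phi y.
have prepG w : w != [::] -> prep w = dec_sum G w.
  move=> w0; rewrite prep_conv // /conv /dec_sum !big_ord_recr /=.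
  rewrite drop_size take_size phi_nil mulr1 addrK {2}/G eqxx addr0.
  apply: eq_bigr => i _; rewrite /G ifF //; apply/negP => /eqP/(congr1 size)/eqP.
  by rewrite size_drop /= subn_eq0 leqNgt ltn_ord.
have minus_pi w : w != [::] -> pi (minus w) = minus w.
  by move=> w0; rewrite minusE // raddfN piK.
have plus_pi w : w != [::] -> pi (plus w) = 0.
  by move=> w0; rewrite plusE // raddfB piK subrr.
(* All cells but the last corner are products by induction. In the product of the two [plus] the
   last corner is [minus u * minus v], whereas [G] puts 0 there; hence the difference. *)
have sum_prep : \sum_(w <- qsh u v) prep w = plus u * plus v - minus u * minus v.
  transitivity (\sum_(w <- qsh u v) dec_sum G w).
    by apply: eq_big_seq => w /(qsh_neq_nil u0)/prepG.
  rewrite dec_sum_qsh !plus_conv /conv /dec_sum mulr_suml.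
  under [in RHS]eq_bigr do rewrite mulr_sumr.
  rewrite [in RHS]big_ord_recr big_ord_recr /= -addrA; congr (_ + _).
    apply: eq_bigr => i _; apply: eq_bigr => j _.
    rewrite -sum_cell_mul //; last first.
      apply: IHn; rewrite !size_take_min.
      by have := ltn_ord i; have := ltn_ord j; move: le_n; rewrite !ltnS; lia.
    rewrite /cell_sum; apply: eq_bigr => x _; apply: eq_big_seq => y.
    rewrite /G => /qsh_neq_nil y0; rewrite (negPf (y0 _)) //.
    by rewrite -size_eq0 size_drop subn_eq0 -ltnNge.
  rewrite big_ord_recr [in RHS]big_ord_recr /= -addrA; congr (_ + _).
    apply: eq_bigr => j _.
    rewrite -sum_cell_mul //; last first.
      apply: IHn; rewrite !size_take_min.
      by have := ltn_ord j; move: le_n; rewrite !ltnS; lia.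
    rewrite /cell_sum; apply: eq_bigr => x _; apply: eq_big_seq => y.
    rewrite drop_size /= inE => /eqP->; rewrite /G ifF //; apply/negP.
    by rewrite -size_eq0 size_drop subn_eq0 leqNgt ltn_ord.
  rewrite !drop_size !take_size phi_nil !mulr1 subrr /cell_sum big1 // => x _.
  by rewrite !drop_size /= big_seq1 /G eqxx.
transitivity (- pi (\sum_(w <- qsh u v) prep w)).
  rewrite sum_prep raddfB /= piM0 ?plus_pi // piM ?minus_pi //.
  by rewrite sub0r opprK.
rewrite raddf_sum -sumrN; apply: eq_big_seq => w /(qsh_neq_nil u0) w0.
by rewrite minusE.
Qed.

Theorem plus_char : qsh_character plus.
Proof.
move=> u v; rewrite !plus_conv (eq_bigr _ (fun w _ => plus_conv w)).
rewrite /conv dec_sum_qsh /dec_sum mulr_suml; apply: eq_bigr => i _.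
rewrite mulr_sumr; apply: eq_bigr => j _.
by rewrite sum_cell_mul //; exact: minus_char.
Qed.

End Birkhoff.

(** * Minimal subtraction on Laurent series *)

Section LaurentBirkhoff.
Variables (R : realType) (phi : word -> lser R).
Let psi w : laurent R := phi w.

(** The default of [insubd] lets [bm] appear in the very induction that proves membership; it is
    never taken, by [bminus_laurent]. *)
Let bm w : lser R := insubd 0 (bminus psi w).

Lemma bprep_lser w :
  (forall j, (0 < j < size w)%N -> bminus psi (take j w) \in @is_laurent R) ->
  bprep psi (bminus psi) w =
  lcoef (phi w + \sum_(1 <= j < size w) bm (take j w) * phi (drop j w)).
Proof.
move=> bmP; apply/funext => n; rewrite /bprep lcoefD lcoef_sum; congr (_ + _).
by apply: eq_big_nat => j /bmP jP; rewrite lcoefM /bm val_insubd jP.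
Qed.

Lemma bminus_laurent w : bminus psi w \in @is_laurent R.
Proof.
have [n le_n] := ubnP (size w); elim: n => // n IHn in w le_n *.
have [->|w0] := eqVneq w [::]; first exact: lone_subproof.
rewrite bminusE // bprep_lser => [|j /andP[_ jw]]; last first.
  by apply: IHn; rewrite size_take jw; exact: leq_trans jw _.
exact: valP (- lpolar _).
Qed.

Let bmE w : bm w = bminus psi w :> (int -> CC R).
Proof. by rewrite /bm val_insubd bminus_laurent. Qed.

Lemma bplus_laurent w : bplus psi w \in @is_laurent R.
Proof.
case: w => [|a w]; first exact: lone_subproof.
rewrite /bplus bprep_lser => [|j _]; last exact: bminus_laurent.
set x := _ + _; exact: valP (x - lpolar x).
Qed.

Hypothesis phi_nil : phi [::] = 1.

Lemma bplus_lbounded w : lbounded 0 (bplus psi w).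
Proof.
case: w => [|a w]; first exact: lbounded1.
by move=> n n0; rewrite /bplus /polar_part -[0]oppr0 n0 subrr.
Qed.

Lemma bplus_qsh : qsh_character phi ->
  forall u v, bplus psi u 0 * bplus psi v 0 = \sum_(w <- qsh u v) bplus psi w 0.
Proof.
move=> phi_char u v; pose bp w : lser R := LSer (bplus_laurent w).
have bpE w : bp w = bplus psi w :> (int -> CC R) by [].
suff /(_ u v)/(congr1 (fun a : lser R => a 0)) : qsh_character bp.
  by rewrite lcoefM0 ?lcoef_sum; [ |exact: bplus_lbounded..].
apply: (@plus_char _ (@lpolar R) _ _ _ phi bm) => //.
- by move=> x; apply: lser_eq => n; rewrite /= /polar_part; case: (n < 0).
- exact: lpolarM.
- exact: lpolarM0.
- by apply: lser_eq => n; rewrite bmE bminus_nil.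
- exact: lser_eq.
- move=> w w0; apply: lser_eq => n; rewrite bmE bminusE // bprep_lser //.
  by move=> j _; exact: bminus_laurent.
- case=> // a w _; apply: lser_eq => n.
  by rewrite /= bprep_lser // => j _; exact: bminus_laurent.
Qed.

End LaurentBirkhoff.

Notation Re := complex.Re.
Notation Im := complex.Im.

(** * Complex numbers and power series *)

Section ComplexNorm.
Variable R : realType.
Local Notation C := (CC R).
Implicit Types (z w : C) (x : R).

Lemma CReD z w : Re (z + w) = Re z + Re w. Proof. by case: z; case: w. Qed.
Lemma CImD z w : Im (z + w) = Im z + Im w. Proof. by case: z; case: w. Qed.
Lemma CReB z w : Re (z - w) = Re z - Re w. Proof. by case: z; case: w. Qed.
Lemma CImB z w : Im (z - w) = Im z - Im w. Proof. by case: z; case: w. Qed.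
Lemma CReM z w : Re (z * w) = Re z * Re w - Im z * Im w.
Proof. by case: z; case: w. Qed.
Lemma CImM z w : Im (z * w) = Re z * Im w + Im z * Re w.
Proof. by case: z; case: w. Qed.

Lemma Re_natM (n : nat) z : Re (n%:R * z) = n%:R * Re z.
Proof.
by rewrite -[(n%:R : C)](rmorph_nat (real_complex R)) CReM /= mul0r subr0.
Qed.

Lemma normc_ge0 z : 0 <= normc z.
Proof. by case: z => a b; exact: sqrtr_ge0. Qed.

Lemma normcE z : `|z| = (normc z)%:C%C :> R[i].
Proof. by case: z. Qed.

Lemma normcB z w : normc (z - w) = normc (w - z).
Proof. by rewrite -normcN opprB. Qed.

Lemma normc_real x : normc (x%:C%C : C) = `|x|.
Proof. by rewrite /normc /= expr0n /= addr0 sqrtr_sqr. Qed.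

Lemma normcX z n : normc (z ^+ n) = normc z ^+ n.
Proof. by elim: n => [|n IH]; rewrite ?normc1 // !exprS normcM IH. Qed.

Lemma normc_nat n : normc (n%:R : C) = n%:R.
Proof. by rewrite -[n%:R](rmorph_nat (real_complex R)) normc_real normr_nat. Qed.

Lemma normc_sum I (r : seq I) (P : pred I) (F : I -> C) :
  normc (\sum_(i <- r | P i) F i) <= \sum_(i <- r | P i) normc (F i).
Proof.
elim/big_ind2: _ => [|x y z w xy zw|//]; first by rewrite normc0.
exact: le_trans (le_normcD _ _) (lerD xy zw).
Qed.

Lemma ler_Re_normc z : `|Re z| <= normc z.
Proof.
case: z => a b; rewrite /= -sqrtr_sqr ler_sqrt ?addr_ge0 ?sqr_ge0 //.
by rewrite lerDl sqr_ge0.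
Qed.

Lemma ler_Im_normc z : `|Im z| <= normc z.
Proof.
case: z => a b; rewrite /= -sqrtr_sqr ler_sqrt ?addr_ge0 ?sqr_ge0 //.
by rewrite lerDr sqr_ge0.
Qed.

Lemma complexRI z : z = (Re z)%:C%C + 'i%C * (Im z)%:C%C.
Proof. by case: z => a b; apply/eqP; rewrite eq_complex /=; apply/andP; split; apply/eqP; ring. Qed.

Lemma normc_le_ReIm z : normc z <= `|Re z| + `|Im z|.
Proof.
rewrite {1}[z]complexRI; apply: le_trans (le_normcD _ _) _.
rewrite normcM !normc_real lerD2l.
by rewrite /normc /= expr0n expr1n add0r sqrtr1 mul1r.
Qed.

Lemma normc_gt0 z : (0 < normc z) = (z != 0).
Proof.
rewrite lt_def normc_ge0 andbT; congr (~~ _); apply/eqP/eqP => [/eq0_normc//|->].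
exact: normc0.
Qed.

Lemma lerB_normc z w : normc z - normc w <= normc (z - w).
Proof. by rewrite lerBlDr -[in X in X <= _](subrK w z) le_normcD. Qed.

(** The norm of [R[i]] takes its values in [R[i]]; here and in [nbhsCP] the topology is restated
    with the real modulus [normc]. *)
Lemma cvgCP T (F : set_system T) (FF : Filter F) (f : T -> C) (l : C) :
  f @ F --> l <-> forall e : R, 0 < e -> \forall x \near F, normc (l - f x) < e.
Proof.
split=> [/cvgrPdist_lt fl e e0|fl].
  have e0' : 0 < e%:C%C :> R[i] by rewrite ltcR.
  by apply: filterS (fl _ e0') => x; rewrite normcE ltcR.
apply/cvgrPdist_lt => -[a b]; rewrite ltcE /= => /andP[/eqP -> a0].
by apply: filterS (fl _ a0) => x; rewrite normcE ltcR.
Qed.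

Lemma nbhsCP (a : C) (P : set C) : (\forall z \near a, P z) <->
  exists2 e : R, 0 < e & forall z, normc (z - a) < e -> P z.
Proof.
split=> [/nbhs_ballP[[e e']]|[e e0 eP]].
  rewrite /= ltcE /= => /andP[/eqP-> e0] aP; exists e => // z za; apply: aP.
  by rewrite -ball_normE /= normcE ltcR normcB.
apply/nbhs_ballP; exists (e%:C%C); first by rewrite /= ltcR.
by move=> z; rewrite -ball_normE /= normcE ltcR normcB; exact: eP.
Qed.

End ComplexNorm.

(** * The complex exponential *)

Section ComplexExp.
Variable R : realType.
Local Notation C := (CC R).
Implicit Types (z w : C) (x : R).

Lemma cexpD z w : cexp (z + w) = cexp z * cexp w.
Proof.
case: z => a b; case: w => c d; rewrite /cexp /= expRD cosD sinD.
by apply/eqP; rewrite eq_complex /=; apply/andP; split; apply/eqP; ring.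
Qed.

Lemma cexp0 : cexp (0 : C) = 1.
Proof.
by rewrite /cexp /= expR0 cos0 sin0; apply/eqP; rewrite eq_complex /= !mul0r !mul1r
  subr0 addr0 !eqxx.
Qed.

Lemma normc_cexp z : normc (cexp z) = expR (Re z).
Proof.
rewrite /cexp normcM normc_real ger0_norm ?expR_ge0 // /normc cos2Dsin2.
by rewrite sqrtr1 mulr1.
Qed.

Lemma cexp_neq0 z : cexp z != 0.
Proof. by rewrite -normc_gt0 normc_cexp expR_gt0. Qed.

Lemma cexpN z : cexp (- z) = (cexp z)^-1.
Proof.
by apply: (mulfI (cexp_neq0 z)); rewrite -cexpD subrr cexp0 mulfV // cexp_neq0.
Qed.

Lemma cexpX z n : cexp z ^+ n = cexp (n%:R * z).
Proof.
elim: n => [|n IH]; first by rewrite mul0r cexp0.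
by rewrite exprS IH -cexpD -nat1r mulrDl mul1r.
Qed.

Lemma cexp_real x : cexp (x%:C%C : C) = (expR x)%:C%C.
Proof.
rewrite /cexp /= cos0 sin0; apply/eqP.
by rewrite eq_complex /= !mulr1 !mulr0 subr0 add0r !eqxx.
Qed.

End ComplexExp.

(** * Complex-valued functions of a real variable *)

Section RealDerivative.
Variable R : realType.
Local Notation C := (CC R).
Implicit Types (f g : R -> C) (x : R) (c d e : C).

(** Taken by components, so that the real mean value theorem applies to each of them. *)
Definition rderiv g x d : Prop :=
  is_derive x 1 (fun y => Re (g y)) (Re d) /\
  is_derive x 1 (fun y => Im (g y)) (Im d).

Lemma rderiv_cst c x : rderiv (fun=> c) x 0.
Proof. by split => /=; exact: is_derive_cst. Qed.

Lemma rderivD f g x c d :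
  rderiv f x c -> rderiv g x d -> rderiv (fun y => f y + g y) x (c + d).
Proof.
move=> [f1 f2] [g1 g2]; split; rewrite ?CReD ?CImD.
  rewrite (_ : (fun y => _) = (fun y => Re (f y)) \+ (fun y => Re (g y))).
    exact: is_deriveD.
  by apply/funext => y /=; rewrite ?CReD ?CImD.
rewrite (_ : (fun y => _) = (fun y => Im (f y)) \+ (fun y => Im (g y))).
  exact: is_deriveD.
by apply/funext => y /=; rewrite ?CReD ?CImD.
Qed.

Lemma rderivM f g x c d : rderiv f x c -> rderiv g x d ->
  rderiv (fun y => f y * g y) x (f x * d + c * g x).
Proof.
move=> [f1 f2] [g1 g2]; split.
  rewrite (_ : (fun y => _) =
    (fun y => Re (f y)) * (fun y => Re (g y)) - (fun y => Im (f y)) * (fun y => Im (g y))).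
    apply: is_derive_eq; rewrite /GRing.scale /= CReD !CReM /=; ring.
  by apply/funext => y /=; rewrite CReM.
rewrite (_ : (fun y => _) =
  (fun y => Re (f y)) * (fun y => Im (g y)) + (fun y => Im (f y)) * (fun y => Re (g y))).
  apply: is_derive_eq; rewrite /GRing.scale /= CImD !CImM /=; ring.
by apply/funext => y /=; rewrite CImM.
Qed.

Lemma rderiv_eq f x c d : rderiv f x c -> c = d -> rderiv f x d.
Proof. by move=> ? <-. Qed.

Lemma rderivZ c g x d : rderiv g x d -> rderiv (fun y => c * g y) x (c * d).
Proof.
move=> gd; apply: rderiv_eq (rderivM (rderiv_cst c x) gd) _.
by rewrite mul0r addr0.
Qed.

Lemma rderivN g x d : rderiv g x d -> rderiv (fun y => - g y) x (- d).
Proof.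
move=> /(@rderivZ (-1)); rewrite mulN1r.
by rewrite (_ : (fun y => _) = (fun y => - g y)) //; apply/funext => y; rewrite mulN1r.
Qed.

Lemma rderivB f g x c d :
  rderiv f x c -> rderiv g x d -> rderiv (fun y => f y - g y) x (c - d).
Proof. by move=> fc /rderivN; exact: rderivD. Qed.

Lemma rderiv_sum n (F : 'I_n -> R -> C) x (D : 'I_n -> C) :
  (forall i, rderiv (F i) x (D i)) ->
  rderiv (fun y => \sum_(i < n) F i y) x (\sum_(i < n) D i).
Proof.
move=> FD; elim: n => [|n IH] in F D FD *.
  rewrite big_ord0 (_ : (fun y => _) = fun=> 0); first exact: rderiv_cst.
  by apply/funext => y; rewrite big_ord0.
rewrite big_ord_recr (_ : (fun y => _) =
  (fun y => \sum_(i < n) F (widen_ord (leqnSn n) i) y + F ord_max y)) /=.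
  by apply: rderivD => //; apply: IH.
by apply/funext => y; rewrite big_ord_recr.
Qed.

Lemma rderiv_real (g : R -> R) x (d : R) : is_derive x 1 g d ->
  rderiv (fun y => (g y)%:C%C) x d%:C%C.
Proof. by move=> gd; split => //=; exact: is_derive_cst. Qed.

Lemma rderiv_id x : rderiv (fun y => y%:C%C) x 1.
Proof. by apply: (@rderiv_real id x 1); exact: is_derive_id. Qed.

Lemma rderiv_cexp c (g : R -> R) x (d : R) : is_derive x 1 g d ->
  rderiv (fun y => cexp (c * (g y)%:C%C)) x (c * d%:C%C * cexp (c * (g x)%:C%C)).
Proof.
case: c => a b gd.
have E y : cexp ((a +i* b)%C * (g y)%:C%C) =
    (expR (a * g y))%:C%C * (cos (b * g y) +i* sin (b * g y))%C.
  rewrite /cexp /=; congr ((expR _)%:C%C * (cos _ +i* sin _)%C); ring.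
rewrite E; under eq_fun do rewrite E.
have ag (e : R) : is_derive x 1 (fun y => e * g y) (e * d).
  by have := is_deriveZ e gd; rewrite /GRing.scale.
have De : is_derive x 1 (fun y => expR (a * g y)) (a * d * expR (a * g x)).
  apply: (@is_derive_eq _ _ _ _ _ _ _ _ (is_derive1_comp _ (ag a))).
  by rewrite /GRing.scale /= mulrC.
have Dc : is_derive x 1 (fun y => cos (b * g y)) (- (b * d * sin (b * g x))).
  apply: (@is_derive_eq _ _ _ _ _ _ _ _ (is_derive1_comp _ (ag b))).
  by rewrite /GRing.scale /=; ring.
have Ds : is_derive x 1 (fun y => sin (b * g y)) (b * d * cos (b * g x)).
  apply: (@is_derive_eq _ _ _ _ _ _ _ _ (is_derive1_comp _ (ag b))).
  by rewrite /GRing.scale /=; ring.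
have Dcs : rderiv (fun y => (cos (b * g y) +i* sin (b * g y))%C) x
  (- (b * d * sin (b * g x)) +i* (b * d * cos (b * g x)))%C by split.
apply: rderiv_eq (rderivM (rderiv_real De) Dcs) _.
by apply/eqP; rewrite eq_complex /=; apply/andP; split; apply/eqP; ring.
Qed.

Lemma is_derive_bound (f f' : R -> R) (a b B : R) : a <= b ->
  (forall x, a <= x <= b -> is_derive x 1 f (f' x)) ->
  (forall x, a <= x <= b -> `|f' x| <= B) -> `|f b - f a| <= B * (b - a).
Proof.
move=> ab fD fB; have [c cab ->] := @MVT_segment R f f' a b ab
  (fun x xab => fD x ltac:(by move: xab; rewrite in_itv /= => /andP[/ltW-> /ltW->]))
  ltac:(apply: derivable_within_continuous => x; rewrite in_itv /= => xab;
    exact: (@ex_derive _ _ _ _ _ _ _ (fD x xab))).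
rewrite normrM (ger0_norm (x := b - a)) ?subr_ge0 // ler_wpM2r ?subr_ge0 //.
by apply: fB; move: cab; rewrite in_itv.
Qed.

(** The mean value theorem fails for complex values; bounding the two components separately costs
    the factor 2, which reappears in many constants below. *)
Lemma rderiv_bound g (g' : R -> C) (a b B : R) : a <= b ->
  (forall x, a <= x <= b -> rderiv g x (g' x)) ->
  (forall x, a <= x <= b -> normc (g' x) <= B) ->
  normc (g b - g a) <= 2 * B * (b - a).
Proof.
move=> ab gD gB; apply: le_trans (normc_le_ReIm _) _.
rewrite -mulrA mulr2n mulrDl mul1r CReB CImB lerD //.
  apply: (@is_derive_bound (fun y => Re (g y)) (fun y => Re (g' y))) => // x xab.
    by have [] := gD _ xab.
  exact: le_trans (ler_Re_normc _) (gB _ xab).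
apply: (@is_derive_bound (fun y => Im (g y)) (fun y => Im (g' y))) => // x xab.
  by have [] := gD _ xab.
exact: le_trans (ler_Im_normc _) (gB _ xab).
Qed.

End RealDerivative.

(** * Limits of complex sequences *)

Section ComplexSequences.
Variable R : realType.
Local Notation C := (CC R).
Implicit Types (u v : nat -> C) (l m : C).

Lemma cvgn_ext u v l : (forall n, u n = v n) -> u @ \oo --> l -> v @ \oo --> l.
Proof. by move=> uv; rewrite (funext uv). Qed.

Lemma cvgnD u v l m : u @ \oo --> l -> v @ \oo --> m ->
  (fun n => u n + v n) @ \oo --> l + m.
Proof. move=> ul vm; exact (cvgD ul vm). Qed.

Lemma cvgnB u v l m : u @ \oo --> l -> v @ \oo --> m ->
  (fun n => u n - v n) @ \oo --> l - m.
Proof. move=> ul vm; exact (cvgB ul vm). Qed.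

Lemma cvgnM u v l m : u @ \oo --> l -> v @ \oo --> m ->
  (fun n => u n * v n) @ \oo --> l * m.
Proof. move=> ul vm; exact (cvgM ul vm). Qed.

Lemma cvgnZ u l m : u @ \oo --> l -> (fun n => m * u n) @ \oo --> m * l.
Proof. move=> ul; exact (cvgM (cvg_cst m) ul). Qed.

Lemma cvgnV u l : l != 0 -> u @ \oo --> l -> (fun n => (u n)^-1) @ \oo --> l^-1.
Proof. move=> l0 ul; exact (cvgV l0 ul). Qed.

Lemma cvgnS u l : (fun n => u n.+1) @ \oo --> l <-> u @ \oo --> l.
Proof. by rewrite (cvg_shiftS u). Qed.

Lemma cvgn_uniq u l m : u @ \oo --> l -> u @ \oo --> m -> l = m.
Proof. move=> ul um; exact (cvg_unique (@norm_hausdorff _ _) ul um). Qed.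

Lemma cvgn_sum n (F : 'I_n -> nat -> C) (L : 'I_n -> C) :
  (forall i, F i @ \oo --> L i) ->
  (fun N => \sum_(i < n) F i N) @ \oo --> \sum_(i < n) L i.
Proof.
elim: n F L => [|n IH] F L FL.
  rewrite big_ord0 (_ : (fun N => _) = fun=> 0); first exact (cvg_cst (0 : C)).
  by apply/funext => N; rewrite big_ord0.
rewrite big_ord_recr /=; apply: (cvgn_ext _ (cvgnD
  (IH (fun i => F (widen_ord (leqnSn n) i)) _ (fun i => FL _)) (FL ord_max))) => N.
by rewrite big_ord_recr.
Qed.

Lemma cvgn_near u v l : (\forall n \near \oo, u n = v n) ->
  u @ \oo --> l -> v @ \oo --> l.
Proof.
move=> uv; apply: cvg_trans; apply: near_eq_cvg.
by move: uv; apply: filterS => n ->.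
Qed.

End ComplexSequences.

(** * Taylor's formula with a crude remainder *)

Section Taylor.
Variable R : realType.
Local Notation C := (CC R).

Lemma is_derive_divfact (a y : R) n :
  is_derive y 1 (fun t => (t - a) ^+ n.+1 / n.+1`!%:R) ((y - a) ^+ n / n`!%:R).
Proof.
have H : is_derive y 1 (fun t => t - a) 1.
  apply: (@is_derive_eq _ _ _ (fun t => t - a)).
  by rewrite subr0.
rewrite (_ : (fun t => _) = (n.+1`!%:R^-1 : R) *: (fun t => t - a) ^+ n.+1).
  apply: is_derive_eq.
  rewrite /GRing.scale /= factS natrM -mulr_natl mulr1.
  by field; rewrite nat1r !pnatr_eq0 /= -lt0n fact_gt0.
by apply/funext => t /=; rewrite fctE /GRing.scale /= mulrC.
Qed.

(** Each of the N applications of [rderiv_bound] costs 2 (b - a). No factorial is gained in the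
    remainder; this only shrinks the interval on which the exponential series is shown to
    converge. *)
Lemma taylor_bound (g : nat -> R -> C) (a b B : R) N : a <= b ->
  (forall n y, a <= y <= b -> rderiv (g n) y (g n.+1 y)) ->
  (forall y, a <= y <= b -> normc (g N y) <= B) ->
  normc (g 0 b - \sum_(i < N) g i a * ((b - a) ^+ i / i`!%:R)%:C%C) <=
  (2 * (b - a)) ^+ N * B.
Proof.
move=> ab gD gB.
(* All [g n] are treated at once: the derivative of the remainder of [g n] is the remainder of
   [g n.+1] with one term fewer. *)
suff rem_bound I n : (n + I)%N = N -> forall y, a <= y <= b ->
    normc (g n y - \sum_(i < I) g (n + i)%N a * ((y - a) ^+ i / i`!%:R)%:C%C) <=
    (2 * (b - a)) ^+ I * B.
  by apply: (rem_bound N 0); rewrite ?ab ?lexx.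
elim: I n => [|I IH] n nN y /andP[ay yb].
  rewrite big_ord0 subr0 expr0 mul1r -[n]addn0 nN; apply: gB.
  by rewrite ay yb.
pose r t := g n t - \sum_(i < I.+1) g (n + i)%N a * ((t - a) ^+ i / i`!%:R)%:C%C.
pose r' t := g n.+1 t - \sum_(i < I) g (n.+1 + i)%N a * ((t - a) ^+ i / i`!%:R)%:C%C.
have ra : r a = 0.
  rewrite /r big_ord_recl big1 => [|i _]; last first.
    by rewrite subrr expr0n /= mul0r mulr0.
  by rewrite addn0 fact0 divr1 mulr1 addr0 subrr.
have B0 : 0 <= B by apply: le_trans (gB a _); rewrite ?normc_ge0 // lexx.
have rB := @rderiv_bound _ r r' a y ((2 * (b - a)) ^+ I * B) ay.
rewrite -/(r y) -[r y]subr0 -ra; apply: le_trans (rB _ _) _.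
- move=> t /andP[at_ ty]; apply: rderivB; first by apply: gD; rewrite at_ (le_trans ty).
  rewrite (_ : (fun t => _) = (fun t => g n a +
    \sum_(i < I) g (n.+1 + i)%N a * ((t - a) ^+ i.+1 / i.+1`!%:R)%:C%C)).
    rewrite -[X in rderiv _ _ X]add0r; apply: rderivD; first exact: rderiv_cst.
    apply: rderiv_sum => i; apply: rderivZ; apply: rderiv_real.
    exact: is_derive_divfact.
  apply/funext => s; rewrite big_ord_recl addn0 fact0 divr1 mulr1.
  by congr (_ + _); apply: eq_bigr => i _; rewrite addSnnS.
- move=> t /andP[at_ ty]; apply: IH; first by rewrite addSnnS.
  by rewrite at_ (le_trans ty).
rewrite exprS -[X in _ <= X]mulrA; set P := (2 * (b - a)) ^+ I * B.
have P0 : 0 <= P.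
  by rewrite mulr_ge0 // exprn_ge0 // mulr_ge0 // subr_ge0 (le_trans ay).
have : P * (y - a) <= P * (b - a) by rewrite ler_wpM2l // lerD2r.
lra.
Qed.

End Taylor.

(** * Power series on the negative side of 0 *)

Section PowerSeries.
Variable R : realType.
Local Notation C := (CC R).
Implicit Types (c d : nat -> C) (g h : R -> C).

Lemma near0_leftP (P : set R) : (\forall z \near 0^'-, P z) <->
  exists2 e : R, 0 < e & forall z, - e < z < 0 -> P z.
Proof.
split.
  rewrite near_withinE => /nbhs_ballP[e /= e0 eP]; exists e => // z /andP[ez z0].
  by apply: eP => //; rewrite /ball /= sub0r normrN ltr0_norm // ltrNl.
move=> [e e0 eP]; rewrite near_withinE; apply/nbhs_ballP; exists e => //= z.
rewrite /ball /= sub0r normrN => ze z0; apply: eP; rewrite z0 andbT ltrNl.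
by rewrite -ltr0_norm.
Qed.

Definition psum_at c (z : R) (M : nat) : C := \sum_(0 <= i < M) c i * z%:C%C ^+ i.

Definition geom c := exists A r : R,
  [/\ 0 <= A, 0 < r & forall i, normc (c i) <= A * r ^+ i].

(** Convergence is tested on real z < 0, the side where q = exp z < 1; the geometric growth of the
    coefficients is carried along because products and quotients need it. *)
Definition pser c g := geom c /\
  \forall z \near (0 : R)^'-, psum_at c z @ \oo --> g z.

Definition convol c d : nat -> C := fun n => \sum_(i < n.+1) c i * d (n - i)%N.

Lemma geom2 c d : geom c -> geom d -> exists A r : R, [/\ 0 <= A, 0 < r,
  forall i, normc (c i) <= A * r ^+ i & forall i, normc (d i) <= A * r ^+ i].
Proof.
move=> [A [r [A0 r0 cA]]] [B [s [B0 s0 dB]]].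
exists (A + B), (r + s); split; rewrite ?addr_ge0 ?addr_gt0 // => i.
  apply: le_trans (cA i) _; apply: ler_pM; rewrite ?exprn_ge0 ?(ltW r0) ?lerDl //.
  by rewrite lerXn2r ?nnegrE ?addr_ge0 ?(ltW r0) ?(ltW s0) // lerDl (ltW s0).
apply: le_trans (dB i) _; apply: ler_pM; rewrite ?exprn_ge0 ?(ltW s0) ?lerDr //.
by rewrite lerXn2r ?nnegrE ?addr_ge0 ?(ltW r0) ?(ltW s0) // lerDr (ltW r0).
Qed.

Lemma geom_exprn (x : C) c : (forall i, normc (c i) <= 1) ->
  geom (fun i => c i * x ^+ i).
Proof.
move=> c1; exists 1, (normc x + 1); split; rewrite ?ltr_wpDl ?normc_ge0 // => i.
rewrite normcM normcX; apply: ler_pM; rewrite ?exprn_ge0 ?normc_ge0 //.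
by rewrite lerXn2r ?nnegrE ?addr_ge0 ?normc_ge0 // lerDl.
Qed.

Lemma geomD c d : geom c -> geom d -> geom (fun i => c i + d i).
Proof.
move=> /geom2 H /H[A [r [A0 r0 cA dA]]]; exists (A + A), r.
split; rewrite ?addr_ge0 // => i; rewrite mulrDl.
exact: le_trans (le_normcD _ _) (lerD _ _).
Qed.

Lemma geomZ (x : C) c : geom c -> geom (fun i => x * c i).
Proof.
move=> [A [r [A0 r0 cA]]]; exists (normc x * A), r.
split; rewrite ?mulr_ge0 ?normc_ge0 // => i.
by rewrite normcM -mulrA ler_wpM2l ?normc_ge0.
Qed.

(** The n + 1 terms of the convolution cost at most a factor 2 ^ n, absorbed by doubling the
    ratio. *)
Lemma geom_convol c d : geom c -> geom d -> geom (convol c d).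
Proof.
move=> /geom2 H /H[A [r [A0 r0 cA dA]]]; exists (A * A), (2 * r).
split; rewrite ?mulr_ge0 ?mulr_gt0 // => n.
apply: le_trans (normc_sum _ _ _) _.
apply: (@le_trans _ _ (\sum_(i < n.+1) A * A * r ^+ n)).
  apply: ler_sum => -[i /= i_n] _; rewrite normcM -[in r ^+ n](@subnKC i n) //.
  by rewrite exprD mulrACA ler_pM ?normc_ge0.
rewrite sumr_const card_ord exprMn -[X in X <= _]mulr_natl mulrA.
have le2 : (n.+1%:R : R) <= 2 ^+ n by rewrite -natrX ler_nat ltn_expl.
have := ler_wpM2r (mulr_ge0 (mulr_ge0 A0 A0) (exprn_ge0 n (ltW r0))) le2.
by rewrite !mulrA (_ : 2 ^+ n * A * A * r ^+ n = A * A * 2 ^+ n * r ^+ n) //; ring.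
Qed.

Lemma psum_at_poly c z M : psum_at c z M = (\poly_(i < M) c i).[z%:C%C].
Proof. by rewrite /psum_at horner_poly big_mkord. Qed.

Lemma cvgC_half (f : nat -> C) (l : C) (K : R) : 0 <= K ->
  (forall M, normc (l - f M) <= K * 2^-1 ^+ M) -> f @ \oo --> l.
Proof.
move=> K0 fl; apply/cvgCP => e e0.
have K1 : 0 < K + 1 by rewrite ltr_wpDl.
have : (2^-1 ^+ M : R) @[M --> \oo] --> 0.
  by apply: cvg_expr; rewrite ger0_norm ?invr_ge0 // invf_lt1 // ltr1n.
move=> /cvgrPdist_lt/(_ (e / (K + 1)) (divr_gt0 e0 K1)).
apply: filterS => M; rewrite sub0r normrN => xM.
apply: le_lt_trans (fl M) _.
rewrite ger0_norm ?exprn_ge0 ?invr_ge0 // ltr_pdivlMr // in xM.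
apply: le_lt_trans xM; rewrite mulrC ler_wpM2l ?exprn_ge0 ?invr_ge0 //.
by rewrite lerDl.
Qed.

(** The product of the two partial sums exceeds the partial sum of the convolution by M terms of
    degree at least M, each at most 2 M A ^ 2 x ^ M with x = r |z|. For x <= 1/8 the estimate M ^ 2
    <= 4 ^ M leaves a multiple of 2 ^ - M, whence the radius 1 / (8 r). *)
Lemma convol_psum_diff c d : geom c -> geom d ->
  \forall z \near (0 : R)^'-,
    (fun M => psum_at (convol c d) z M - psum_at c z M * psum_at d z M) @ \oo
      --> (0 : C).
Proof.
move=> /geom2 H /H[A [r [A0 r0 cA dA]]]; apply/near0_leftP.
exists ((8 * r)^-1); first by rewrite invr_gt0 mulr_gt0.
move=> z /andP[zr z0].
pose x := r * `|z|.
have x0 : 0 <= x by rewrite mulr_ge0 // ltW.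
have x8 : x <= 8^-1.
  rewrite /x ltr0_norm //; have /ltW zr' : - z < (8 * r)^-1 by lra.
  apply: le_trans (ler_wpM2l (ltW r0) zr') _.
  by rewrite invfM mulrCA mulfV ?gt_eqF // mulr1.
have dist M : normc (psum_at (convol c d) z M - psum_at c z M * psum_at d z M) <=
    2 * A * A * 2^-1 ^+ M.
  rewrite 2!psum_at_poly [psum_at d _ _]psum_at_poly -hornerM.
  set p := \poly_(i < M) c i; set q := \poly_(i < M) d i.
  have pqS : (size (p * q)%R <= M + M)%N.
    apply: leq_trans (size_polyMleq _ _) _.
    apply: leq_trans (leq_pred _) _.
    by rewrite leq_add // size_poly.
  rewrite [(p * q).[_]](horner_coef_wide _ pqS) horner_poly big_split_ord /=.
  rewrite [X in _ - (X + _)](eq_bigr (fun i : 'I_M => convol c d i * z%:C%C ^+ i)); last first.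
    move=> i _; congr (_ * _); rewrite coefM /convol.
    apply: eq_bigr => -[j /= ji] _; rewrite !coef_poly.
    by rewrite !ifT //; have := ltn_ord i; lia.
  rewrite opprD addrA subrr sub0r normcN.
  apply: le_trans (normc_sum _ _ _) _.
  apply: (@le_trans _ _ (\sum_(i < M) (M + M)%:R * (A * A) * x ^+ M)).
    apply: ler_sum => i _; rewrite normcM normcX normc_real.
    have pqn n : (n < M + M)%N -> normc (p * q)`_n <= (M + M)%:R * (A * A) * r ^+ n.
      move=> nM; rewrite coefM; apply: le_trans (normc_sum _ _ _) _.
      apply: (@le_trans _ _ (\sum_(j < n.+1) A * A * r ^+ n)); last first.
        rewrite sumr_const card_ord -[X in X <= _]mulr_natl mulrA.
        rewrite ler_wpM2r ?exprn_ge0 ?(ltW r0) // ler_wpM2r ?mulr_ge0 //.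
        by rewrite ler_nat.
      apply: ler_sum => -[j /= jn] _; rewrite !coef_poly normcM.
      rewrite -[in r ^+ n](@subnKC j n) // exprD mulrACA.
      apply: ler_pM; rewrite ?normc_ge0 //; case: ifP => _ //;
        by rewrite normc0 mulr_ge0 ?exprn_ge0 // ltW.
    apply: le_trans (ler_wpM2r _ (pqn _ _)) _; rewrite ?exprn_ge0 ?ltn_add2l //.
    rewrite -[X in X <= _]mulrA -exprMn -/x ler_wpM2l ?mulr_ge0 //.
    by rewrite ler_wiXn2l ?leq_addr // (le_trans x8) // invf_le1 // ler1n.
  rewrite sumr_const card_ord -[X in X <= _]mulr_natl.
  have -> : M%:R * ((M + M)%:R * (A * A) * x ^+ M) =
      2 * A * A * ((M * M)%:R * x ^+ M) by rewrite natrD natrM; ring.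
  rewrite ler_wpM2l ?mulr_ge0 //.
  apply: (@le_trans _ _ (4 ^+ M * 8^-1 ^+ M)).
    apply: ler_pM; rewrite ?exprn_ge0 //; last first.
      by rewrite lerXn2r // nnegrE invr_ge0.
    rewrite -natrX ler_nat -[4%N]/(2 * 2)%N expnMn leq_mul // ltnW // ltn_expl //.
  rewrite -exprMn (_ : 4 * 8^-1 = 2^-1) //; lra.
apply: (@cvgC_half _ _ (2 * A * A)) => [|M]; first by rewrite !mulr_ge0.
by rewrite sub0r normcN.
Qed.

End PowerSeries.

Section PowerSeriesTheory.
Variable R : realType.
Local Notation C := (CC R).
Implicit Types (c d : nat -> C) (g h : R -> C).

Lemma pser_eq c g h : pser c g -> (\forall z \near (0 : R)^'-, g z = h z) ->
  pser c h.
Proof.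
by move=> [cg gS] gh; split; [exact: cg|apply: filterS2 gh gS => z <-].
Qed.

Lemma pserD c d g h : pser c g -> pser d h ->
  pser (fun i => c i + d i) (fun z => g z + h z).
Proof.
move=> [cG cS] [dG dS]; split; first exact: geomD.
apply: filterS2 cS dS => z cz dz; refine (cvgn_ext _ (cvgnD cz dz)) => M.
by rewrite /psum_at -big_split; apply: eq_bigr => i _; rewrite mulrDl.
Qed.

Lemma pserZ (x : C) c g : pser c g -> pser (fun i => x * c i) (fun z => x * g z).
Proof.
move=> [cG cS]; split; first exact: geomZ.
apply: filterS cS => z cz; refine (cvgn_ext _ (cvgnZ cz)) => M.
by rewrite /psum_at big_distrr; apply: eq_bigr => i _; rewrite /= mulrA.
Qed.

Lemma pserM c d g h : pser c g -> pser d h ->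
  pser (convol c d) (fun z => g z * h z).
Proof.
move=> [cG cS] [dG dS]; split; first exact: geom_convol.
apply: filterS3 cS dS (convol_psum_diff cG dG) => z cz dz cdz.
rewrite -[_ * _]add0r; refine (cvgn_ext _ (cvgnD cdz (cvgnM cz dz))) => M.
by rewrite subrK.
Qed.

(* The quotient exists as soon as its formal coefficients grow geometrically. *)
Lemma pser_div c d g h : geom c -> pser d g -> pser (convol c d) h ->
  (\forall z \near (0 : R)^'-, g z != 0) -> pser c (fun z => h z / g z).
Proof.
move=> cG [dG dS] [_ cdS] g0; split; first exact: cG.
apply: filterS3 (filterI g0 dS) cdS (convol_psum_diff cG dG).
move=> z [gz dz] cdz diffz.
have cdlim : (fun M => psum_at c z M * psum_at d z M) @ \oo --> h z.
  rewrite -[h z]subr0; refine (cvgn_ext _ (cvgnB cdz diffz)) => M.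
  by rewrite subKr.
refine (cvgn_near _ (cvgnM cdlim (cvgnV gz dz))).
have /cvgCP/(_ (normc (g z)))-/(_ _)[|] := dz; first by rewrite normc_gt0.
move=> M0 _ dM; exists M0 => // M /dM gM.
rewrite -mulrA mulfV ?mulr1 //; apply/eqP => d0.
by move: gM; rewrite d0 subr0 ltxx.
Qed.

Lemma psum_at_recl c z M :
  psum_at c z M.+1 = c 0%N + z%:C%C * psum_at (fun i => c i.+1) z M.
Proof.
rewrite /psum_at big_nat_recl // expr0 mulr1; congr (_ + _).
by rewrite big_distrr; apply: eq_bigr => i _ /=; rewrite exprS mulrCA.
Qed.

Lemma pser_cons (x : C) c g : pser c g ->
  pser (fun i => if i is j.+1 then c j else x) (fun z => x + z%:C%C * g z).
Proof.
move=> [[A [r [A0 r0 cA]]] cS]; split.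
  exists (normc x + A / r), r; split; rewrite ?addr_ge0 ?normc_ge0 ?divr_ge0 ?(ltW r0) //.
  case=> [|i]; first by rewrite expr0 mulr1 lerDl divr_ge0 // ltW.
  apply: le_trans (cA i) _; rewrite exprS.
  have -> : (normc x + A / r) * (r * r ^+ i) = normc x * (r * r ^+ i) + A * r ^+ i.
    by field; rewrite gt_eqF.
  by rewrite lerDr !mulr_ge0 ?normc_ge0 ?exprn_ge0 // ltW.
apply: filterS cS => z cz; apply/cvgnS.
refine (cvgn_ext _ (cvgnD (cvg_cst (x : C)) (cvgnZ cz))) => M.
by rewrite psum_at_recl.
Qed.

Lemma pser_tail c g h : pser c g ->
  (\forall z \near (0 : R)^'-, g z = c 0%N + z%:C%C * h z) ->
  pser (fun i => c i.+1) h.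
Proof.
move=> [[A [r [A0 r0 cA]]] cS] gh; split.
  exists (A * r), r; split; rewrite ?mulr_ge0 ?(ltW r0) // => i.
  by rewrite -mulrA -exprS.
have z0 : \forall z \near (0 : R)^'-, z < 0 by exact: nbhs_left_lt.
apply: filterS3 cS gh z0 => z cz ghz z0.
have z0' : z%:C%C != 0 :> C by rewrite (inj_eq (@complexI _)) lt_eqF.
have -> : h z = (z%:C%C)^-1 * (g z - c 0%N) by rewrite ghz addrC addKr mulKf.
refine (cvgn_ext _ (cvgnZ (cvgnB ((cvgnS _ _).2 cz) (cvg_cst (c 0%N))))) => M.
by rewrite psum_at_recl addrC addKr mulKf.
Qed.

Lemma pser_cst (x : C) : pser (fun i => if i is 0 then x else 0) (fun=> x).
Proof.
split.
  exists (normc x), 1; split; rewrite ?normc_ge0 // => -[|i]; rewrite expr1n mulr1 //.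
  by rewrite normc0 normc_ge0.
near=> z; apply/cvgnS; refine (cvgn_ext _ (cvg_cst (x : C))) => M.
rewrite psum_at_recl /psum_at big1 ?mulr0 ?addr0 // => i _.
by rewrite mul0r.
Unshelve. all: by end_near. Qed.

Lemma geom_sum_le (x : R) M : 0 <= x <= 2^-1 -> \sum_(0 <= i < M) x ^+ i <= 2.
Proof.
move=> /andP[x0 x2]; have := subrX1 x M; rewrite -(big_mkord xpredT (GRing.exp x)).
have := exprn_ge0 M x0; move: (x ^+ M) (\sum_(_ <= i < _) _) => y S y0 yS.
by nra.
Qed.

Lemma pser_bounded c g : pser c g ->
  exists2 K : R, 0 <= K & \forall z \near (0 : R)^'-, normc (g z) <= K.
Proof.
move=> [[A [r [A0 r0 cA]]] cS]; exists (2 * A + 1); first by rewrite addr_ge0 ?mulr_ge0.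
have small : \forall z \near (0 : R)^'-, r * `|z| <= 2^-1.
  apply/near0_leftP; exists (2 * r)^-1; first by rewrite invr_gt0 mulr_gt0.
  move=> z /andP[zr z0]; rewrite ltr0_norm //.
  have /ltW zr' : - z < (2 * r)^-1 by lra.
  apply: le_trans (ler_wpM2l (ltW r0) zr') _.
  by rewrite invfM mulrCA mulfV ?gt_eqF // mulr1.
apply: filterS2 cS small => z /cvgCP/(_ 1 ltr01)[M _ /(_ M (leqnn M)) gM] rz.
rewrite -[g z](subrK (psum_at c z M)) addrC.
apply: le_trans (le_normcD _ _) (lerD _ (ltW gM)).
apply: le_trans (normc_sum _ _ _) _.
apply: (@le_trans _ _ (A * \sum_(0 <= i < M) (r * `|z|) ^+ i)).
  rewrite big_distrr; apply: ler_sum => i _ /=.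
  rewrite normcM normcX normc_real exprMn mulrA ler_wpM2r ?exprn_ge0 //.
by rewrite mulrC ler_wpM2r // geom_sum_le // rz mulr_ge0 // ltW.
Qed.

Lemma pser_div_id c g : pser c g ->
  pser (fun i => c i.+1) (fun z => (z%:C%C)^-1 * (g z - c 0%N)).
Proof.
move=> cg; apply: pser_tail cg _; near=> z; rewrite mulVKf ?subrKC //.
by rewrite (inj_eq (@complexI _)) lt_eqF //; near: z; exact: nbhs_left_lt.
Unshelve. all: by end_near. Qed.

Lemma pser_asymp c g : pser c g -> exists2 K : R, 0 <= K &
  \forall z \near (0 : R)^'-, normc (g z - c 0%N) <= K * `|z|.
Proof.
move=> /pser_div_id/pser_bounded[K K0 gK]; exists K => //.
have z0 : \forall z \near (0 : R)^'-, z < 0 by exact: nbhs_left_lt.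
apply: filterS2 gK z0 => z; rewrite normcM normcV normc_real => gK z0.
by rewrite -ler_pdivrMr ?normr_gt0 ?lt_eqF // mulrC.
Qed.

Lemma pser_uniq0 c d g : pser c g -> pser d g -> c 0%N = d 0%N.
Proof.
move=> /pser_asymp[K K0 cK] /pser_asymp[L L0 dL]; apply/eqP; apply: contraT => cd.
pose D := normc (c 0%N - d 0%N).
have D0 : 0 < D by rewrite normc_gt0 subr_eq0.
have KL : 0 < K + L + 1 by rewrite ltr_wpDl ?addr_ge0.
have small : \forall z \near (0 : R)^'-, `|z| < D / (K + L + 1).
  apply/near0_leftP; exists (D / (K + L + 1)); first exact: divr_gt0.
  by move=> z /andP[zD z0]; rewrite ltr0_norm // ltrNl.
have [e e0 He] := (near0_leftP _).1 (filterI (filterI cK dL) small).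
have [|[cz dz] zD] := He (- (e / 2)); first by apply/andP; split; lra.
set z := - (e / 2) in cz dz zD.
have : D <= (K + L) * `|z|.
  rewrite /D (_ : _ - _ = (g z - d 0%N) - (g z - c 0%N)); last by ring.
  by rewrite mulrDl addrC; apply: le_trans (le_normcD _ _) _; rewrite normcN lerD.
rewrite ltr_pdivlMr // in zD => DK; suff : D < D by rewrite ltxx.
by apply: le_lt_trans DK (le_lt_trans _ zD); rewrite mulrC ler_wpM2l ?lerDl.
Qed.

(** Constant terms are compared as z tends to 0 from the left, and division by z shifts the series;
    agreement on one side of 0 is enough. *)
Lemma pser_uniq c d g : pser c g -> pser d g -> c = d.
Proof.
move=> cg dg; apply/funext => n; elim: n => [|n IH] in c d g cg dg *.
  exact: pser_uniq0 cg dg.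
move: (pser_div_id cg) (pser_div_id dg); rewrite (pser_uniq0 cg dg) => cg' dg'.
exact: (IH (fun i => c i.+1) (fun i => d i.+1) _ cg' dg').
Qed.

End PowerSeriesTheory.

(** * Bernoulli numbers *)

Section Bernoulli.

(** The recursion uses all earlier values, so these are accumulated in a list. *)
Fixpoint ber_list n : seq rat :=
  if n is m.+1 then let s := ber_list m in
    rcons s (- (m == 0%N)%:R - \sum_(i < m) s`_i / (m.+1 - i)`!%:R)
  else [::].

(* x / (1 - exp x) = sum_n ber n * x ^ n; thus ber n = - B_n / n! *)
Definition ber n : rat := (ber_list n.+1)`_n.

Lemma size_ber_list n : size (ber_list n) = n.
Proof. by elim: n => //= n IH; rewrite size_rcons IH. Qed.

Lemma nth_ber_list n i : (i < n)%N -> (ber_list n)`_i = ber i.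
Proof.
elim: n => // n IH; rewrite ltnS leq_eqVlt => /orP[/eqP->//|i_n].
by rewrite /= nth_rcons size_ber_list i_n IH.
Qed.

Lemma berE n : ber n = - (n == 0%N)%:R - \sum_(i < n) ber i / (n.+1 - i)`!%:R.
Proof.
rewrite {1}/ber /= nth_rcons size_ber_list ltnn eqxx; congr (_ - _).
by apply: eq_bigr => i _; rewrite nth_ber_list.
Qed.

(** Coefficient form of ((exp x - 1) / x) (x / (1 - exp x)) = - 1. *)
Lemma ber_rec n : \sum_(i < n.+1) ber i / (n - i).+1`!%:R = - (n == 0%N)%:R.
Proof.
rewrite big_ord_recr /= subnn divr1 [ber n]berE addrCA.
have -> : \sum_(i < n) ber i / (n - i).+1`!%:R = \sum_(i < n) ber i / (n.+1 - i)`!%:R.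
  by apply: eq_bigr => i _; rewrite subSn // ltnW.
by rewrite subrr addr0.
Qed.

Lemma ber0 : ber 0 = -1. Proof. by rewrite berE big_ord0 subr0. Qed.

Lemma expn_fact n : (2 ^ n <= n.+1`!)%N.
Proof. by elim: n => // n IH; rewrite expnS factS leq_mul. Qed.

Lemma sum_half (F : numFieldType) n : \sum_(i < n) (2^-1 : F) ^+ (n - i) <= 1.
Proof.
suff -> : \sum_(i < n) (2^-1 : F) ^+ (n - i) = 1 - 2^-1 ^+ n.
  by rewrite lerBlDr lerDl exprn_ge0 // invr_ge0.
elim: n => [|n IH]; first by rewrite big_ord0 subrr.
rewrite big_ord_recl subn0 (eq_bigr (fun i : 'I_n => 2^-1 ^+ (n - i))) // IH.
by rewrite exprS; field.
Qed.

(** As (m + 1)! >= 2 ^ m, the recursion is dominated by a geometric sum below 1. This crude bound is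
    all that is needed for a positive radius of convergence. *)
Lemma ber_le1 n : `|ber n| <= 1.
Proof.
have [m le_m] := ubnP n; elim: m => // m IH in n le_m *.
case: n le_m => [|n] le_m; first by rewrite ber0.
rewrite berE oppr0 sub0r normrN; apply: le_trans (ler_norm_sum _ _ _) _.
apply: le_trans (sum_half _ n.+1); apply: ler_sum => -[i /= i_n] _.
rewrite normrM normfV normr_nat exprVn -[X in _ <= X]mul1r.
apply: ler_pM => //.
  by apply: IH; apply: leq_trans i_n _.
rewrite lef_pV2 ?posrE ?exprn_gt0 ?ltr0n ?fact_gt0 // -natrX ler_nat.
by rewrite (_ : (n.+2 - i = (n.+1 - i).+1)%N) ?expn_fact //; lia.
Qed.

End Bernoulli.

(** * The kernel exp x / (1 - exp x) *)

Section GeometricKernel.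
Variable R : realType.
Local Notation C := (CC R).
Implicit Types (al : C).

Definition cber n : C := ratr (ber n).

Lemma normc_ratr (x : rat) : normc (ratr x : C) = ratr `|x|.
Proof. by rewrite -(fmorph_rat (real_complex R)) normc_real ratr_norm. Qed.

Lemma normc_cber n : normc (cber n) <= 1.
Proof. by rewrite normc_ratr -(rmorph1 (@ratr R)) ler_rat ber_le1. Qed.

Lemma pser_cexp al :
  pser (fun i => (i`!%:R)^-1 * al ^+ i) (fun z => cexp (al * z%:C%C)).
Proof.
split.
  apply: geom_exprn => i; rewrite normcV normc_nat.
  by rewrite invf_le1 ?ltr0n ?fact_gt0 // ler1n fact_gt0.
have a1 : 0 < 4 * (normc al + 1) by rewrite mulr_gt0 // ltr_wpDl ?normc_ge0.
apply/near0_leftP; exists (4 * (normc al + 1))^-1; first by rewrite invr_gt0.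
move=> z /andP[za z0]; pose B := expR (normc al * - z).
apply: (@cvgC_half _ _ _ B) => [|M]; first exact: expR_ge0.
(* [taylor_bound] works to the right of its base point, so it is applied to exp (- al s) on
   [0, - z]. Its factor 2 makes 2 |al z| <= 1/2 necessary, which the radius 1 / (4 (|al| + 1))
   provides. *)
pose g n (s : R) : C := (- al) ^+ n * cexp (- al * s%:C%C).
have gD n y : rderiv (g n) y (g n.+1 y).
  apply: rderiv_eq (rderivZ _ (rderiv_cexp (- al) (is_derive_id y 1))) _.
  by rewrite /g exprSr mulr1 mulrA.
have gB y : 0 <= y <= - z -> normc (g M y) <= normc al ^+ M * B.
  move=> /andP[y0 yz]; rewrite /g normcM normcX normcN ler_wpM2l ?exprn_ge0 ?normc_ge0 //.
  rewrite normc_cexp ler_expR; apply: le_trans (ler_norm _) _.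
  apply: le_trans (ler_Re_normc _) _; rewrite normcM normcN normc_real ger0_norm //.
  by rewrite ler_wpM2l ?normc_ge0.
have z0' : 0 <= - z by lra.
have := taylor_bound z0' (fun n y _ => gD n y) gB.
rewrite /g expr0 mul1r subr0 raddfN /= mulrNN => tB.
rewrite /psum_at big_mkord; move: tB.
rewrite (eq_bigr (fun i : 'I_M => i`!%:R^-1 * al ^+ i * (z%:C)%C ^+ i)); last first.
  move=> i _; rewrite mulr0 cexp0 mulr1 rmorphM /= fmorphV /= rmorph_nat.
  rewrite rmorphXn /= rmorphN /= mulrA -exprMn mulrNN exprMn.
  by rewrite mulrC mulrA.
move=> /le_trans; apply; rewrite mulrA -exprMn [X in _ <= X]mulrC ler_wpM2r ?expR_ge0 //.
have n0 := normc_ge0 al.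
have az : - z * (normc al + 1) <= 4^-1.
  by rewrite -ler_pdivlMr ?ltr_wpDl // -invfM; lra.
rewrite lerXn2r ?nnegrE ?invr_ge0 ?mulr_ge0 //; nra.
Qed.

(* The sum of the exp (m x), m > 0, when it converges. *)
Definition geomker (x : C) : C := cexp x / (1 - cexp x).

Let pser_expm1 al : pser (fun n => (n.+1`!%:R)^-1 * al ^+ n.+1)
  (fun z => z%:C%C^-1 * (cexp (al * z%:C%C) - 1)).
Proof.
have := pser_div_id (pser_cexp al).
by rewrite fact0 invr1 expr0 mulr1.
Qed.

Let near_expm1 al : al != 0 ->
  \forall z \near (0 : R)^'-, (z%:C%C)^-1 * (cexp (al * z%:C%C) - 1) != 0 :> C.
Proof.
move=> al0; have [K K0 aK] := pser_asymp (pser_expm1 al).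
have D0 : 0 < normc al by rewrite normc_gt0.
have K1 : 0 < K + 1 by rewrite ltr_wpDl.
have small : \forall z \near (0 : R)^'-, `|z| < normc al / (K + 1).
  apply/near0_leftP; exists (normc al / (K + 1)); first exact: divr_gt0.
  by move=> z /andP[zD z0]; rewrite ltr0_norm // ltrNl.
apply: filterS2 aK small => z + zD; rewrite invr1 mul1r => aK.
apply/eqP => h0; move: aK; rewrite h0 sub0r normcN expr1.
rewrite ltr_pdivlMr // in zD; have := normr_ge0 z; nra.
Qed.

Lemma near_cexp_neq1 al : al != 0 ->
  \forall z \near (0 : R)^'-, cexp (al * z%:C%C) != 1.
Proof.
move=> /near_expm1; apply: filterS => z; apply: contra_neq => ->.
by rewrite subrr mulr0.
Qed.

(** The coefficients of x exp x / (1 - exp x) = x / (1 - exp x) - x, which differ from [cber] in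
    degree 1 only. *)
Definition bercoef n : C := cber n - (n == 1%N)%:R.

(** By [ber_rec] the candidate series times that of (exp (al z) - 1) / z is the constant - al, so
    [pser_div] yields its sum. *)
Lemma pser_geomker al : al != 0 ->
  pser (fun n => bercoef n * al ^+ n / al) (fun z => z%:C%C * geomker (al * z%:C%C)).
Proof.
move=> al0.
have convE n : convol (fun n => cber n * al ^+ n) (fun n => (n.+1`!%:R)^-1 * al ^+ n.+1) n
    = if n is 0%N then - al else 0.
  rewrite /convol; transitivity (ratr (\sum_(i < n.+1) ber i / (n - i).+1`!%:R) * al ^+ n.+1).
    rewrite rmorph_sum mulr_suml; apply: eq_bigr => -[i /= i_n] _.
    rewrite fmorph_div rmorph_nat /= mulrACA -exprD; congr (_ * _ * _ ^+ _).
    by rewrite addnS subnKC.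
  rewrite ber_rec rmorphN rmorph_nat; case: n => [|n] /=; first by rewrite mulN1r expr1.
  by rewrite oppr0 mul0r.
have uP : pser (fun n => cber n * al ^+ n)
    (fun z => (- al) / (z%:C%C^-1 * (cexp (al * z%:C%C) - 1))).
  apply: pser_div (pser_expm1 al) _ (near_expm1 al0).
    by apply: geom_exprn; exact: normc_cber.
  rewrite (funext convE); exact: pser_cst.
have zP : pser (fun n => (n == 1%N)%:R : C) (fun z => z%:C%C).
  have := pser_cons 0 (pser_cst (1 : C)).
  rewrite (_ : (fun i => _) = fun n => (n == 1%N)%:R).
    by move=> /pser_eq; apply; near=> z; rewrite add0r mulr1.
  by apply/funext => -[|[|n]].
have := pserD (pserZ al^-1 uP) (pserZ (-1) zP).
rewrite (_ : (fun i => _) = fun n => bercoef n * al ^+ n / al).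
  move=> /pser_eq; apply; near=> z.
  have z0 : z%:C%C != 0 :> C.
    by rewrite (inj_eq (@complexI _)) lt_eqF //; near: z; exact: nbhs_left_lt.
  have e1 : 1 - cexp (al * z%:C%C) != 0.
    by rewrite subr_eq0 eq_sym; near: z; exact: near_cexp_neq1.
  rewrite /geomker; field.
  by rewrite z0 e1 al0 -opprB oppr_eq0 e1.
apply/funext => n; rewrite /bercoef; case: eqP => [->|_]; last first.
  by rewrite mulr0 addr0 subr0; ring.
by rewrite expr1; field.
Unshelve. all: by end_near. Qed.

End GeometricKernel.

(** * Laurent expansions of functions *)

Section LaurentExpansion.
Variable R : realType.
Local Notation C := (CC R).
Implicit Types (f g : R -> C) (a b : int -> C).

Definition lexp_at N f a : Prop := lbounded N a /\
  pser (fun i : nat => a (i%:Z - N%:Z)) (fun z => z%:C%C ^+ N * f z).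

(** Equivalent to [is_laurent_expansion], with the growth of the coefficients made explicit; the
    calculus of expansions is done in this form. *)
Definition lexp f a : Prop := exists N, lexp_at N f a.

Lemma lexp_atS N f a : lexp_at N f a -> lexp_at N.+1 f a.
Proof.
move=> [aN cP]; split; first exact: lbounded_le aN.
have := pser_cons 0 cP.
rewrite (_ : (fun i => _) = fun i : nat => a (i%:Z - N.+1%:Z)).
  by move/pser_eq; apply; near=> z; rewrite add0r exprS mulrA.
apply/funext => -[|i]; first by rewrite aN //; lia.
by congr a; lia.
Unshelve. all: by end_near. Qed.

Lemma lexp_at_le N M f a : (N <= M)%N -> lexp_at N f a -> lexp_at M f a.
Proof.
move=> /subnK<-; elim: (M - N)%N => [|k IH] fa; first exact: fa.
exact: lexp_atS (IH fa).
Qed.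

Lemma lexp_eq f g a : lexp f a -> (\forall z \near (0 : R)^'-, f z = g z) ->
  lexp g a.
Proof.
move=> [N [aN cP]] fg; exists N; split; first exact: aN.
by apply: (pser_eq cP); apply: filterS fg => z ->.
Qed.

Lemma lexp1 : lexp (fun=> 1) (laurent1 R).
Proof.
exists 0%N; split; first exact: lbounded1.
have := pser_cst (1 : C).
rewrite (_ : (fun i => _) = fun i : nat => laurent1 R (i%:Z - 0%:Z)).
  by move/pser_eq; apply; near=> z; rewrite expr0 mul1r.
by apply/funext => -[|i].
Unshelve. all: by end_near. Qed.

Lemma lexpD f g a b : lexp f a -> lexp g b ->
  lexp (fun z => f z + g z) (fun n => a n + b n).
Proof.
move=> [N aP] [M bP]; exists (maxn N M).
have [aN cP] := lexp_at_le (leq_maxl N M) aP.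
have [bM dP] := lexp_at_le (leq_maxr N M) bP.
split; first by move=> n nN; rewrite aN ?bM ?addr0.
apply: pser_eq (pserD cP dP) _; near=> z; by rewrite mulrDr.
Unshelve. all: by end_near. Qed.

Lemma lexpZ (x : C) f a : lexp f a -> lexp (fun z => x * f z) (fun n => x * a n).
Proof.
move=> [N [aN cP]]; exists N; split; first by move=> n nN; rewrite aN ?mulr0.
apply: pser_eq (pserZ x cP) _; near=> z; by rewrite mulrCA.
Unshelve. all: by end_near. Qed.

Lemma lexpM f g a b : lexp f a -> lexp g b ->
  lexp (fun z => f z * g z) (laurent_mul a b).
Proof.
move=> [N [aN cP]] [M [bM dP]]; exists (N + M)%N; split.
  exact: lbounded_mul.
have := pserM cP dP.
rewrite (_ : convol _ _ = fun i : nat => laurent_mul a b (i%:Z - (N + M)%N%:Z)).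
  by move/pser_eq; apply; near=> z; rewrite mulrACA -exprD.
apply/funext => n; rewrite (@laurent_mulE _ N M _ _ _ n.+1 aN bM); last by lia.
by apply: eq_bigr => -[i /= i_n] _; congr (_ * b _); lia.
Unshelve. all: by end_near. Qed.

Lemma lexp_shift f a k : lexp f a ->
  lexp (fun z => (z%:C%C ^+ k)^-1 * f z) (fun n => a (n + k%:Z)).
Proof.
move=> [N [aN cP]]; exists (N + k)%N; split.
  by move=> n nN; apply: aN; lia.
rewrite (_ : (fun i : nat => _) = fun i : nat => a (i%:Z - N%:Z)).
  have z0 : \forall z \near (0 : R)^'-, z < 0 by exact: nbhs_left_lt.
  apply: (pser_eq cP); apply: filterS z0 => z z0.
  rewrite exprD -mulrA mulVKf // expf_neq0 //.
  by rewrite (inj_eq (@complexI _)) lt_eqF.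
by apply/funext => i; congr a; lia.
Qed.

Lemma lexp_sum I (r : seq I) (F : I -> R -> C) (A : I -> lser R) :
  (forall i, lexp (F i) (A i)) ->
  lexp (fun z => \sum_(i <- r) F i z) (\sum_(i <- r) A i : lser R).
Proof.
move=> FA; elim: r => [|i r IH].
  rewrite big_nil; have := lexpZ 0 lexp1.
  rewrite (_ : (fun n => _) = lcoef (0 : lser R)).
    by move/lexp_eq; apply; near=> z; rewrite big_nil mul0r.
  by apply/funext => n; rewrite mul0r lcoef0.
rewrite big_cons; apply: lexp_eq (lexpD (FA i) IH) _; near=> z.
by rewrite big_cons.
Unshelve. all: by end_near. Qed.

Lemma lexp_uniq f a b : lexp f a -> lexp f b -> a = b.
Proof.
move=> [N aP] [M bP].
have [aN cP] := lexp_at_le (leq_maxl N M) aP.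
have [bM dP] := lexp_at_le (leq_maxr N M) bP.
have ab := pser_uniq cP dP; apply/funext => n.
have [nN|Nn] := ltrP n (- (maxn N M)%:Z); first by rewrite aN ?bM.
have := congr1 (fun c : nat -> C => c (absz (n + (maxn N M)%:Z))) ab.
by rewrite /= (_ : _ - _ = n) //; lia.
Qed.

Lemma lexp_is_laurent f a : lexp f a -> a \in @is_laurent R.
Proof. by move=> [N [aN _]]; apply/is_laurentP; exists N. Qed.

Lemma exprz_sub (z : C) (i N : nat) : z != 0 ->
  z ^ (i%:Z - N%:Z) = (z ^+ N)^-1 * z ^+ i.
Proof. by move=> z0; rewrite expfzDr // exprnN mulrC. Qed.

Lemma lexp_is_laurent_expansion f a : lexp f a -> is_laurent_expansion f a.
Proof.
move=> [N [aN [_ cS]]]; exists N; split; first exact: aN.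
have z0 : \forall z \near (0 : R)^'-, z < 0 by exact: nbhs_left_lt.
apply: filterS2 z0 cS => z z0 cz.
have z0' : z%:C%C != 0 :> C by rewrite (inj_eq (@complexI _)) lt_eqF.
rewrite -[f z](mulKf (expf_neq0 N z0')).
refine (cvgn_ext _ (cvgnZ cz)) => M.
rewrite /psum_at big_distrr; apply: eq_bigr => i _ /=.
by rewrite exprz_sub // mulrCA.
Qed.

Lemma cvgn_bounded (u : nat -> C) (l : C) : u @ \oo --> l ->
  exists2 B : R, 0 <= B & forall n, normc (u n) <= B.
Proof.
move=> /cvgCP/(_ 1 ltr01)[M _ uM].
exists (\sum_(i < M) normc (u i) + normc l + 1).
  by rewrite !addr_ge0 ?normc_ge0 ?sumr_ge0 // => i _; exact: normc_ge0.
move=> n; have [nM|Mn] := ltnP n M.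
  rewrite (bigD1 (Ordinal nM)) //= -!addrA lerDl !addr_ge0 ?normc_ge0 ?sumr_ge0 //.
  by move=> i _; exact: normc_ge0.
have /ltW un : normc (l - u n) < 1 := uM n Mn; rewrite -[u n](subKr l).
apply: le_trans (le_normcD _ _) _; rewrite normcN lerD // lerDr.
by rewrite sumr_ge0 // => i _; exact: normc_ge0.
Qed.

(** As in Abel's lemma, convergence at a single z bounds the partial sums by some B, hence every
    term by 2 B, and so the coefficients grow at most like |z| ^ - i. *)
Lemma is_laurent_expansion_lexp f a : is_laurent_expansion f a -> lexp f a.
Proof.
move=> [N [aN cS]]; exists N; split; first exact: aN.
have z0 : \forall z \near (0 : R)^'-, z < 0 by exact: nbhs_left_lt.
have cP : \forall z \near (0 : R)^'-,
    psum_at (fun i : nat => a (i%:Z - N%:Z)) z @ \oo --> (z%:C%C ^+ N * f z : C).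
  apply: filterS2 z0 cS => z z0 cz.
  have z0' : z%:C%C != 0 :> C by rewrite (inj_eq (@complexI _)) lt_eqF.
  refine (cvgn_ext _ (cvgnZ cz)) => M.
  rewrite /psum_at big_distrr; apply: eq_bigr => i _ /=.
  by rewrite exprz_sub // mulrCA mulVKf ?expf_neq0.
split; last exact: cP.
have [e e0 He] := (near0_leftP _).1 (filterI z0 cP).
have [|{}z0 cz] := He (- (e / 2)); first by apply/andP; split; lra.
have [B B0 uB] := cvgn_bounded cz.
set z := - (e / 2) in z0 cz uB; have nz : 0 < `|z| by rewrite normr_gt0 lt_eqF.
exists (B + B), `|z|^-1; split; rewrite ?invr_gt0 ?addr_ge0 // => i.
rewrite exprVn ler_pdivlMr ?exprn_gt0 //.
have uBN := uB i; rewrite -normcN in uBN.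
have := le_trans (le_normcD _ _) (lerD (uB i.+1) uBN).
rewrite /psum_at big_nat_recr //= addrAC subrr add0r.
by rewrite normcM normcX normc_real.
Qed.

Lemma laurent_expansionE f a : lexp f a -> laurent_expansion f = a.
Proof.
move=> fa; rewrite /laurent_expansion; case: xgetP => [b _ /= fb|/(_ a)[]].
  exact: lexp_uniq (is_laurent_expansion_lexp fb) fa.
exact: lexp_is_laurent_expansion.
Qed.

(** The pole at 0 is simple, hence the shift by one; the polar coefficient, k = 0, is - 1 / al. *)
Definition lgeomker_coef (al : C) (n : int) : C :=
  if n + 1 is Posz k then bercoef R k * al ^+ k / al else 0.

Fact lgeomker_bounded al : lbounded 1 (lgeomker_coef al).
Proof. by move=> n n1; rewrite /lgeomker_coef; case E: (n + 1) => [k|//]; lia. Qed.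

Fact lgeomker_subproof al : lgeomker_coef al \in @is_laurent R.
Proof. by apply/is_laurentP; exists 1%N; exact: lgeomker_bounded. Qed.

Definition lgeomker al : lser R := LSer (lgeomker_subproof al).

Lemma lexp_geomker al : al != 0 ->
  lexp (fun z => geomker (al * z%:C%C)) (lgeomker al).
Proof.
move=> al0; exists 1%N; split; first exact: lgeomker_bounded.
have := pser_geomker al0.
rewrite (_ : (fun n => _) = fun i : nat => lgeomker al (i%:Z - 1%:Z)).
  by move/pser_eq; apply; near=> z; rewrite expr1.
by apply/funext => n; rewrite /= /lgeomker_coef subrK.
Unshelve. all: by end_near. Qed.

End LaurentExpansion.

(** * The q-zeta values *)

Section NestedSums.
Variable K : comNzRingType.
Implicit Types (f : nat -> K) (fs : seq (nat -> K)).

Lemma nested_sum_cons0 f fs : nested_sum (f :: fs) 0 = 0.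
Proof. by rewrite /= big_geq. Qed.

Lemma nested_sum_cons1 f fs : nested_sum (f :: fs) 1 = 0.
Proof. by rewrite /= big_geq. Qed.

Lemma nested_sum_consS f fs N :
  nested_sum (f :: fs) N.+2 = nested_sum (f :: fs) N.+1 + f N.+1 * nested_sum fs N.+1.
Proof. by rewrite [LHS]/= big_nat_recr. Qed.

(** Splitting off the largest index N, a product (S + f T) (S' + f' T') has three new terms; they
    match the three branches of the quasi-shuffle, the diagonal one through F (a + b) = F a F b. *)
Lemma nested_sum_qsh (F : letter -> nat -> K) :
  (forall a b m, F (add_letter a b) m = F a m * F b m) ->
  forall N u v, nested_sum [seq F a | a <- u] N * nested_sum [seq F a | a <- v] N =
    \sum_(w <- qsh u v) nested_sum [seq F a | a <- w] N.
Proof.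
move=> FD N [|a u] v; first by rewrite mul1r big_seq1.
case: v => [|b v]; first by rewrite mulr1 big_seq1.
case: N => [|N].
  have big0 (c : letter) (s : seq word) :
      \sum_(w <- s) nested_sum [seq F d | d <- c :: w] 0 = 0.
    by apply: big1 => w _; rewrite map_cons nested_sum_cons0.
  by rewrite big_qsh_cons !map_cons !nested_sum_cons0 mul0r !big0 !addr0.
elim: N a u b v => [|N IH] a u b v.
  have big0 (c : letter) (s : seq word) :
      \sum_(w <- s) nested_sum [seq F d | d <- c :: w] 1 = 0.
    by apply: big1 => w _; rewrite map_cons nested_sum_cons1.
  by rewrite big_qsh_cons !map_cons !nested_sum_cons1 mul0r !big0 !addr0.
have IH' x y : nested_sum [seq F a | a <- x] N.+1 * nested_sum [seq F a | a <- y] N.+1 =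
    \sum_(w <- qsh x y) nested_sum [seq F a | a <- w] N.+1.
  case: x => [|c x]; first by rewrite mul1r big_seq1.
  by case: y => [|d y]; [rewrite mulr1 big_seq1|exact: IH].
have splitS (c : letter) (s : seq word) :
    \sum_(w <- s) nested_sum [seq F d | d <- c :: w] N.+2 =
    \sum_(w <- s) nested_sum [seq F d | d <- c :: w] N.+1 +
    F c N.+1 * \sum_(w <- s) nested_sum [seq F d | d <- w] N.+1.
  by rewrite mulr_sumr -big_split; apply: eq_bigr => w _; rewrite map_cons nested_sum_consS.
rewrite big_qsh_cons !splitS -!IH' !map_cons !nested_sum_consS.
have := IH' (a :: u) (b :: v); rewrite big_qsh_cons FD.
move: (\sum_(w <- _) _) (\sum_(w <- _) _) (\sum_(w <- _) _) => X Y Z.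
rewrite !map_cons; move: (nested_sum (_ :: _) _) (nested_sum (_ :: _) _) => S T.
move: (nested_sum _ _) (nested_sum _ _) => S' T' E.
by rewrite mulrDl !mulrDr E; ring.
Qed.

(** Summation by parts. In the limit it replaces the sum of X ^ m over m > p by its value X ^ (p +
    1) / (1 - X), without rearranging a double series. *)
Lemma abel_sum (X : K) (h : nat -> K) N :
  (1 - X) * (\sum_(1 <= m < N.+1) X ^+ m * \sum_(1 <= p < m) h p) =
  X * (\sum_(1 <= p < N.+1) X ^+ p * h p) - X ^+ N.+1 * \sum_(1 <= p < N.+1) h p.
Proof.
elim: N => [|N IH]; first by rewrite !big_geq // !mulr0 subr0.
have recr (g : nat -> K) :
    \sum_(1 <= p < N.+2) g p = \sum_(1 <= p < N.+1) g p + g N.+1.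
  by rewrite big_nat_recr.
rewrite !recr mulrDr IH [X ^+ N.+2]exprS; ring.
Qed.

End NestedSums.

(** * Closed form of the q-zeta sums *)

Section QZeta.
Variables (R : realType) (t : CC R).
Hypothesis t_gt0 : 0 < Re t.
Local Notation C := (CC R).
Implicit Types (al : C) (k : letter) (w : word) (z : R).

Definition lettershift k i : C := (val k)%:R * t + i%:R.
Definition lettercoef k i : C := (-1) ^+ i *+ 'C(val k, i).

(* Summing from the outside, the sum of exp (al m z) over m > m_1 is
   geomker (al z) exp (al m_1 z): the exponents of successive letters add up. *)
Fixpoint nestker al w z : C :=
  geomker (al * z%:C%C) * (if w is k :: w' then
    \sum_(i < (val k).+1) lettercoef k i * nestker (al + lettershift k i) w' z
  else 1).

Definition qzker w z : C := if w is k :: w' then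
    \sum_(i < (val k).+1) lettercoef k i * nestker (lettershift k i) w' z
  else 1.

Definition qterm z k (m : nat) : C :=
  cpow (expR z) ((val k)%:R * m%:R * t) * ((1 - expR z ^+ m) ^+ val k)%:C%C.

Definition qsum z w N : C := nested_sum [seq qterm z k | k <- w] N.

Lemma Re_lettershift k i : 0 < Re (lettershift k i).
Proof.
rewrite /lettershift CReD Re_natM -[i%:R](rmorph_nat (real_complex R)) /=.
by rewrite ltr_pwDl // mulr_gt0 // ltr0n; exact: (valP k).
Qed.

Lemma normc_cexp_lt1 al z : 0 < Re al -> z < 0 -> normc (cexp (al * z%:C%C)) < 1.
Proof.
move=> al0 z0; rewrite normc_cexp expR_lt1 CReM /= mulr0 subr0.
by rewrite nmulr_llt0.
Qed.

Lemma qtermE z k m : qterm z k m =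
  \sum_(i < (val k).+1) lettercoef k i * cexp (lettershift k i * z%:C%C) ^+ m.
Proof.
have -> : qterm z k m = cexp ((val k)%:R * t * z%:C%C) ^+ m *
    (1 - cexp z%:C%C ^+ m) ^+ val k.
  rewrite /qterm /cpow expRK cexp_real cexpX; congr (cexp _ * _); first by ring.
  by rewrite !(rmorphXn, rmorphB, rmorph1).
rewrite exprBn mulr_sumr; apply: eq_bigr => i _.
rewrite expr1n mulr1 /lettercoef -mulrnAl mulrCA; congr (_ * _).
rewrite -!exprM mulnC exprM -exprMn [cexp z%:C%C ^+ i]cexpX -cexpD; congr (cexp _ ^+ _).
by rewrite /lettershift; ring.
Qed.

Lemma qterm_add z a b m : qterm z (add_letter a b) m = qterm z a m * qterm z b m.
Proof.
rewrite /qterm /= mulrACA /cpow -cexpD exprD rmorphM /= natrD.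
by congr (cexp _ * _); ring.
Qed.

Lemma cvgn_expr (x : C) : normc x < 1 -> (fun n => x ^+ n) @ \oo --> (0 : C).
Proof.
move=> x1; apply/cvgCP => e e0.
have /cvgrPdist_lt/(_ _ e0) : (normc x ^+ n : R) @[n --> \oo] --> 0.
  by apply: cvg_expr; rewrite ger0_norm // normc_ge0.
apply: filterS => n; rewrite !sub0r normrN normcN normcX ger0_norm //.
by rewrite exprn_ge0 // normc_ge0.
Qed.

Lemma cvg_geom_sum (x : C) : normc x < 1 ->
  (fun N => \sum_(1 <= m < N) x ^+ m) @ \oo --> (x / (1 - x) : C).
Proof.
move=> x1; have x1' : 1 - x != 0.
  by rewrite subr_eq0; apply: contraTneq x1 => <-; rewrite normc1 ltxx.
apply/cvgnS; rewrite (_ : x / (1 - x) = x / (1 - x) - x / (1 - x) * 0);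
  last by rewrite mulr0 subr0.
refine (cvgn_ext _ (cvgnB (cvg_cst (x / (1 - x) : C)) (cvgnZ (cvgn_expr x1)))) => N.
apply: (mulfI x1'); rewrite big_add1 /= (eq_bigr (fun i => x * x ^+ i)) => [|i _].
  rewrite -mulr_sumr mulrCA; have := subrX1 x N.
  rewrite -(big_mkord xpredT (GRing.exp x)); move: (\sum_(0 <= i < N) _) => S E.
  have -> : (1 - x) * S = 1 - x ^+ N by rewrite -[1 - x]opprB mulNr -E opprB.
  by field; rewrite x1'.
by rewrite exprS.
Qed.

(** The two limits are proved together: the binomial expansion of the first letter reduces both to
    weighted sums for the rest of the word, with the exponent [al] increased, and [abel_sum]
    restores the outer weight. *)
Lemma qsum_cvg z w : z < 0 -> qsum z w @ \oo --> qzker w z /\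
  forall al, 0 < Re al ->
    (fun N => \sum_(1 <= m < N) cexp (al * z%:C%C) ^+ m * qsum z w m) @ \oo
      --> nestker al w z.
Proof.
move=> z0; elim: w => [|k w [IH0 IH]].
  split; first exact (cvg_cst (1 : C)).
  move=> al al0; rewrite /= mulr1.
  refine (cvgn_ext _ (cvg_geom_sum (normc_cexp_lt1 al0 z0))) => N.
  by apply: eq_bigr => m _; rewrite mulr1.
have inner al : 0 <= Re al ->
    (fun N => \sum_(1 <= p < N) cexp (al * z%:C%C) ^+ p * (qterm z k p * qsum z w p))
    @ \oo --> (\sum_(i < (val k).+1) lettercoef k i * nestker (al + lettershift k i) w z : C).
  move=> al0.
  have al1 (i : 'I_(val k).+1) : 0 < Re (al + lettershift k i).
    by rewrite CReD ltr_wpDl // Re_lettershift.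
  refine (cvgn_ext _ (cvgn_sum (fun i => cvgnZ (IH _ (al1 i))))) => N.
  under eq_bigr do rewrite mulr_sumr.
  rewrite exchange_big; apply: eq_bigr => p _ /=.
  rewrite qtermE mulr_suml mulr_sumr; apply: eq_bigr => i _.
  rewrite mulrDl cexpD exprMn; ring.
have S0 : qsum z (k :: w) @ \oo --> qzker (k :: w) z.
  have /inner : 0 <= Re (0 : C) by [].
  under [X in _ --> X]eq_bigr do rewrite add0r.
  move=> H; refine (cvgn_ext _ H) => N; apply: eq_bigr => m _.
  by rewrite mul0r cexp0 expr1n mul1r.
split; first exact S0.
move=> al al0; have X1 := normc_cexp_lt1 al0 z0.
have := inner al (ltW al0); set L := \sum_(i < _) _ => innerL.
have -> : nestker al (k :: w) z = (1 - cexp (al * z%:C%C))^-1 *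
    (cexp (al * z%:C%C) * L - 0 * qzker (k :: w) z).
  rewrite mul0r subr0 -[nestker al (k :: w) z]/(geomker (al * z%:C%C) * L).
  by rewrite /geomker; ring.
set X := cexp (al * z%:C%C) in X1 innerL *.
have X0 : 1 - X != 0.
  by rewrite subr_eq0; apply: contraTneq X1 => <-; rewrite normc1 ltxx.
apply/cvgnS.
have cX : (fun n => X ^+ n.+1) @ \oo --> (0 : C) by apply/cvgnS; exact (cvgn_expr X1).
have cB := (cvgnS _ _).2 innerL; have cS := (cvgnS _ _).2 S0.
refine (cvgn_ext _ (cvgnZ (cvgnB (cvgnZ cB) (cvgnM cX cS)))) => N.
apply: (mulfI X0); rewrite mulVKf //.
by rewrite /qsum /= -(abel_sum X (fun p => qterm z k p * qsum z w p)).
Qed.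

Lemma qzetaE z w : z < 0 -> qzeta t (expR z) w = qzker w z.
Proof.
move=> z0; have [wS _] := qsum_cvg w z0.
exact (cvg_lim (@norm_hausdorff _ _) wS).
Qed.

Lemma qzker_qsh z u v : z < 0 ->
  qzker u z * qzker v z = \sum_(w <- qsh u v) qzker w z.
Proof.
move=> z0; have [uS _] := qsum_cvg u z0; have [vS _] := qsum_cvg v z0.
refine (cvgn_uniq (cvgnM uS vS) _).
suff sumS (r : seq word) : (fun N => \sum_(w <- r) qsum z w N) @ \oo
    --> (\sum_(w <- r) qzker w z : C).
  refine (cvgn_ext _ (sumS (qsh u v))) => N; symmetry.
  exact: nested_sum_qsh (qterm_add z) N u v.
elim: r => [|w r IH].
  by rewrite big_nil; refine (cvgn_ext _ (cvg_cst (0 : C))) => N; rewrite big_nil.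
have [wS _] := qsum_cvg w z0.
by rewrite big_cons; refine (cvgn_ext _ (cvgnD wS IH)) => N; rewrite big_cons.
Qed.

End QZeta.

(** * The regularised character and its constant terms *)

Section Character.
Variables (R : realType) (t : CC R).
Hypothesis t_gt0 : 0 < Re t.
Local Notation C := (CC R).
Implicit Types (al : C) (k : letter) (w : word) (z : R).

Fact lscale_subproof (c : C) (a : lser R) : (fun n => c * a n) \in @is_laurent R.
Proof.
have [N aN] := lserP a; apply/is_laurentP; exists N => n nN.
by rewrite aN ?mulr0.
Qed.
Definition lscale c a := LSer (lscale_subproof c a).

Fixpoint lnestker al w : lser R :=
  lgeomker al * (if w is k :: w' then
    \sum_(i < (val k).+1) lscale (lettercoef R k i) (lnestker (al + lettershift t k i) w')
  else 1).

Definition lqzker w : lser R := if w is k :: w' then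
    \sum_(i < (val k).+1) lscale (lettercoef R k i) (lnestker (lettershift t k i) w')
  else 1.

Lemma lexp_nestker al w : 0 < Re al -> lexp (nestker t al w) (lnestker al w).
Proof.
elim: w al => [|k w IH] al al0 /=.
  by apply: lexpM; [apply: lexp_geomker; apply: contraTneq al0 => ->; rewrite ltxx|
    exact: lexp1].
apply: lexpM; first by apply: lexp_geomker; apply: contraTneq al0 => ->; rewrite ltxx.
apply: (@lexp_sum R _ _ _ (fun i => lscale _ _)) => i.
apply: lexpZ; apply: IH; rewrite CReD ltr_wpDl ?(ltW al0) //.
exact: Re_lettershift.
Qed.

Lemma lexp_qzker w : lexp (qzker t w) (lqzker w).
Proof.
case: w => [|k w] /=; first exact: lexp1.
apply: (@lexp_sum R _ _ _ (fun i => lscale _ _)) => i.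
by apply: lexpZ; apply: lexp_nestker; exact: Re_lettershift.
Qed.

Lemma laurent_expansion_qzeta w :
  laurent_expansion (fun z => qzeta t (expR z) w) = lqzker w.
Proof.
apply: laurent_expansionE; apply: lexp_eq (lexp_qzker w) _.
by near=> z; rewrite qzetaE //; near: z; exact: nbhs_left_lt.
Unshelve. all: by end_near. Qed.

Lemma psiE w : psi t w = fun n => (-1) ^+ weight w * lqzker w (n + (weight w)%:Z).
Proof.
case: w => [|k w]; last by rewrite /psi laurent_expansion_qzeta.
by apply/funext => n; rewrite /weight big_nil expr0 mul1r addr0.
Qed.

Definition psifun w z : C := (-1) ^+ weight w * ((z%:C%C ^+ weight w)^-1 * qzker t w z).

Lemma lexp_psi w : lexp (psifun w) (psi t w).
Proof. by rewrite psiE; apply: lexpZ; apply: lexp_shift; exact: lexp_qzker. Qed.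

Lemma weight_cons k w : weight (k :: w) = (val k + weight w)%N.
Proof. by rewrite /weight big_cons. Qed.

(** The product is homogeneous for the weight, which makes the prefactor (-1) ^ |w| z ^ - |w| of
    [psi] multiplicative. *)
Lemma weight_qsh u v w : w \in qsh u v -> weight w = (weight u + weight v)%N.
Proof.
elim: u v w => [|a u IHu] v w; first by rewrite /= inE => /eqP->; rewrite /weight big_nil.
elim: v w => [|b v IHv] w; first by rewrite /= inE => /eqP->; rewrite {3}/weight big_nil addn0.
rewrite qsh_cons !mem_cat => /or3P[] /mapP[x xP ->]; rewrite !weight_cons.
- by rewrite (IHu _ _ xP) weight_cons; lia.
- by rewrite (IHv _ xP) weight_cons; lia.
- by rewrite (IHu _ _ xP) /=; lia.
Qed.

Definition lpsi w : lser R := LSer (lexp_is_laurent (lexp_psi w)).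

(** The identity holds between functions of z < 0 and passes to the series by uniqueness of
    expansions. *)
Lemma lpsi_char : qsh_character lpsi.
Proof.
move=> u v; apply: lser_eq => n.
have uv := lexpM (lexp_psi u) (lexp_psi v).
have sumP : lexp (fun z => \sum_(w <- qsh u v) psifun w z)
    (\sum_(w <- qsh u v) lpsi w : lser R).
  by apply: lexp_sum => w; exact: lexp_psi.
rewrite lcoefM; congr (_ n); refine (lexp_uniq uv (lexp_eq sumP _)).
near=> z; have z0 : z < 0 by near: z; exact: nbhs_left_lt.
rewrite /psifun mulrACA -exprD [X in _ * X]mulrACA -invfM -exprD qzker_qsh //.
rewrite !mulr_sumr; apply: eq_big_seq => w wP.
by rewrite (weight_qsh wP).
Unshelve. all: by end_near. Qed.

Lemma zetaplus_qsh u v :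
  zetaplus t u * zetaplus t v = \sum_(w <- qsh u v) zetaplus t w.
Proof.
apply: (@bplus_qsh R lpsi) lpsi_char u v.
exact: lser_eq.
Qed.

Lemma zetaplus_nil : zetaplus t [::] = 1. Proof. by []. Qed.

Lemma zetaplus_lin_morphism : is_qsh_morphism (zetaplus_lin t).
Proof.
have linD (c : rat) (x y : hminus) :
    zetaplus_lin t (c *: x + y) = ratr c * zetaplus_lin t x + zetaplus_lin t y.
  rewrite /zetaplus_lin mmapD; congr (_ + _).
  rewrite (mmapEw (msuppZ_le _ _)) mmapE mulr_sumr.
  apply: eq_bigr => w _; rewrite mcoeffZ -[LHS]/(ratr (c * mcoeff w x) * zetaplus t w).
  by rewrite rmorphM -mulrA.
have lin0 : zetaplus_lin t 0 = 0 by rewrite /zetaplus_lin mmap0.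
have linZ (c : rat) (x : hminus) : zetaplus_lin t (c *: x) = ratr c * zetaplus_lin t x.
  by rewrite -[c *: x]addr0 linD lin0 addr0.
have linS I (r : seq I) (F : I -> hminus) :
    zetaplus_lin t (\sum_(i <- r) F i) = \sum_(i <- r) zetaplus_lin t (F i).
  elim: r => [|i r IH]; first by rewrite !big_nil lin0.
  by rewrite !big_cons -IH -[F i]scale1r linD rmorph1 mul1r scale1r.
have linW w : zetaplus_lin t (of_word w) = zetaplus t w.
  rewrite /zetaplus_lin /of_word mmapU -[LHS]/(ratr 1 * zetaplus t w).
  by rewrite rmorph1 mul1r.
split; [exact: linD|exact: (linW [::])|].
move=> x y; rewrite /qsh_prod linS.
rewrite [zetaplus_lin t x]mmapE [zetaplus_lin t y]mmapE mulr_suml.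
apply: eq_bigr => u _; rewrite linS mulr_sumr; apply: eq_bigr => v _.
rewrite linZ linS (eq_bigr _ (fun w _ => linW w)) -zetaplus_qsh rmorphM.
exact: mulrACA.
Qed.

End Character.

(** * Rationality in t *)

Section Rationality.
Variable R : realType.
Local Notation C := (CC R).
Implicit Types (h : C -> C) (F G : C -> int -> C).

Definition reval (p : {poly rat}) (t : C) : C := (map_poly ratr p).[t].

Lemma revalM p q t : reval (p * q) t = reval p t * reval q t.
Proof. by rewrite /reval (rmorphM (map_poly (ratr : rat -> C))); exact: hornerM. Qed.

Lemma revalD p q t : reval (p + q) t = reval p t + reval q t.
Proof. by rewrite /reval (rmorphD (map_poly (ratr : rat -> C))); exact: hornerD. Qed.

Lemma revalC r t : reval r%:P t = ratr r.
Proof. by rewrite /reval map_polyC; exact: hornerC. Qed.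

Lemma revalX t : reval 'X t = t.
Proof. by rewrite /reval map_polyX; exact: hornerX. Qed.

Lemma reval1 t : reval 1 t = 1.
Proof. by rewrite -[1%R]/(1%:P) revalC rmorph1. Qed.

Lemma revalXn p n t : reval (p ^+ n) t = reval p t ^+ n.
Proof. by elim: n => [|n IH]; rewrite ?expr0 ?reval1 // !exprS revalM IH. Qed.

Definition regular_rational h : Prop := exists p q : {poly rat},
  (forall t : C, 0 < Re t -> reval q t != 0) /\
  (forall t : C, 0 < Re t -> h t = reval p t / reval q t).

Lemma rrat_eq h g : regular_rational h -> (forall t, 0 < Re t -> g t = h t) ->
  regular_rational g.
Proof.
by move=> [p [q [q0 hE]]] gh; exists p, q; split=> // t t0; rewrite gh // hE.
Qed.

Lemma rrat_poly (p : {poly rat}) : regular_rational (fun t => reval p t).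
Proof.
by exists p, 1; split=> t t0; rewrite reval1 ?oner_eq0 ?divr1.
Qed.

Lemma rrat_cst (r : rat) : regular_rational (fun=> ratr r).
Proof. by apply: rrat_eq (rrat_poly r%:P) _ => t _; rewrite revalC. Qed.

Lemma rratD h g : regular_rational h -> regular_rational g ->
  regular_rational (fun t => h t + g t).
Proof.
move=> [p [q [q0 hE]]] [p' [q' [q'0 gE]]].
exists (p * q' + p' * q), (q * q'); split=> t t0.
  by rewrite revalM; exact: mulf_neq0 (q0 t t0) (q'0 t t0).
rewrite (hE t t0) (gE t t0) (addf_div _ _ (q0 t t0) (q'0 t t0)).
by rewrite revalD !revalM.
Qed.

Lemma rratM h g : regular_rational h -> regular_rational g ->
  regular_rational (fun t => h t * g t).
Proof.
move=> [p [q [q0 hE]]] [p' [q' [q'0 gE]]].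
exists (p * p'), (q * q'); split=> t t0.
  by rewrite revalM; exact: mulf_neq0 (q0 t t0) (q'0 t t0).
by rewrite (hE t t0) (gE t t0) mulf_div !revalM.
Qed.

Lemma rrat_sum I (r : seq I) (H : I -> C -> C) :
  (forall i, regular_rational (H i)) ->
  regular_rational (fun t => \sum_(i <- r) H i t).
Proof.
move=> HP; elim: r => [|i r IH].
  by apply: rrat_eq (rrat_cst 0) _ => t _; rewrite big_nil rmorph0.
by apply: rrat_eq (rratD (HP i) IH) _ => t _; rewrite big_cons.
Qed.

Lemma rratV (p : {poly rat}) : (forall t : C, 0 < Re t -> reval p t != 0) ->
  regular_rational (fun t => (reval p t)^-1).
Proof.
move=> p0; exists 1, p; split=> t t0; first exact: p0.
by rewrite reval1 mul1r.
Qed.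

(** The order of the pole is bounded uniformly in t, so that a coefficient of a product is a sum of
    fixed length of products of rational functions. *)
Definition rational_family F : Prop :=
  (exists N, forall t, 0 < Re t -> lbounded N (F t)) /\
  forall n, regular_rational (fun t => F t n).

Lemma rfam_eq F G : rational_family F -> (forall t, 0 < Re t -> G t = F t) ->
  rational_family G.
Proof.
move=> [[N FN] FR] GF; split; first by exists N => t t0; rewrite GF //; exact: FN.
by move=> n; apply: rrat_eq (FR n) _ => t t0; rewrite GF.
Qed.

Lemma rfam1 : rational_family (fun=> laurent1 R).
Proof.
split; first by exists 0%N => t _; exact: lbounded1.
move=> n; apply: rrat_eq (rrat_cst (n == 0)%:R) _ => t _.
by rewrite /laurent1 rmorph_nat; case: eqP.
Qed.

Lemma rfamD F G : rational_family F -> rational_family G ->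
  rational_family (fun t n => F t n + G t n).
Proof.
move=> [[N FN] FR] [[M GM] GR]; split; last by move=> n; exact: rratD.
exists (N + M)%N => t t0 n nNM; rewrite FN ?GM ?addr0 //; lia.
Qed.

Lemma rfamZ h F : regular_rational h -> rational_family F ->
  rational_family (fun t n => h t * F t n).
Proof.
move=> hP [[N FN] FR]; split; last by move=> n; exact: rratM.
by exists N => t t0 n nN; rewrite FN ?mulr0.
Qed.

Lemma rfamM F G : rational_family F -> rational_family G ->
  rational_family (fun t => laurent_mul (F t) (G t)).
Proof.
move=> [[N FN] FR] [[M GM] GR]; split.
  by exists (N + M)%N => t t0; apply: lbounded_mul; [exact: FN|exact: GM].
move=> n; pose K := (absz (n + N%:Z + M%:Z)).+1.
have nK : n + N%:Z + M%:Z < K%:Z by rewrite /K; lia.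
pose H (i : 'I_K) (t : C) := F t (i%:Z - N%:Z) * G t (n - (i%:Z - N%:Z)).
apply: (@rrat_eq (fun t => \sum_(i <- index_enum 'I_K) H i t)).
  by apply: rrat_sum => i; exact: rratM.
by move=> t t0; exact: laurent_mulE (FN t t0) (GM t t0) nK.
Qed.

Lemma rfam_sum I (r : seq I) (H : I -> C -> lser R) :
  (forall i, rational_family (fun t => H i t)) ->
  rational_family (fun t => (\sum_(i <- r) H i t : lser R)).
Proof.
move=> HP; elim: r => [|i r IH].
  apply: rfam_eq (rfamZ (rrat_cst 0) rfam1) _ => t _; apply/funext => n.
  by rewrite big_nil rmorph0 mul0r.
by apply: rfam_eq (rfamD (HP i) IH) _ => t _; rewrite big_cons.
Qed.

Lemma rfam_polar F : rational_family F ->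
  rational_family (fun t => polar_part (F t)).
Proof.
move=> [[N FN] FR]; split.
  by exists N => t t0 n nN; rewrite /polar_part FN // if_same.
move=> n; rewrite /polar_part; case: (n < 0); first exact: FR.
by apply: rrat_eq (rrat_cst 0) _ => t _; rewrite rmorph0.
Qed.

Lemma rrat_bercoef k : regular_rational (fun=> bercoef R k).
Proof.
apply: rrat_eq (rrat_cst (ber k - (k == 1%N)%:R)) _ => t _.
by rewrite rmorphB rmorph_nat.
Qed.

Lemma rrat_lettercoef k i : regular_rational (fun=> lettercoef R k i).
Proof.
apply: rrat_eq (rrat_cst ((-1) ^+ i *+ 'C(val k, i))) _ => t _.
by rewrite rmorphMn rmorphXn rmorphN1.
Qed.

(** The only denominators are the m t + i with m > 0, whose real part is positive on D. Partial sums
    of exponents keep this form, which carries the induction of [rfam_nestker]. *)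
Lemma rfam_geomker (m i : nat) : (0 < m)%N ->
  rational_family (fun t => lgeomker (m%:R * t + i%:R)).
Proof.
move=> m0; split; first by exists 1%N => t _; exact: lgeomker_bounded.
pose p : {poly rat} := m%:R%:P * 'X + i%:R%:P.
have pE (t : C) : reval p t = m%:R * t + i%:R.
  by rewrite revalD revalM !revalC revalX !rmorph_nat.
move=> n; rewrite /= /lgeomker_coef; case: (n + 1) => k; last first.
  by apply: rrat_eq (rrat_cst 0) _ => t _; rewrite rmorph0.
apply: (@rrat_eq (fun t => bercoef R k * reval (p ^+ k) t * (reval p t)^-1)).
  apply: rratM; first by apply: rratM; [exact: rrat_bercoef|exact: rrat_poly].
  apply: rratV => t t0; rewrite pE; apply/eqP => /(congr1 (fun x : C => Re x)).
  rewrite CReD Re_natM -[i%:R](rmorph_nat (real_complex R)) /= => E.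
  have : 0 < m%:R * Re t + i%:R by rewrite ltr_pwDl // mulr_gt0 // ltr0n.
  by rewrite E ltxx.
by move=> t _; rewrite revalXn !pE.
Qed.

Lemma rfam_nestker w (m i : nat) : (0 < m)%N ->
  rational_family (fun t => lnestker t (m%:R * t + i%:R) w).
Proof.
elim: w m i => [|k w IH] m i m0 /=; first exact: rfamM (rfam_geomker _ m0) rfam1.
apply: rfamM; first exact: rfam_geomker.
apply: (@rfam_sum _ _ (fun j t => lscale _ _)) => j.
apply: rfamZ; first exact: rrat_lettercoef.
apply: rfam_eq (IH (m + val k)%N (i + j)%N _) _; first by rewrite addn_gt0 m0.
by move=> t _; rewrite /lettershift !natrD; congr (lcoef (lnestker _ _ _)); ring.
Qed.

Lemma rfam_psi w : rational_family (fun t => psi t w).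
Proof.
have qP : rational_family (fun t => lqzker t w).
  case: w => [|k w]; first exact: rfam1.
  apply: (@rfam_sum _ _ (fun j t => lscale _ _)) => j.
  apply: rfamZ; first exact: rrat_lettercoef.
  exact: rfam_nestker (valP k).
have sP : rational_family (fun t n => lqzker t w (n + (weight w)%:Z)).
  move: qP => [[N qN] qR]; split=> [|n]; last exact: qR.
  by exists (N + weight w)%N => t t0 n nN; apply: qN => //; lia.
apply: rfam_eq (rfamZ (rrat_cst ((-1) ^+ weight w)) sP) _ => t t0.
by rewrite psiE // rmorphXn rmorphN1.
Qed.

Lemma rfam_bprep (B : C -> word -> int -> C) w :
  (forall j, (0 < j < size w)%N -> rational_family (fun t => B t (take j w))) ->
  rational_family (fun t => bprep (psi t) (B t) w).
Proof.
move=> BP; apply: rfamD; first exact: rfam_psi.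
have sumP (r : seq nat) : all (fun j => 0 < j < size w)%N r -> rational_family (fun t n =>
    \sum_(j <- r) laurent_mul (B t (take j w)) (psi t (drop j w)) n).
  elim: r => [_|j r IH /= /andP[jw /IH rP]].
    apply: rfam_eq (rfamZ (rrat_cst 0) rfam1) _ => t _; apply/funext => n.
    by rewrite big_nil rmorph0 mul0r.
  apply: rfam_eq (rfamD (rfamM (BP j jw) (rfam_psi (drop j w))) rP) _ => t _.
  by apply/funext => n; rewrite big_cons.
by apply: sumP; apply/allP => j; rewrite mem_index_iota.
Qed.

Lemma rfam_bminus w : rational_family (fun t => bminus (psi t) w).
Proof.
have [n le_n] := ubnP (size w); elim: n => // n IHn in w le_n *.
have [->|w0] := eqVneq w [::]; first exact: rfam1.
apply: (@rfam_eq (fun t k => ratr (-1) * polar_part (bprep (psi t) (bminus (psi t)) w) k)).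
  apply: rfamZ; first exact: rrat_cst.
  apply: rfam_polar; apply: (@rfam_bprep (fun t => bminus (psi t))) => j /andP[_ jw].
  by apply: IHn; rewrite size_take jw; exact: leq_trans jw _.
by move=> t _; rewrite bminusE //; apply/funext => k; rewrite rmorphN1 mulN1r.
Qed.

Theorem zetaplus_rational w : regular_rational (fun t => zetaplus t w).
Proof.
case: w => [|k w].
  by apply: rrat_eq (rrat_cst 1) _ => t _; rewrite zetaplus_nil rmorph1.
have [_ P] := @rfam_bprep (fun t => bminus (psi t)) (k :: w) (fun j _ => rfam_bminus _).
apply: rrat_eq (P 0) _ => t _.
by rewrite /zetaplus /bplus /polar_part ltxx subr0.
Qed.

End Rationality.

(** * Holomorphic functions *)

Section ComplexDifferentiability.
Variable R : realType.
Local Notation C := (CC R).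
Implicit Types (f g : C -> C) (p z w d : C).

(** Complex differentiability with real quantifiers: the linear approximation that Goursat's
    argument consumes. *)
Definition cderiv f p d : Prop := forall e : R, 0 < e -> exists2 r : R, 0 < r &
  forall z, normc (z - p) < r -> normc (f z - f p - d * (z - p)) <= e * normc (z - p).

Lemma dnbhsCP (P : set C) : (\forall h \near (0 : C)^', P h) <->
  exists2 e : R, 0 < e & forall h : C, h != 0 -> normc h < e -> P h.
Proof.
rewrite near_withinE; split=> [/nbhsCP[e e0 eP]|[e e0 eP]].
  by exists e => // h h0 he; apply: eP; rewrite ?subr0.
by apply/nbhsCP; exists e => // h; rewrite subr0 => he h0; exact: eP.
Qed.

Lemma differentiable_cderiv f p : differentiable f p -> exists d, cderiv f p d.
Proof.
move=> /derivable1_diffP fD; exists ('D_1 f p) => e e0.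
have /cvgCP/(_ e e0)/dnbhsCP[r r0 rP] :
    (fun h : C => h^-1 *: (f (h *: (1 : C) + p) - f p)) @ (0 : C)^' --> 'D_1 f p.
  exact: fD.
exists r => // z zr; have [->|zp] := eqVneq z p.
  by rewrite !subrr mulr0 subrr normc0 mulr0.
have h0 : z - p != 0 by rewrite subr_eq0.
have := rP _ h0 zr; rewrite {1}/GRing.scale /= {1}/GRing.scale /= mulr1 subrK.
rewrite -(ltr_pM2r (x := normc (z - p))) ?normc_gt0 // -normcM mulrBl mulrAC.
by rewrite mulVf // mul1r -normcN opprB => /ltW.
Qed.

Lemma cderiv_differentiable f p d : cderiv f p d -> differentiable f p.
Proof.
move=> fd; apply/derivable1_diffP/cvg_ex; exists d.
apply/cvgCP => e e0; have e2 : 0 < e / 2 by rewrite divr_gt0.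
have [r r0 rP] := fd _ e2; apply/dnbhsCP; exists r => // h h0 hr.
have := rP (h + p); rewrite addrK => /(_ hr).
rewrite /GRing.scale /= mulr1 => H.
rewrite -(ltr_pM2r (x := normc h)) ?normc_gt0 // -normcM mulrBl mulrAC.
rewrite mulVf // mul1r -normcN opprB; apply: le_lt_trans H _.
by rewrite ltr_pM2r ?normc_gt0 // ltr_pdivrMr // mulr2n mulrDr mulr1 ltrDl.
Qed.

Lemma cderiv_cexp p : cderiv (@cexp R) p (cexp p).
Proof.
(* The 4 is the factor (2 (b - a)) ^ 2 of [taylor_bound] for s |-> exp (h s) on [0, 1], and [expR 1]
   bounds this function when |h| < 1. *)
pose K : R := normc (cexp p) * (4 * expR 1).
have K0 : 0 < K by rewrite !mulr_gt0 ?expR_gt0 // normc_gt0 cexp_neq0.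
move=> e e0; exists (Num.min 1 (e / K)); first by rewrite lt_min ltr01 divr_gt0.
move=> z; rewrite lt_min => /andP[z1 ze]; set h := z - p in z1 ze *.
have -> : cexp z - cexp p - cexp p * h = cexp p * (cexp h - (1 + h)).
  by rewrite -{1}(subrK p z) -/h cexpD; ring.
pose g n (s : R) : C := h ^+ n * cexp (h * s%:C%C).
have gD n s : rderiv (g n) s (g n.+1 s).
  apply: rderiv_eq (rderivZ _ (rderiv_cexp h (is_derive_id s 1))) _.
  by rewrite /g exprSr mulr1 mulrA.
have gB s : 0 <= s <= 1 -> normc (g 2 s) <= normc h ^+ 2 * expR 1.
  move=> /andP[s0 s1]; rewrite /g normcM normcX ler_wpM2l ?exprn_ge0 ?normc_ge0 //.
  rewrite normc_cexp ler_expR; apply: le_trans (ler_norm _) (le_trans (ler_Re_normc _) _).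
  rewrite normcM normc_real ger0_norm //; apply: le_trans (ltW z1).
  by rewrite ler_piMr ?normc_ge0.
have := taylor_bound ler01 (fun n s _ => gD n s) gB.
rewrite big_ord_recl big_ord1 /g !(mulr0, subr0, mulr1, expr0, mul1r, expr1, cexp0) /=.
rewrite !invr1 mulr1 => tB; rewrite normcM.
apply: le_trans (ler_wpM2l (normc_ge0 _) tB) _.
have -> : normc (cexp p) * (2 ^+ 2 * (normc h ^+ 2 * expR 1)) = K * normc h * normc h.
  by rewrite /K; ring.
by rewrite ler_wpM2r ?normc_ge0 // mulrC -ler_pdivlMr // ltW.
Qed.

Lemma differentiable_cexp p : differentiable (@cexp R : C -> C) p.
Proof. exact: cderiv_differentiable (cderiv_cexp p). Qed.

Lemma diffC_cst (c : C) p : differentiable (fun _ : C => c) p.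
Proof. exact (differentiable_cst c p). Qed.

Lemma diffC_id p : differentiable (fun z : C => z) p.
Proof.
apply: (@cderiv_differentiable _ _ 1) => e e0; exists 1 => // z _.
by rewrite mul1r subrr normc0 mulr_ge0 ?normc_ge0 // ltW.
Qed.

Lemma diffCD f g p : differentiable f p -> differentiable g p ->
  differentiable (fun z => f z + g z) p.
Proof. move=> fD gD; exact (differentiableD fD gD). Qed.

Lemma diffCM f g p : differentiable f p -> differentiable g p ->
  differentiable (fun z => f z * g z) p.
Proof. move=> fD gD; exact (differentiableM fD gD). Qed.

Lemma diffCN f p : differentiable f p -> differentiable (fun z => - f z) p.
Proof. move=> fD; exact (differentiableN fD). Qed.

Lemma diffCV f p : differentiable f p -> f p != 0 ->
  differentiable (fun z => (f z)^-1) p.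
Proof. move=> fD f0; exact (differentiableV fD f0). Qed.

Lemma diffC_comp f g p : differentiable f p -> differentiable g (f p) ->
  differentiable (fun z => g (f z)) p.
Proof. move=> fD gD; exact (differentiable_comp fD gD). Qed.

Lemma diffC_sum n (F : 'I_n -> C -> C) p : (forall i, differentiable (F i) p) ->
  differentiable (fun z => \sum_(i < n) F i z) p.
Proof.
elim: n F => [|n IH] F FD.
  rewrite (_ : (fun z => _) = fun _ : C => 0); first exact: diffC_cst.
  by apply/funext => z; rewrite big_ord0.
rewrite (_ : (fun z => _) = fun z =>
  \sum_(i < n) F (widen_ord (leqnSn n) i) z + F ord_max z).
  by apply: diffCD; [apply: IH|].
by apply/funext => z; rewrite big_ord_recr.
Qed.

Lemma differentiable_eps f p : differentiable f p -> forall e : R, 0 < e ->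
  exists2 r : R, 0 < r & forall z, normc (z - p) < r -> normc (f z - f p) < e.
Proof.
move=> /differentiable_continuous/cvgCP fc e /fc/nbhsCP[r r0 rP].
by exists r => // z /rP; rewrite normcB.
Qed.

End ComplexDifferentiability.

(** * Line integrals as differences of primitives *)

Section Primitive.
Variable R : realType.
Local Notation C := (CC R).

Lemma primitive_exists (f : R -> R) (a b : R) : a < b ->
  (forall x, a <= x <= b -> {for x, continuous f}) ->
  exists F : R -> R, forall x, a < x < b -> is_derive x 1 F (f x).
Proof.
move=> ab fc; exists (fun x => \int[@lebesgue_measure R]_(t in `[a, x]) f t)%R.
move=> x /andP[ax xb].
have intf : (@lebesgue_measure R).-integrable `[a, b] (EFin \o f).
  apply: continuous_compact_integrable; first exact: segment_compact.
  apply: continuous_in_subspaceT => y; rewrite inE /= in_itv /=; exact: fc.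
have [|Fd FE] := continuous_FTC1_closed xb intf ax.
  by apply: fc; rewrite !ltW.
apply: DeriveDef; first exact: Fd.
by rewrite -derive1E; exact: FE.
Qed.

(** An integral of g becomes a difference of values of a chosen primitive, so estimates along a path
    are instances of [rderiv_bound]. The choice depends on the interval and on g alone: equal
    integrands get the same primitive. *)
Definition prim (a b : R) (g : R -> C) : R -> C :=
  xget (fun=> 0) [set G | forall x, a < x < b -> rderiv G x (g x)].

Lemma primP (a b : R) (g : R -> C) : a < b ->
  (forall x, a <= x <= b -> forall e : R, 0 < e -> exists2 r : R, 0 < r &
    forall y, `|y - x| < r -> normc (g y - g x) < e) ->
  forall x, a < x < b -> rderiv (prim a b g) x (g x).
Proof.
move=> ab gc.
have cont (proj : C -> R) : (forall z w : C, `|proj z - proj w| <= normc (z - w)) ->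
    forall x, a <= x <= b -> {for x, continuous (fun y => proj (g y))}.
  move=> pL x xab; apply/cvgrPdist_lt => e e0; have [r r0 rP] := gc x xab e e0.
  apply/nbhs_ballP; exists r => //= y; rewrite /ball /= distrC => /rP.
  by rewrite normcB; apply: le_lt_trans.
have [F FD] := primitive_exists ab (cont (fun z => Re z)
  (fun z w => ltac:(by rewrite -CReB; exact: ler_Re_normc))).
have [G GD] := primitive_exists ab (cont (fun z => Im z)
  (fun z w => ltac:(by rewrite -CImB; exact: ler_Im_normc))).
move=> x xab; rewrite /prim; case: xgetP => [H _ HP|/(_ (fun y => (F y +i* G y)%C))[]].
  exact: HP.
by move=> y yab; split => /=; [exact: FD|exact: GD].
Qed.

End Primitive.

(** * Goursat's subdivision argument *)

Section Goursat.
Variable R : realType.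
Local Notation C := (CC R).

Lemma nested_intervals (u v : nat -> R) :
  (forall n, u n <= u n.+1) -> (forall n, v n.+1 <= v n) -> (forall n, u n <= v n) ->
  exists p, forall n, u n <= p <= v n.
Proof.
move=> uS vS uv.
have uM m n : (m <= n)%N -> u m <= u n.
  by move/subnK <-; elim: (n - m)%N => // k /le_trans; apply; rewrite addSn.
have vM m n : (m <= n)%N -> v n <= v m.
  by move/subnK <-; elim: (n - m)%N => // k; apply: le_trans; rewrite addSn.
have uvmn m n : u m <= v n.
  apply: le_trans (uM _ _ (leq_maxl m n)) _.
  exact: le_trans (uv _) (vM _ _ (leq_maxr m n)).
have ubv n : ubound (range u) (v n) by move=> _ [m _ <-].
exists (sup (range u)) => n; apply/andP; split.
  by apply: ub_le_sup; [exists (v 0); exact: ubv|exists n].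
by apply: ge_sup; [exists (u 0), 0%N|exact: ubv].
Qed.

(* Subdivision: an additive function of rectangles that is o(diameter ^ 2) at
   every point vanishes. *)
Lemma goursat_vanish (J : R -> R -> R -> R -> C) (a b c d : R) : a <= b -> c <= d ->
  (forall x1 x2 x3 y1 y2, J x1 x3 y1 y2 = J x1 x2 y1 y2 + J x2 x3 y1 y2) ->
  (forall x1 x2 y1 y2 y3, J x1 x2 y1 y3 = J x1 x2 y1 y2 + J x1 x2 y2 y3) ->
  (forall px py, a <= px <= b -> c <= py <= d -> forall e : R, 0 < e ->
    exists2 r : R, 0 < r & forall x1 x2 y1 y2, a <= x1 <= px -> px <= x2 <= b ->
      c <= y1 <= py -> py <= y2 <= d -> x2 - x1 < r -> y2 - y1 < r ->
      normc (J x1 x2 y1 y2) <= e * (x2 - x1 + (y2 - y1)) ^+ 2) ->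
  J a b c d = 0.
Proof.
move=> ab cd Jx Jy Jloc; apply/eqP; apply: contraT; rewrite -normc_gt0.
set K := normc _ => K0.
pose w n := (b - a) * 2^-1 ^+ n; pose h n := (d - c) * 2^-1 ^+ n.
have wS n : w n = w n.+1 + w n.+1 by rewrite /w exprS; field.
have hS n : h n = h n.+1 + h n.+1 by rewrite /h exprS; field.
have w0 n : 0 <= w n by rewrite mulr_ge0 ?subr_ge0 ?exprn_ge0 ?invr_ge0.
have h0 n : 0 <= h n by rewrite mulr_ge0 ?subr_ge0 ?exprn_ge0 ?invr_ge0.
pose N n (s : R * R) := normc (J s.1 (s.1 + w n) s.2 (s.2 + h n)).
(* [s] is the lower left corner of the current rectangle. If three quarters all fall short of the
   required modulus, additivity forces the fourth to reach it. *)
pose step n (s : R * R) : R * R :=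
  if K * 4^-1 ^+ n.+1 <= N n.+1 s then s else
  if K * 4^-1 ^+ n.+1 <= N n.+1 (s.1 + w n.+1, s.2) then (s.1 + w n.+1, s.2) else
  if K * 4^-1 ^+ n.+1 <= N n.+1 (s.1, s.2 + h n.+1) then (s.1, s.2 + h n.+1) else
  (s.1 + w n.+1, s.2 + h n.+1).
pose s := fix s n := if n is m.+1 then step m (s m) else (a, c).
have sN n : K * 4^-1 ^+ n <= N n (s n).
  elim: n => [|n IH].
    by rewrite expr0 mulr1 /N /= /w /h !expr0 !mulr1 !subrKC.
  rewrite /= /step; case: ifPn => // /negbTE; case: ifPn => // + H1.
  move=> /negbTE; case: ifPn => // + H2.
  move=> /negbTE H3; rewrite leNgt; apply/negP => H4; move: IH; apply/negP.
  rewrite -ltNge; move/negbT: H1; move/negbT: H2; move/negbT: H3.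
  rewrite -!ltNge => H3 H2 H1.
  rewrite /N (Jx _ ((s n).1 + w n.+1)) (Jy _ _ _ ((s n).2 + h n.+1)).
  rewrite (Jy ((s n).1 + w n.+1) _ _ ((s n).2 + h n.+1)).
  have -> : (s n).1 + w n = (s n).1 + w n.+1 + w n.+1 by rewrite (wS n) addrA.
  have -> : (s n).2 + h n = (s n).2 + h n.+1 + h n.+1 by rewrite (hS n) addrA.
  rewrite /N /= in H1 H2 H3 H4.
  have -> : K * 4^-1 ^+ n = K * 4^-1 ^+ n.+1 + K * 4^-1 ^+ n.+1 +
      (K * 4^-1 ^+ n.+1 + K * 4^-1 ^+ n.+1) by rewrite exprS; field.
  apply: le_lt_trans (ltrD (ltrD H1 H3) (ltrD H2 H4)).
  apply: le_trans (le_normcD _ _) _; apply: lerD; last exact: le_normcD.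
  exact: le_normcD.
have sx n : (s n).1 <= (s n.+1).1 /\ (s n.+1).1 + w n.+1 <= (s n).1 + w n.
  by rewrite /= /step (wS n); have := w0 n.+1; do !case: ifP => _ /=; split; lra.
have sy n : (s n).2 <= (s n.+1).2 /\ (s n.+1).2 + h n.+1 <= (s n).2 + h n.
  by rewrite /= /step (hS n); have := h0 n.+1; do !case: ifP => _ /=; split; lra.
have [px pxP] := @nested_intervals (fun n => (s n).1) (fun n => (s n).1 + w n)
  (fun n => (sx n).1) (fun n => (sx n).2) (fun n => ltac:(by rewrite lerDl)).
have [py pyP] := @nested_intervals (fun n => (s n).2) (fun n => (s n).2 + h n)
  (fun n => (sy n).1) (fun n => (sy n).2) (fun n => ltac:(by rewrite lerDl)).
have sxb n : a <= (s n).1 /\ (s n).1 + w n <= b.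
  elim: n => [|n [IH1 IH2]]; first by rewrite /= /w expr0 mulr1 subrKC !lexx.
  by have [H1 H2] := sx n; split; [exact: le_trans IH1 H1|exact: le_trans H2 IH2].
have syb n : c <= (s n).2 /\ (s n).2 + h n <= d.
  elim: n => [|n [IH1 IH2]]; first by rewrite /= /h expr0 mulr1 subrKC !lexx.
  by have [H1 H2] := sy n; split; [exact: le_trans IH1 H1|exact: le_trans H2 IH2].
pose L := b - a + (d - c).
have L0 : 0 <= L by rewrite addr_ge0 ?subr_ge0.
have L1 : 0 < L ^+ 2 + 1 by rewrite ltr_wpDl ?exprn_ge0.
have pab : a <= px <= b.
  have := pxP 0%N; rewrite /= /w expr0 mulr1 subrKC //.
have pcd : c <= py <= d.
  have := pyP 0%N; rewrite /= /h expr0 mulr1 subrKC //.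
(* With e = K / (L ^ 2 + 1) the local bound e (L / 2 ^ n) ^ 2 drops below the lower bound K / 4 ^
   n. *)
have [r r0 rP] := Jloc px py pab pcd _ (divr_gt0 K0 L1).
have : (2^-1 ^+ n : R) @[n --> \oo] --> 0.
  by apply: cvg_expr; rewrite ger0_norm ?invr_ge0 // invf_lt1 // ltr1n.
move=> /cvgrPdist_lt/(_ (r / (L + 1)))[|n _ /(_ n (leqnn n))].
  by rewrite divr_gt0 // ltr_wpDl.
rewrite /= sub0r normrN ger0_norm ?exprn_ge0 ?invr_ge0 // => nr.
have small l : 0 <= l -> l <= L -> l * 2^-1 ^+ n < r.
  move=> l0 lL; rewrite ltr_pdivlMr ?ltr_wpDl // in nr; apply: le_lt_trans nr.
  by rewrite mulrC ler_wpM2l ?exprn_ge0 ?invr_ge0 // (le_trans lL) // lerDl.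
have [[s1 s2] [s3 s4]] := (sxb n, syb n).
have /andP[p1 p2] := pxP n; have /andP[p3 p4] := pyP n.
have := rP (s n).1 ((s n).1 + w n) (s n).2 ((s n).2 + h n).
rewrite !(addrC (s n).1) !(addrC (s n).2) !addrK -!(addrC (s n).1) -!(addrC (s n).2).
rewrite s1 p1 p2 s2 s3 p3 p4 s4.
move=> /(_ isT isT isT isT (small _ _ _) (small _ _ _)).
rewrite !subr_ge0 => /(_ ab _ cd _).
rewrite lerDl lerDr !subr_ge0 => /(_ cd ab) Jn.
have := le_trans (sN n) Jn; rewrite /w /h -mulrDl -/L exprMn -exprM mulnC exprM.
rewrite (_ : 2^-1 ^+ 2 = 4^-1 :> R); last by field.
rewrite mulrA ler_pM2r ?exprn_gt0 ?invr_gt0 // mulrAC ler_pdivlMr //.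
by rewrite ler_pM2l // -subr_ge0 opprD addNKr ler0N1.
Qed.

End Goursat.

(** * Mean value property *)

Section MeanValue.
Variable R : realType.
Local Notation C := (CC R).
Implicit Types (f g : C -> C).

Definition cxy (x y : R) : C := (x +i* y)%C.

Lemma cxyE x y : cxy x y = x%:C%C + 'i%C * y%:C%C.
Proof. by rewrite /cxy [LHS]complexRI. Qed.

Lemma cxyB x y x' y' : cxy x y - cxy x' y' = cxy (x - x') (y - y').
Proof. by []. Qed.

Lemma normc_cxy x y : normc (cxy x y) <= `|x| + `|y|.
Proof. exact: normc_le_ReIm. Qed.

Lemma normc_i : normc ('i%C : C) = 1.
Proof. by rewrite /normc /= expr0n expr1n add0r sqrtr1. Qed.

Lemma mulii : 'i%C * 'i%C = -1 :> C.
Proof. by apply/eqP; rewrite eq_complex /=; apply/andP; split; apply/eqP; ring. Qed.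

Lemma normc_sqr (z : C) : normc z ^+ 2 = Re z ^+ 2 + Im z ^+ 2.
Proof. by case: z => a b; rewrite /normc sqr_sqrtr // addr_ge0 ?sqr_ge0. Qed.

Definition cconj (z : C) : C := (Re z +i* - Im z)%C.

Lemma normc_conj z : normc (cconj z) = normc z.
Proof. by case: z => a b; rewrite /cconj /normc /= sqrrN. Qed.

Lemma cconjM z : cconj z * z = (normc z ^+ 2)%:C%C.
Proof.
rewrite normc_sqr; case: z => a b; apply/eqP; rewrite eq_complex /cconj /=.
by apply/andP; split; apply/eqP; ring.
Qed.

Section Rectangle.
Variables (g : C -> C) (X Y0 Y1 : R).
Hypothesis Y01 : Y0 < Y1.
Hypothesis gD : forall z : C, Re z < X -> differentiable g z.

Let hprim a b y := prim a b (fun x => g (cxy x y)).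
Let vprim x := prim Y0 Y1 (fun y => g (cxy x y)).

Let hprimP a b y : a < b -> b < X -> forall x, a < x < b ->
  rderiv (hprim a b y) x (g (cxy x y)).
Proof.
move=> ab bX; apply: primP => // x /andP[ax xb] e e0.
have [r r0 rP] := differentiable_eps (gD (z := cxy x y) (le_lt_trans xb bX)) e0.
exists r => // x' xx'; apply: rP; rewrite cxyB subrr.
by apply: le_lt_trans (normc_cxy _ _) _; rewrite normr0 addr0.
Qed.

Let vprimP x : x < X -> forall y, Y0 < y < Y1 -> rderiv (vprim x) y (g (cxy x y)).
Proof.
move=> xX; apply: primP => // y yY e e0.
have [r r0 rP] := differentiable_eps (gD (z := cxy x y) xX) e0.
exists r => // y' yy'; apply: rP; rewrite cxyB subrr.
by apply: le_lt_trans (normc_cxy _ _) _; rewrite normr0 add0r.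
Qed.

(** Near p the function g is affine up to e |z - p|, and the affine part has the primitive [Q],
    whose boundary contributions cancel. The margins a', b', Y0, Y1 are there because [primP] gives
    derivatives inside the open interval only. *)
Lemma goursat_rectangle a b a' b' c d : a' < a -> a <= b -> b < b' -> b' < X ->
  Y0 < c -> c <= d -> d < Y1 ->
  hprim a' b' c b - hprim a' b' c a + 'i%C * (vprim b d - vprim b c)
  - (hprim a' b' d b - hprim a' b' d a) - 'i%C * (vprim a d - vprim a c) = 0.
Proof.
move=> a'a ab bb' b'X Yc cd dY.
pose J x1 x2 y1 y2 := hprim a' b' y1 x2 - hprim a' b' y1 x1
  + 'i%C * (vprim x2 y2 - vprim x2 y1)
  - (hprim a' b' y2 x2 - hprim a' b' y2 x1) - 'i%C * (vprim x1 y2 - vprim x1 y1).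
apply: (@goursat_vanish R J) => //; [by move=> *; rewrite /J; ring|
  by move=> *; rewrite /J; ring|].
move=> px py /andP[apx pxb] /andP[cpy pyd] e e0.
have pX : Re (cxy px py) < X by exact: le_lt_trans pxb (lt_trans bb' b'X).
have [D gd] := differentiable_cderiv (gD pX).
(* Each side contributes at most 2 (e / 4) S times its length; two horizontal and two vertical sides
   add up to e S ^ 2. *)
have e4 : 0 < e / 4 by rewrite divr_gt0.
have [r r0 rP] := gd _ e4; exists (r / 2); first by rewrite divr_gt0.
move=> x1 x2 y1 y2 /andP[ax1 x1p] /andP[px2 x2b] /andP[cy1 y1p] /andP[py2 y2d] xr yr.
pose p := cxy px py; pose S := x2 - x1 + (y2 - y1).
pose Q z := g p * z + D * ((z - p) * (z - p) * 2^-1).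
pose q z := g p + D * (z - p).
have near_p x y : x1 <= x <= x2 -> y1 <= y <= y2 ->
    normc (g (cxy x y) - q (cxy x y)) <= e / 4 * S.
  move=> /andP[xx1 xx2] /andP[yy1 yy2].
  have zp : normc (cxy x y - p) <= S.
    rewrite cxyB; apply: le_trans (normc_cxy _ _) (lerD _ _); rewrite ler_norml; lra.
  rewrite /q opprD addrA; apply: le_trans (rP _ _) _; last by rewrite ler_wpM2l // ltW.
  by apply: le_lt_trans zp _; rewrite /S; lra.
have cP : 2^-1 + 2^-1 = 1 :> C by field.
have Qx y x : rderiv (fun s => Q (cxy s y)) x (q (cxy x y)).
  have dz : rderiv (fun s => cxy s y - p) x 1.
    rewrite (_ : (fun s => _) = fun s => s%:C%C + ('i%C * y%:C%C - p)).
      rewrite -[X in rderiv _ _ X]addr0; apply: rderivD; first exact: rderiv_id.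
      exact: rderiv_cst.
    by apply/funext => s; rewrite cxyE addrA.
  rewrite (_ : (fun s => _) = fun s => g p * (cxy s y - p) + g p * p
      + D * ((cxy s y - p) * (cxy s y - p) * 2^-1)); last first.
    by apply/funext => s; rewrite /Q; ring.
  apply: rderiv_eq (rderivD (rderivD (rderivZ _ dz) (rderiv_cst _ _))
    (rderivZ _ (rderivM (rderivM dz dz) (rderiv_cst _ _)))) _.
  by rewrite /q; field.
have Qy x y : rderiv (fun s => Q (cxy x s)) y ('i%C * q (cxy x y)).
  have dz : rderiv (fun s => cxy x s - p) y 'i%C.
    rewrite (_ : (fun s => _) = fun s => 'i%C * s%:C%C + (x%:C%C - p)).
      rewrite -['i%C in X in rderiv _ _ X]addr0; apply: rderivD; last exact: rderiv_cst.
      by rewrite -['i%C in X in rderiv _ _ X]mulr1; apply: rderivZ; exact: rderiv_id.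
    by apply/funext => s; rewrite cxyE; ring.
  rewrite (_ : (fun s => _) = fun s => g p * (cxy x s - p) + g p * p
      + D * ((cxy x s - p) * (cxy x s - p) * 2^-1)); last first.
    by apply/funext => s; rewrite /Q; ring.
  apply: rderiv_eq (rderivD (rderivD (rderivZ _ dz) (rderiv_cst _ _))
    (rderivZ _ (rderivM (rderivM dz dz) (rderiv_cst _ _)))) _.
  by rewrite /q; field.
have x12 : x1 <= x2 by exact: le_trans x1p px2.
have y12 : y1 <= y2 by exact: le_trans y1p py2.
have hB y : y1 <= y <= y2 -> normc ((hprim a' b' y x2 - Q (cxy x2 y)) -
    (hprim a' b' y x1 - Q (cxy x1 y))) <= 2 * (e / 4 * S) * (x2 - x1).
  move=> yy; apply: (@rderiv_bound _ (fun x => hprim a' b' y x - Q (cxy x y))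
    (fun x => g (cxy x y) - q (cxy x y))) => // x xx; last exact: near_p.
  apply: rderivB (Qx y x); apply: hprimP => //; first by lra.
  by move/andP: xx => [? ?]; lra.
have vB x : x1 <= x <= x2 -> normc (('i%C * vprim x y2 - Q (cxy x y2)) -
    ('i%C * vprim x y1 - Q (cxy x y1))) <= 2 * (e / 4 * S) * (y2 - y1).
  move=> xx; apply: (@rderiv_bound _ (fun y => 'i%C * vprim x y - Q (cxy x y))
    (fun y => 'i%C * g (cxy x y) - 'i%C * q (cxy x y))) => // y yy.
    apply: rderivB (Qy x y); apply: rderivZ; apply: vprimP.
      by move/andP: xx => [? ?]; lra.
    by move/andP: yy => [? ?]; lra.
  by rewrite -mulrBr normcM normc_i mul1r; exact: near_p.
have [yy1 yy2] : (y1 <= y1 <= y2) /\ (y1 <= y2 <= y2) by rewrite !lexx y12.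
have [xx1 xx2] : (x1 <= x1 <= x2) /\ (x1 <= x2 <= x2) by rewrite !lexx x12.
have h1 := hB _ yy1; have h2 := hB _ yy2; have v1 := vB _ xx1; have v2 := vB _ xx2.
rewrite -normcN in h2; rewrite -normcN in v1.
have -> : J x1 x2 y1 y2 =
    (hprim a' b' y1 x2 - Q (cxy x2 y1) - (hprim a' b' y1 x1 - Q (cxy x1 y1)) +
    ('i%C * vprim x2 y2 - Q (cxy x2 y2) - ('i%C * vprim x2 y1 - Q (cxy x2 y1)))) +
    (- (hprim a' b' y2 x2 - Q (cxy x2 y2) - (hprim a' b' y2 x1 - Q (cxy x1 y2))) +
    - ('i%C * vprim x1 y2 - Q (cxy x1 y2) - ('i%C * vprim x1 y1 - Q (cxy x1 y1)))).
  by rewrite /J; ring.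
apply: le_trans (le_normcD _ _) (le_trans (lerD (le_trans (le_normcD _ _) (lerD h1 v2))
  (le_trans (le_normcD _ _) (lerD h2 v1))) _).
by rewrite le_eqVlt; apply/orP; left; apply/eqP; rewrite /S; field.
Qed.

Hypothesis Y0_lt : Y0 < 0.
Hypothesis Y1_gt : pi *+ 2 < Y1.
Hypothesis g_per : forall x y, g (cxy x (y + pi *+ 2)) = g (cxy x y).

Lemma vertical_integral_const a b : a <= b -> b < X ->
  vprim a (pi *+ 2) - vprim a 0 = vprim b (pi *+ 2) - vprim b 0.
Proof.
move=> ab bX; pose b' := (b + X) / 2.
have bb' : b < b' by rewrite /b'; lra.
have b'X : b' < X by rewrite /b'; lra.
have pi0 : 0 <= pi *+ 2 :> R by rewrite mulrn_wge0 // pi_ge0.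
have a1 : a - 1 < a by lra.
have := @goursat_rectangle a b (a - 1) b' 0 (pi *+ 2) a1 ab bb' b'X Y0_lt pi0 Y1_gt.
(* By periodicity the integrands on the two horizontal sides are the same function, hence so are
   their chosen primitives, and these sides cancel. *)
rewrite (_ : hprim (a - 1) b' (pi *+ 2) = hprim (a - 1) b' 0); last first.
  by rewrite /hprim; congr prim; apply/funext => x; rewrite -[pi *+ 2]add0r g_per.
move: (hprim _ _ _ _) (hprim _ _ _ _) => H1 H2 E.
have i0 : 'i%C != 0 :> C by rewrite -normc_gt0 normc_i.
apply/esym/(mulfI i0)/eqP; rewrite -subr_eq0; apply/eqP; rewrite -[RHS]E; ring.
Qed.

End Rectangle.

(* exp maps the strip Re < ln r onto the punctured disc of radius r. *)
Section Disc.
Variables (f : C -> C) (w : C) (r : R).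
Hypothesis r0 : 0 < r.
Hypothesis fD : forall z, normc (z - w) < r -> differentiable f z.

Let g (z : C) : C := f (w + cexp z).
Let Y0 : R := -1.
Let Y1 : R := pi *+ 2 + 1.
Let V x := prim Y0 Y1 (fun y => g (cxy x y)).

Let Y01 : Y0 < Y1.
Proof. by have := pi_ge0 R; rewrite /Y0 /Y1 -mulr_natl; lra. Qed.

Let gD (z : C) : Re z < ln r -> differentiable g z.
Proof.
move=> zr; apply: (@diffC_comp _ (fun z => w + cexp z)).
  by apply: diffCD; [exact: diffC_cst|exact: differentiable_cexp].
apply: fD; rewrite addrAC subrr add0r normc_cexp.
by rewrite -[ltRHS]lnK ?ltr_expR // posrE.
Qed.

Let g_per x y : g (cxy x (y + pi *+ 2)) = g (cxy x y).
Proof. by rewrite /g /cxy /cexp /= cosD2pi sinD2pi. Qed.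

Let VP x y : x < ln r -> Y0 < y < Y1 -> rderiv (V x) y (g (cxy x y)).
Proof.
move=> xr; apply: primP => // {}y yY e e0.
have [d d0 dP] := differentiable_eps (gD (z := cxy x y) xr) e0.
exists d => // y' yy'; apply: dP; rewrite cxyB subrr.
by apply: le_lt_trans (normc_cxy _ _) _; rewrite normr0 add0r.
Qed.

(** The left-hand side does not depend on x, and for x near minus infinity the circle of radius exp
    x shrinks to w, where f is close to [f w]. *)
Lemma mean_value x : x < ln r -> V x (pi *+ 2) - V x 0 = (pi *+ 2)%:C%C * f w.
Proof.
move=> xr; have pi2 : 0 <= pi *+ 2 :> R by rewrite mulrn_wge0 // pi_ge0.
apply/eqP; rewrite -subr_eq0; apply: contraT; rewrite -normc_gt0.
set D := normc _ => D0.
pose e := D / (4 * (pi *+ 2 + 1)).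
have P1 : 0 < 4 * (pi *+ 2 + 1) :> R by rewrite mulr_gt0 // ltr_wpDl.
have e0 : 0 < e by rewrite divr_gt0.
have [d d0 dP] := differentiable_eps (fD (z := w) ltac:(by rewrite subrr normc0)) e0.
pose x' := Num.min x (ln d - 1).
have x'x : x' <= x by rewrite ge_min lexx.
have := @vertical_integral_const g (ln r) Y0 Y1 Y01 gD ltac:(by rewrite /Y0; lra)
  ltac:(by rewrite /Y1; lra) g_per x' x x'x xr.
rewrite -/(V x) -/(V x') => VE.
have x'r : x' < ln r by exact: le_lt_trans x'x xr.
have : D <= 2 * e * (pi *+ 2 - 0).
  rewrite /D -VE.
  rewrite (_ : _ - _ = (V x' (pi *+ 2) - (pi *+ 2)%:C%C * f w) - (V x' 0 - 0%:C%C * f w));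
    last by rewrite mul0r; ring.
  apply: (@rderiv_bound _ (fun y => V x' y - y%:C%C * f w)
    (fun y => g (cxy x' y) - f w)) => // y /andP[y0 yp].
    apply: rderivB; first by apply: VP => //; rewrite /Y0 /Y1; lra.
    apply: rderiv_eq (rderivM (rderiv_id y) (rderiv_cst (f w) y)) _.
    by rewrite mulr0 add0r mul1r.
  apply/ltW/dP; rewrite /g addrAC subrr add0r normc_cexp /=.
  rewrite -[ltRHS]lnK ?ltr_expR ?posrE // (@le_lt_trans _ _ (ln d - 1)) //.
    by rewrite ge_min lexx orbT.
  by rewrite ltrBlDr ltrDl.
rewrite leNgt => /negP; case; rewrite subr0 /e.
have -> : 2 * (D / (4 * (pi *+ 2 + 1))) * (pi *+ 2) =
    D * (pi *+ 2 / (2 * (pi *+ 2 + 1))).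
  by field; lra.
by rewrite gtr_pMr // ltr_pdivrMr ?mulr_gt0 ?ltr_wpDl // mul1r mulrDr; lra.
Qed.

(* |f| + e |z| ^ 2 is strictly subharmonic. *)
Lemma no_interior_max e : 0 < e -> f w != 0 ->
  ~ (forall z, normc (z - w) < r ->
       normc (f z) + e * normc z ^+ 2 <= normc (f w) + e * normc w ^+ 2).
Proof.
move=> e0 fw0 fmax; have M0 : 0 < normc (f w) by rewrite normc_gt0.
set M := normc (f w) in fmax M0; pose x := ln (r / 2); pose rho := r / 2.
have rho0 : 0 < rho by rewrite divr_gt0.
have xE : expR x = rho by rewrite lnK // posrE.
have rho_r : rho < r by rewrite /rho; have := r0; lra.
have xr : x < ln r by rewrite /x ltr_ln ?posrE.
have pi2 : 0 < pi *+ 2 :> R by rewrite mulrn_wgt0 // pi_gt0.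
(* Since |w + u| ^ 2 = |w| ^ 2 + rho ^ 2 + 2 Re (conj w u) for u on the circle |u| = rho, maximality
   at w says that Re P' <= 0. But by [mean_value] the real part of P grows by 2 pi M e rho ^ 2 > 0
   over a full turn. *)
pose K := M * e * rho ^+ 2 - M ^+ 2.
pose P y : C := cconj (f w) * V x y + K%:C%C * y%:C%C +
  (M * e)%:C%C * 2 * cconj w * cexp x%:C%C * - 'i%C * cexp ('i%C * y%:C%C).
pose P' y : C := cconj (f w) * g (cxy x y) + K%:C%C +
  (M * e)%:C%C * 2 * cconj w * cexp (cxy x y).
have PD y : Y0 < y < Y1 -> rderiv P y (P' y).
  move=> yY; apply: rderiv_eq (rderivD (rderivD (rderivZ _ (VP xr yY))
    (rderivZ _ (rderiv_id y))) (rderivZ _ (rderiv_cexp 'i%C (is_derive_id y 1)))) _.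
  rewrite /P' cxyE cexpD !mulr1; congr (_ + _ + _).
  rewrite !mulrA -[RHS]mulr1 -[X in _ = _ * X]opprK -mulii.
  ring.
have P'le y : Re (P' y) <= 0.
  have zw : normc (w + cexp (cxy x y) - w) = rho.
    by rewrite addrAC subrr add0r normc_cexp.
  have := fmax (w + cexp (cxy x y)).
  rewrite zw => /(_ rho_r).
  rewrite -/(g (cxy x y)) !normc_sqr.
  have : Re (cexp (cxy x y)) ^+ 2 + Im (cexp (cxy x y)) ^+ 2 = rho ^+ 2.
    by rewrite -normc_sqr normc_cexp xE.
  have : Re (cconj (f w) * g (cxy x y)) <= M * normc (g (cxy x y)).
    apply: le_trans (ler_norm _) (le_trans (ler_Re_normc _) _).
    by rewrite normcM normc_conj.
  rewrite /P' !CReD; move: (g (cxy x y)) => G; move: (cexp (cxy x y)) => [a b].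
  move: (Re (_ * G)) (normc G) => A B; case: w => w1 w2 /= AB ab H.
  rewrite /K; have := ler_wpM2l (ltW M0) H.
  have : M * e * (a ^+ 2 + b ^+ 2) = M * e * rho ^+ 2 by rewrite ab.
  lra.
have [| |c cP E] := @MVT_segment R (fun y => Re (P y)) (fun y => Re (P' y)) 0 (pi *+ 2) (ltW pi2).
- move=> y; rewrite in_itv /= => /andP[y0 yp].
  by have [] := PD y ltac:(by rewrite /Y0 /Y1; lra).
- apply: derivable_within_continuous => y; rewrite in_itv /= => /andP[y0 yp].
  have [PDy _] := PD y ltac:(by rewrite /Y0 /Y1; lra).
  exact: (@ex_derive _ _ _ _ _ _ _ PDy).
have : Re (P (pi *+ 2)) - Re (P 0) = pi *+ 2 * (M * e * rho ^+ 2).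
  rewrite -CReB /P (_ : cexp ('i%C * (pi *+ 2)%:C%C) = cexp ('i%C * 0%:C%C)); last first.
    by rewrite /cexp /= !(mul0r, mul1r, mulr0, subr0, addr0, add0r) cos2pi sin2pi cos0 sin0 oppr0.
  rewrite (_ : _ - _ = cconj (f w) * (V x (pi *+ 2) - V x 0) + (K * (pi *+ 2))%:C%C).
    rewrite mean_value // mulrCA cconjM -/M CReD /= /K; ring.
  by rewrite mulr0 rmorphM /=; ring.
rewrite E subr0 => H.
have : 0 < pi *+ 2 * (M * e * rho ^+ 2) by rewrite !mulr_gt0 // exprn_gt0.
by rewrite -H ltNge mulr_le0_ge0 // ltW.
Qed.

End Disc.
End MeanValue.

(** * Maximum modulus and uniqueness on rectangles *)

Section MaximumModulus.
Variable R : realType.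
Local Notation C := (CC R).
Implicit Types (f h : C -> C).

Definition rect (x0 x1 y0 y1 : R) : set C :=
  [set z | x0 <= Re z <= x1 /\ y0 <= Im z <= y1].

Lemma cxyRI (z : C) : cxy (Re z) (Im z) = z. Proof. by case: z. Qed.

Lemma rect_max (phi : C -> R) x0 x1 y0 y1 p : rect x0 x1 y0 y1 p ->
  (forall z, rect x0 x1 y0 y1 z -> forall e : R, 0 < e -> exists2 r : R, 0 < r &
    forall z', normc (z' - z) < r -> `|phi z' - phi z| < e) ->
  exists2 c, rect x0 x1 y0 y1 c & forall z, rect x0 x1 y0 y1 z -> phi z <= phi c.
Proof.
move=> Kp phic.
pose A : set (R * R) := `[x0, x1] `*` `[y0, y1].
have AE q : A q <-> rect x0 x1 y0 y1 (cxy q.1 q.2).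
  by rewrite /A /= /rect /= !in_itv.
have A0 : A !=set0 by exists (Re p, Im p); apply/AE; rewrite cxyRI.
have cA : compact A by apply: compact_setX; exact: segment_compact.
have fA : {within A, continuous (fun q : R * R => phi (cxy q.1 q.2))}.
  apply: continuous_in_subspaceT => q; rewrite inE => /AE Kq.
  apply/cvgrPdist_lt => e e0; have [r r0 rP] := phic _ Kq e e0.
  have r2 : 0 < r / 2 by rewrite divr_gt0.
  apply: filterS (nbhsx_ballx q _ r2) => q' [] /=; rewrite /ball /= => q1 q2.
  rewrite distrC; apply: rP.
  rewrite cxyB; apply: le_lt_trans (normc_cxy _ _) _.
  rewrite distrC (distrC q'.2); lra.
have [c cA' cmax] := compact_EVT_max A0 cA fA; rewrite inE in cA'.
exists (cxy c.1 c.2) => [|z Kz]; first exact/AE.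
have := cmax (Re z, Im z); rewrite inE cxyRI; apply.
by apply/AE; rewrite cxyRI.
Qed.

Lemma ler_distB_normc (z w : C) : `|normc z - normc w| <= normc (z - w).
Proof. by rewrite ler_norml lerB_normc andbT lerNl opprB normcB lerB_normc. Qed.

Lemma rect_bounded f x0 x1 y0 y1 :
  (forall z, rect x0 x1 y0 y1 z -> differentiable f z) ->
  exists2 M : R, 0 <= M & forall z, rect x0 x1 y0 y1 z -> normc (f z) <= M.
Proof.
move=> fD; have [[p Kp]|K0] := pselect (exists p, rect x0 x1 y0 y1 p); last first.
  by exists 0 => // z Kz; case: K0; exists z.
have [c Kc cmax] := @rect_max (fun z => normc (f z)) x0 x1 y0 y1 p Kp
  (fun z Kz e e0 => ltac:(have [r r0 rP] := differentiable_eps (fD z Kz) e0;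
    exists r => // z' /rP; exact: le_lt_trans (ler_distB_normc _ _))).
by exists (normc (f c)); first exact: normc_ge0.
Qed.

(** If |f p| > B, a small e gives B + e L < |f p|, with L a bound of |z| ^ 2 on the rectangle. The
    maximum of |f| + e |z| ^ 2 is then interior and f does not vanish there, against
    [no_interior_max]. *)
Lemma maximum_modulus f x0 x1 y0 y1 B : 0 <= B ->
  (forall z, rect x0 x1 y0 y1 z -> differentiable f z) ->
  (forall z, rect x0 x1 y0 y1 z ->
    [\/ Re z = x0, Re z = x1, Im z = y0 | Im z = y1] -> normc (f z) <= B) ->
  forall z, rect x0 x1 y0 y1 z -> normc (f z) <= B.
Proof.
move=> B0 fD fB p Kp; rewrite leNgt; apply/negP => pB.
have [L L0 LP] := @rect_bounded (fun z => z * z) x0 x1 y0 y1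
  (fun z _ => diffCM (diffC_id z) (diffC_id z)).
pose e := (normc (f p) - B) / (2 * (L + 1)).
have L1 : 0 < 2 * (L + 1) by rewrite mulr_gt0 // ltr_wpDl.
have e0 : 0 < e by rewrite divr_gt0 // subr_gt0.
have eL : B + e * L < normc (f p).
  rewrite -ltrBrDl /e mulrAC ltr_pdivrMr // mulrC [X in _ < X]mulrC ltr_pM2r ?subr_gt0 //.
  lra.
have phic z : rect x0 x1 y0 y1 z -> forall d : R, 0 < d -> exists2 r : R, 0 < r &
    forall z', normc (z' - z) < r ->
    `|normc (f z') + e * normc (z' * z') - (normc (f z) + e * normc (z * z))| < d.
  move=> Kz d d0; have d2 : 0 < d / 2 by rewrite divr_gt0.
  have [r r0 rP] := differentiable_eps (fD z Kz) d2.
  have [s s0 sP] := differentiable_eps (diffCM (diffC_id z) (diffC_id z))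
    (divr_gt0 d2 e0).
  exists (Num.min r s); first by rewrite lt_min r0.
  move=> z'; rewrite lt_min => /andP[/rP zr /sP zs].
  rewrite opprD addrACA -mulrBr; apply: le_lt_trans (ler_normD _ _) _.
  rewrite normrM (gtr0_norm e0).
  have H1 := le_lt_trans (ler_distB_normc _ _) zr.
  have H2 := le_lt_trans (ler_distB_normc _ _) zs.
  by rewrite ltr_pdivlMr // mulrC in H2; lra.
have [c [/andP[c1 c2] /andP[c3 c4]] cmax] := rect_max Kp phic.
have Kc : rect x0 x1 y0 y1 c by split; apply/andP.
have fc : B + e * L < normc (f c) + e * normc (c * c).
  apply: lt_le_trans eL (le_trans _ (cmax _ Kp)).
  by rewrite lerDl mulr_ge0 ?normc_ge0 // ltW.
have notB : ~ [\/ Re c = x0, Re c = x1, Im c = y0 | Im c = y1].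
  move=> /(fB _ Kc) cB; suff : B + e * L < B + e * L by rewrite ltxx.
  by apply: lt_le_trans fc (lerD cB _); rewrite ler_wpM2l ?LP // ltW.
have d1 : x0 < Re c by rewrite lt_def c1 andbT; apply/eqP => H; apply: notB; constructor 1.
have d2 : Re c < x1.
  by rewrite lt_def c2 andbT; apply/eqP => H; apply: notB; constructor 2.
have d3 : y0 < Im c by rewrite lt_def c3 andbT; apply/eqP => H; apply: notB; constructor 3.
have d4 : Im c < y1.
  by rewrite lt_def c4 andbT; apply/eqP => H; apply: notB; constructor 4.
pose r := Num.min (Num.min (Re c - x0) (x1 - Re c)) (Num.min (Im c - y0) (y1 - Im c)).
have r0 : 0 < r by rewrite !lt_min !subr_gt0 d1 d2 d3.
have Kr z : normc (z - c) < r -> rect x0 x1 y0 y1 z.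
  rewrite !lt_min => /andP[/andP[r1 r2] /andP[r3 r4]].
  have := ler_Re_normc (z - c); rewrite CReB ler_norml => /andP[z1 z2].
  have := ler_Im_normc (z - c); rewrite CImB ler_norml => /andP[z3 z4].
  split; lra.
apply: (@no_interior_max _ f c r r0 (fun z zr => fD z (Kr z zr)) e e0) => [|z zr].
  apply/eqP => fc0; move: fc; rewrite fc0 normc0 add0r ltNge => /negP; apply.
  apply: le_trans (ler_wpM2l (ltW e0) (LP _ Kc)) _; lra.
by have := cmax z (Kr z zr); rewrite !normcM -!expr2.
Qed.

(* The weight exp (q exp (c z)) is largest on the side where h vanishes. *)
Lemma rect_uniqueness h x0 x1 b : 0 < b -> x0 < x1 ->
  (forall e : R, 0 < e -> exists h', (forall z, rect x0 x1 (- b) b z ->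
     differentiable h' z /\ normc (h z - h' z) <= e)) ->
  (forall y, - b <= y <= b -> h (cxy x1 y) = 0) ->
  forall x, x0 < x <= x1 -> h (cxy x 0) = 0.
Proof.
move=> b0 x01 happ h0 x /andP[x0x xx1].
have [M M0 hM] : exists2 M : R, 0 <= M & forall z, rect x0 x1 (- b) b z -> normc (h z) <= M.
  have [h1 h1P] := happ 1 ltr01.
  have [M M0 MP] := rect_bounded (fun z Kz => (h1P z Kz).1).
  exists (1 + M); first by rewrite addr_ge0.
  move=> z Kz; rewrite -[h z](subrK (h1 z)).
  exact: le_trans (le_normcD _ _) (lerD (h1P z Kz).2 (MP z Kz)).
(* This c makes cos (c Im z) vanish for Im z = - b and Im z = b: on the horizontal sides Re exp (c
   z) = 0, below its value E0 on the real axis at the left side. *)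
pose c : R := pi / (2 * b).
have c0 : 0 < c by rewrite divr_gt0 ?pi_gt0 // mulr_gt0.
have cb : c * b = pi / 2 by rewrite /c; field; rewrite gt_eqF.
pose phi (z : C) : C := cexp (c%:C%C * z).
have RephiE z : Re (phi z) = expR (c * Re z) * cos (c * Im z).
  case: z => z1 z2; rewrite /phi /cexp /= !mul0r subr0 addr0.
  by rewrite subr0.
have Kw : rect x0 x1 (- b) b (cxy x 0).
  split; rewrite /= ?(ltW x0x) ?xx1 // lerNl oppr0; lra.
pose E0 := expR (c * x0); pose E1 := expR (c * x1); pose E := expR (c * x).
have ineq (q : nat) (e : R) : 0 < e ->
    normc (h (cxy x 0)) * expR (q%:R * E) <= M * expR (q%:R * E0) +
      e * (expR (q%:R * E) + expR (q%:R * E0) + expR (q%:R * E1)).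
  move=> e0; have [h' h'P] := happ e e0.
  pose G z := h' z * cexp (q%:R * phi z).
  have GD z : rect x0 x1 (- b) b z -> differentiable G z.
    move=> Kz; apply: diffCM; first exact: (h'P z Kz).1.
    apply: (@diffC_comp _ (fun z => q%:R * phi z)); last exact: differentiable_cexp.
    apply: diffCM; first exact: diffC_cst.
    apply: (@diffC_comp _ (fun z => c%:C%C * z)); last exact: differentiable_cexp.
    by apply: diffCM; [exact: diffC_cst|exact: diffC_id].
  have GE z : normc (G z) = normc (h' z) * expR (q%:R * Re (phi z)).
    rewrite /G normcM normc_cexp; congr (_ * expR _).
    exact: Re_natM.
  have h'M z : rect x0 x1 (- b) b z -> normc (h' z) <= M + e.
    move=> Kz; rewrite -[h' z](subKr (h z)); apply: le_trans (le_normcD _ _) _.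
    by rewrite normcN lerD ?hM // (h'P z Kz).2.
  pose B := (M + e) * expR (q%:R * E0) + e * expR (q%:R * E1).
  have Me : 0 <= M + e by rewrite addr_ge0 // ltW.
  have B1 : 0 <= (M + e) * expR (q%:R * E0) by rewrite mulr_ge0 ?expR_ge0.
  have B2 : 0 <= e * expR (q%:R * E1) by rewrite mulr_ge0 ?expR_ge0 // ltW.
  have left z : rect x0 x1 (- b) b z -> Re (phi z) <= E0 -> normc (G z) <= B.
    move=> Kz zE; rewrite GE; apply: (@le_trans _ _ ((M + e) * expR (q%:R * E0))).
      by apply: ler_pM; rewrite ?normc_ge0 ?expR_ge0 ?h'M // ler_expR ler_wpM2l.
    by rewrite /B lerDl.
  have GB : normc (G (cxy x 0)) <= B.
    apply: (@maximum_modulus G x0 x1 (- b) b) => //; first by rewrite /B addr_ge0.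
    move=> z Kz [zx|zx|zy|zy].
    - apply: left => //; rewrite RephiE zx -/E0 ler_piMr ?expR_ge0 //.
    - rewrite GE; apply: (@le_trans _ _ (e * expR (q%:R * E1))); last by rewrite /B lerDr.
      apply: ler_pM; rewrite ?normc_ge0 ?expR_ge0 //.
        have := (h'P z Kz).2; rewrite -{1}[z]cxyRI zx h0 ?sub0r ?normcN //.
        by case: Kz.
      rewrite ler_expR ler_wpM2l // RephiE zx -/E1 ler_piMr ?expR_ge0 //.
    - apply: left => //; rewrite RephiE zy mulrN cosN cb cos_pihalf mulr0.
      exact: expR_ge0.
    - apply: left => //; rewrite RephiE zy cb cos_pihalf mulr0.
      exact: expR_ge0.
  rewrite GE RephiE /= mulr0 cos0 mulr1 -/E in GB.
  have hh' : normc (h (cxy x 0)) <= e + normc (h' (cxy x 0)).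
    rewrite -[h (cxy x 0)](subrK (h' (cxy x 0))).
    by apply: le_trans (le_normcD _ _) _; rewrite lerD2r (h'P _ Kw).2.
  apply: le_trans (ler_wpM2r (expR_ge0 _) hh') _.
  move: GB; rewrite /B; lra.
(* The approximation error goes to 0 while q is fixed. What remains is |h| exp (q (E - E0)) <= M for
   every q, with E > E0, and 1 + x <= exp x with the Archimedean property concludes. *)
have ineq0 (q : nat) : normc (h (cxy x 0)) * expR (q%:R * E) <= M * expR (q%:R * E0).
  set S := expR (q%:R * E) + expR (q%:R * E0) + expR (q%:R * E1).
  have S0 : 0 < S by rewrite !addr_gt0 ?expR_gt0.
  apply/ler_addgt0Pr => e e0; have := ineq q (e / S) (divr_gt0 e0 S0).
  by rewrite -/S divfK // gt_eqF.
have EE : 0 < E - E0 by rewrite subr_gt0 ltr_expR ltr_pM2l.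
have lin (q : nat) : normc (h (cxy x 0)) * (1 + q%:R * (E - E0)) <= M.
  apply: le_trans (ler_wpM2l (normc_ge0 _) (expR_ge1Dx _)) _.
  rewrite mulrBr expRD expRN mulrA ler_pdivrMr ?expR_gt0 //.
apply/eqP; apply: contraT; rewrite -normc_gt0; set D := normc _ => D0.
have DE : 0 < D * (E - E0) by rewrite mulr_gt0.
have := archi_boundP (divr_ge0 M0 (ltW DE)); set q := Num.bound _ => qP.
have := lin q; rewrite -/D leNgt => /negP; case.
rewrite ltr_pdivrMr // in qP; apply: lt_le_trans qP _.
have -> : D * (1 + q%:R * (E - E0)) = D + q%:R * (D * (E - E0)) by ring.
by rewrite lerDr ltW.
Qed.

End MaximumModulus.

(** * Euler-Maclaurin summation *)

Section EulerMaclaurin.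
Variable R : realType.
Local Notation C := (CC R).
Implicit Types (s a : C) (x : R).

Lemma cpowD x s a : cpow x (s + a) = cpow x s * cpow x a.
Proof. by rewrite /cpow mulrDl cexpD. Qed.

Lemma cpow1 s : cpow 1 s = 1.
Proof. by rewrite /cpow ln1 mulr0 cexp0. Qed.

Lemma cpow_nat x n : 0 < x -> cpow x (n%:R : C) = x%:C%C ^+ n.
Proof. by move=> x0; rewrite /cpow -cexpX cexp_real lnK. Qed.

Lemma normc_cpow x s : 0 < x -> normc (cpow x s) = expR (Re s * ln x).
Proof. by move=> x0; rewrite normc_cexp CReM /= mulr0 subr0. Qed.

Lemma cpowN1 x : 0 < x -> cpow x (-1) = (x^-1)%:C%C.
Proof. by move=> x0; rewrite /cpow mulN1r cexpN cexp_real lnK // fmorphV. Qed.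

Lemma rderiv_cpow s x : 0 < x -> rderiv (fun y => cpow y s) x (s * cpow x (s - 1)).
Proof.
move=> x0; apply: rderiv_eq (rderiv_cexp s (@is_derive1_ln R x x0)) _.
by rewrite cpowD cpowN1 // -mulrA [X in s * X]mulrC.
Qed.

(* n-th derivative of x ^ (1 - s) / (1 - s) *)
Definition emcoef s n : C :=
  if n is m.+1 then \prod_(i < m) (- s - i%:R) else (1 - s)^-1.

Definition emfun s n x : C := emcoef s n * cpow x (1 - s - n%:R).

Lemma emfun_rderiv s n x : s != 1 -> 0 < x ->
  rderiv (emfun s n) x (emfun s n.+1 x).
Proof.
move=> s1 x0; apply: rderiv_eq (rderivZ _ (rderiv_cpow _ x0)) _.
rewrite /emfun mulrA; congr (_ * cpow _ _); last by rewrite -natr1; ring.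
case: n => [|n] /=; first by rewrite subr0 mulVf ?big_ord0 // subr_eq0 eq_sym.
by rewrite big_ord_recr /= -natr1; congr (_ * _); ring.
Qed.

(** The operator D / (1 - exp D), cut after degree K, applied to the primitive x ^ (1 - s) / (1 - s)
    of x ^ - s; its increments nearly cancel the terms N ^ - s. *)
Definition emtail K s x : C := \sum_(n < K.+1) cber R n * emfun s n x.

Lemma cber_rec d : \sum_(n < d.+1) cber R n / (d - n).+1`!%:R = - (d == 0%N)%:R.
Proof.
have := congr1 (ratr : rat -> C) (ber_rec d).
rewrite rmorph_sum rmorphN rmorph_nat => <-.
by apply: eq_bigr => n _; rewrite fmorph_div rmorph_nat.
Qed.

(* Formally, (exp D - 1) (D / (1 - exp D)) = - D. *)
Lemma emtail_formal K (g : nat -> C) : (0 < K)%N ->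
  \sum_(n < K.+1) cber R n * \sum_(i < K.+1 - n) g (n + i)%N / i`!%:R =
  \sum_(n < K.+1) cber R n * g n - g 1%N.
Proof.
move=> K0.
have inner (n : 'I_K.+1) : \sum_(i < K.+1 - n) g (n + i)%N / i`!%:R =
    g n + \sum_(d < K.+1 | (n < d)%N) g d / (d - n)`!%:R.
  rewrite -(big_mkord xpredT (fun i => g (n + i)%N / i`!%:R)) big_ltn ?subn_gt0 //.
  rewrite addn0 fact0 divr1; congr (_ + _).
  rewrite -(big_mkord (fun d => (n < d)%N) (fun d => g d / (d - n)`!%:R)).
  rewrite [RHS](big_cat_nat (n := n.+1)) //= [X in _ = X + _]big1_seq ?add0r; last first.
    by move=> d; rewrite mem_index_iota; lia.
  have := @big_addn C 0 +%R 1 K.+1 n (fun d => (n < d)%N) (fun d => g d / (d - n)`!%:R).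
  rewrite add1n => ->; rewrite [RHS]big_nat_cond [LHS]big_nat_cond.
  apply: eq_big => [i|i _]; first by lia.
  by rewrite addnK addnC.
under eq_bigr do rewrite inner mulrDr mulr_sumr.
rewrite big_split /=; congr (_ + _).
rewrite (exchange_big_dep xpredT) //= (bigD1 (Ordinal (K0 : (1 < K.+1)%N))) //=.
rewrite [X in _ + X]big1 ?addr0 => [|d d1].
  rewrite (eq_bigl (fun i : 'I_K.+1 => i == ord0)); last by case=> -[|[|i]].
  by rewrite big_pred1_eq subn0 divr1 /cber ber0 rmorphN1 mulN1r.
case: d d1 => -[|d] /= dK d1; first by rewrite big1.
under eq_bigr => n nd do rewrite mulrCA.
rewrite -mulr_sumr.
have -> : \sum_(n < K.+1 | (n < d.+1)%N) cber R n / (d.+1 - n)`!%:R =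
    \sum_(n < d.+1) cber R n / (d - n).+1`!%:R.
  rewrite (@big_ord_widen _ _ _ d.+1 K.+1 (fun n => cber R n / (d - n).+1`!%:R)); last by lia.
  by apply: eq_bigr => n nd; rewrite subSn.
rewrite cber_rec; case: (eqVneq d 0%N) d1 => [d0|d0] d1; last first.
  by rewrite oppr0 mulr0.
by case/eqP: d1; apply: val_inj; rewrite /= d0.
Qed.

Lemma inv_sq_le (n : nat) : (0 < n)%N -> n%:R ^- 2 <= 2 * (n%:R^-1 - n.+1%:R^-1) :> R.
Proof.
move=> n0; have n0' : 0 < n%:R :> R by rewrite ltr0n.
rewrite -[n.+1%:R]natr1 (_ : n%:R^-1 - (n%:R + 1)^-1 = (n%:R * (n%:R + 1))^-1); last first.
  by field; lra.
rewrite -ler_pdivrMl ?ltr0n // -invfM lef_pV2 ?posrE ?mulr_gt0 ?exprn_gt0 ?ltr_wpDl ?(ltW n0') //.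
have : 1 <= n%:R :> R by rewrite ler1n.
nra.
Qed.

(** The n-th derivative is expanded at N to order K + 1 - n, so every remainder involves the
    derivative of order K + 1, of size A N ^ - (Re s + K), hence at most A N ^ - 2. *)
Lemma em_step K s N (A : R) : (0 < K)%N -> s != 1 -> 2 <= Re s + K%:R -> (0 < N)%N ->
  normc (emcoef s K.+1) <= A ->
  normc (emtail K s N.+1%:R - emtail K s N%:R + cpow N%:R (- s)) <=
  K.+1%:R * 2 ^+ K.+1 * A * N%:R ^- 2.
Proof.
move=> K0 s1 sK N0 sA; have N0' : 0 < N%:R :> R by rewrite ltr0n.
pose g n x := emfun s n x.
have gB x : N%:R <= x <= N.+1%:R -> normc (g K.+1 x) <= A * N%:R ^- 2.
  move=> /andP[Nx _]; have x0 : 0 < x by exact: lt_le_trans Nx.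
  rewrite /g /emfun normcM; apply: ler_pM; rewrite ?normc_ge0 // normc_cpow //.
  have -> : Re (1 - s - K.+1%:R) = - (Re s + K%:R).
    rewrite !CReB -[K.+1%:R](rmorph_nat (real_complex R)) /= -natr1; ring.
  rewrite -[_ ^- 2]lnK ?posrE ?invr_gt0 ?exprn_gt0 // ler_expR lnV ?posrE ?exprn_gt0 //.
  rewrite lnXn // mulNr lerN2 -[_ *+ 2]mulr_natl.
  apply: ler_pM => //; first by rewrite ln_ge0 // ler1n.
  by rewrite ler_ln ?posrE.
have tay (n : 'I_K.+1) : normc (g n N.+1%:R - \sum_(i < K.+1 - n) g (n + i)%N N%:R / i`!%:R)
    <= 2 ^+ K.+1 * (A * N%:R ^- 2).
  have NN : N%:R <= N.+1%:R :> R by rewrite ler_nat.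
  have := @taylor_bound R (fun i => g (n + i)%N) N%:R N.+1%:R (A * N%:R ^- 2) (K.+1 - n) NN.
  rewrite subnKC 1?ltnW // addn0 -[N.+1%:R]natr1 addrAC subrr add0r mulr1 natr1.
  move=> /(_ _ gB) tB.
  apply: le_trans (_ : _ <= 2 ^+ (K.+1 - n) * (A * N%:R ^- 2)) _.
    rewrite (eq_bigr (fun i : 'I__ => g (n + i)%N N%:R * (1 ^+ i / i`!%:R)%:C%C)).
      apply: tB => i y /andP[Ny _]; rewrite addnS; apply: emfun_rderiv => //.
      exact: lt_le_trans Ny.
    by move=> i _; rewrite expr1n mul1r fmorphV rmorph_nat.
  rewrite ler_wpM2r ?mulr_ge0 ?invr_ge0 ?exprn_ge0 ?(le_trans (normc_ge0 _) sA) //.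
  by rewrite ler_weXn2l ?ler1n // leq_subr.
have -> : emtail K s N.+1%:R - emtail K s N%:R + cpow N%:R (- s) =
    \sum_(n < K.+1) cber R n *
      (g n N.+1%:R - \sum_(i < K.+1 - n) g (n + i)%N N%:R / i`!%:R).
  under [RHS]eq_bigr do rewrite mulrBr.
  rewrite sumrB (emtail_formal (fun n => g n N%:R)) // opprB addrA addrAC.
  congr (_ + _).
  by rewrite /g /emfun /= big_ord0 mul1r; congr cpow; ring.
apply: le_trans (normc_sum _ _ _) _.
apply: (@le_trans _ _ (\sum_(n < K.+1) 2 ^+ K.+1 * (A * N%:R ^- 2))).
  apply: ler_sum => n _; rewrite normcM.
  apply: le_trans (ler_pM _ _ (normc_cber R n) (tay n)) _; rewrite ?normc_ge0 //.
  by rewrite mul1r.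
by rewrite sumr_const card_ord -[X in X <= _]mulr_natl !mulrA.
Qed.

Definition emsum K s N : C :=
  \sum_(1 <= m < N) cpow m%:R (- s) + emtail K s N%:R.

(** In each component the intervals of radius c / N around the N-th term are nested; their common
    point is the limit and the rate comes with it. *)
Lemma cvg_telescope (u : nat -> C) (c : R) : 0 <= c ->
  (forall N, (0 < N)%N -> normc (u N.+1 - u N) <= c * (N%:R^-1 - N.+1%:R^-1)) ->
  exists l : C, forall N, (0 < N)%N -> normc (u N - l) <= 2 * c * N%:R^-1.
Proof.
move=> c0 uc.
have real_case (v : nat -> R) :
    (forall N, (0 < N)%N -> `|v N.+1 - v N| <= c * (N%:R^-1 - N.+1%:R^-1)) ->
    exists l : R, forall N, (0 < N)%N -> `|v N - l| <= c * N%:R^-1.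
  move=> vc.
  have uS n : v n.+1 - c * n.+1%:R^-1 <= v n.+2 - c * n.+2%:R^-1.
    have := vc n.+1 isT; move: (n.+1%:R^-1 : R) (n.+2%:R^-1 : R) => x y.
    by rewrite ler_norml => /andP[]; lra.
  have wS n : v n.+2 + c * n.+2%:R^-1 <= v n.+1 + c * n.+1%:R^-1.
    have := vc n.+1 isT; move: (n.+1%:R^-1 : R) (n.+2%:R^-1 : R) => x y.
    by rewrite ler_norml => /andP[]; lra.
  have uw n : v n.+1 - c * n.+1%:R^-1 <= v n.+1 + c * n.+1%:R^-1.
    by rewrite lerD2l ge0_cp ?mulr_ge0 ?invr_ge0.
  have [l lP] := @nested_intervals R (fun n => v n.+1 - c * n.+1%:R^-1)
    (fun n => v n.+1 + c * n.+1%:R^-1) uS wS uw.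
  exists l => -[//|n] _; have := lP n; move: (n.+1%:R^-1 : R) => x.
  by rewrite ler_norml => /andP[? ?]; apply/andP; split; lra.
have [|l lP] := real_case (fun N => Re (u N)).
  by move=> N N0; rewrite -CReB; exact: le_trans (ler_Re_normc _) (uc N N0).
have [|l' lP'] := real_case (fun N => Im (u N)).
  by move=> N N0; rewrite -CImB; exact: le_trans (ler_Im_normc _) (uc N N0).
exists (l +i* l')%C => N N0; apply: le_trans (normc_le_ReIm _) _.
rewrite CReB CImB /=; have := lP N N0; have := lP' N N0; lra.
Qed.

(** Of the 4, one factor 2 is from [inv_sq_le] and one from [cvg_telescope]. *)
Definition emconst K : R := 4 * (K.+1%:R * 2 ^+ K.+1).

Lemma emsum_cvg K s (A : R) : (0 < K)%N -> s != 1 -> 2 <= Re s + K%:R ->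
  normc (emcoef s K.+1) <= A ->
  exists l : C, forall N, (0 < N)%N -> normc (emsum K s N - l) <= emconst K * A * N%:R^-1.
Proof.
move=> K0 s1 sK sA; have A0 : 0 <= A by exact: le_trans (normc_ge0 _) sA.
have B0 : 0 <= K.+1%:R * 2 ^+ K.+1 * A by rewrite !mulr_ge0 ?exprn_ge0.
have [|N N0|l lP] := @cvg_telescope (emsum K s) (2 * (K.+1%:R * 2 ^+ K.+1 * A)).
- by rewrite mulr_ge0.
- have -> : emsum K s N.+1 - emsum K s N =
      emtail K s N.+1%:R - emtail K s N%:R + cpow N%:R (- s).
    by rewrite /emsum big_nat_recr //=; ring.
  apply: le_trans (em_step K0 s1 sK N0 sA) _.
  rewrite [2 * _]mulrC -[X in _ <= X]mulrA ler_wpM2l //.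
  exact: inv_sq_le.
exists l => N N0; apply: le_trans (lP N N0) _; rewrite /emconst.
by rewrite le_eqVlt; apply/orP; left; apply/eqP; ring.
Qed.

Lemma normc_emcoef K s : normc (emcoef s K.+1) <= (normc s + K%:R) ^+ K.
Proof.
rewrite /=; have bound (m : nat) : (m <= K)%N ->
    normc (\prod_(i < m) (- s - i%:R)) <= (normc s + K%:R) ^+ m.
  elim: m => [|m IH] mK; first by rewrite big_ord0 normc1 expr0.
  rewrite big_ord_recr normcM exprSr; apply: ler_pM; rewrite ?normc_ge0 ?IH 1?ltnW //.
  apply: le_trans (le_normcD _ _) _; rewrite !normcN normc_nat lerD2l ler_nat.
  exact: ltnW.
exact: bound.
Qed.

Lemma cpow_cvg0 s : Re s < 0 -> (fun N : nat => cpow N%:R s) @ \oo --> (0 : C).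
Proof.
move=> s0; apply/cvgCP => e e0; pose B := expR (ln e / Re s).
exists (Num.bound B).+1 => // N BN; rewrite sub0r normcN.
have B0 : 0 < B by exact: expR_gt0.
have BN' : B < N%:R.
  apply: lt_le_trans (archi_boundP (ltW B0)) _; rewrite ler_nat; exact: ltnW.
have N0 : 0 < N%:R :> R by exact: lt_trans B0 BN'.
rewrite normc_cpow // -[ltRHS]lnK ?posrE // ltr_expR.
rewrite -ltr_ln ?posrE // in BN'; rewrite expRK in BN'.
by rewrite ltr_ndivrMr // mulrC in BN'.
Qed.

Lemma emtail_cvg0 K s : 1 < Re s -> (fun N : nat => emtail K s N%:R) @ \oo --> (0 : C).
Proof.
move=> s1; rewrite (_ : (0 : C) = \sum_(n < K.+1) cber R n * (emcoef s n * 0)); last first.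
  by rewrite big1 // => n _; rewrite !mulr0.
refine (@cvgn_sum R K.+1 (fun n N => cber R n * emfun s n N%:R) _ _) => n.
refine (cvgnZ (cvgnZ (cpow_cvg0 _))).
rewrite !CReB -[(n%:R : C)](rmorph_nat (real_complex R)) /=.
have : 0 <= n%:R :> R by []; lra.
Qed.

Lemma differentiable_cpow x (f : C -> C) s : differentiable f s ->
  differentiable (fun z => cpow x (f z)) s.
Proof.
move=> fD; apply: (@diffC_comp _ (fun z => f z * (ln x)%:C%C)).
  by apply: diffCM => //; exact: diffC_cst.
exact: differentiable_cexp.
Qed.

Lemma diffCB (f g : C -> C) p : differentiable f p -> differentiable g p ->
  differentiable (fun z => f z - g z) p.
Proof. by move=> fD gD; exact: diffCD fD (diffCN gD). Qed.

Lemma differentiable_emcoef n s : s != 1 -> differentiable (emcoef ^~ n) s.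
Proof.
move=> s1; case: n => [|m].
  apply: diffCV; last by rewrite subr_eq0 eq_sym.
  by apply: diffCB; [exact: diffC_cst|exact: diffC_id].
elim: m => [|m IH].
  rewrite (_ : emcoef ^~ 1%N = fun=> 1); first exact: diffC_cst.
  by apply/funext => z; rewrite /emcoef big_ord0.
rewrite (_ : emcoef ^~ m.+2 = fun z => emcoef z m.+1 * (- z - m%:R)).
  apply: diffCM; first exact: IH.
  apply: diffCB; last exact: diffC_cst.
  by apply: diffCN; exact: diffC_id.
by apply/funext => z; rewrite /emcoef big_ord_recr.
Qed.

Lemma differentiable_emsum K s N : s != 1 -> differentiable (fun z => emsum K z N) s.
Proof.
move=> s1; apply: diffCD.
  rewrite (_ : (fun z => _) = fun z => \sum_(i < N.-1) cpow i.+1%:R (- z)).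
    by apply: diffC_sum => i; apply: differentiable_cpow; apply: diffCN; exact: diffC_id.
  apply/funext => z; rewrite big_add1 big_mkord.
  by apply: eq_bigr.
apply: diffC_sum => n; apply: diffCM; first exact: diffC_cst.
apply: diffCM; first exact: differentiable_emcoef.
apply: differentiable_cpow; apply: diffCB; last exact: diffC_cst.
by apply: diffCB; [exact: diffC_cst|exact: diffC_id].
Qed.

Lemma neg_nat_neq1 k : - k%:R != 1 :> C.
Proof.
rewrite -(rmorph_nat (real_complex R)) -rmorphN -(rmorph1 (real_complex R)).
rewrite (inj_eq (@complexI _)); apply/eqP => k1.
by have := ler0n R k; rewrite -oppr_le0 k1 ler10.
Qed.

Lemma natC_neq0 n : (0 < n)%N -> n%:R != 0 :> C.
Proof. by move=> n0; rewrite -normc_gt0 normc_nat ltr0n. Qed.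

Lemma emcoef_neg k n : emcoef (- k%:R) n =
  if (n <= k.+1)%N then k`!%:R / (k.+1 - n)`!%:R else 0.
Proof.
case: n => [|m].
  rewrite /= subn0 opprK nat1r factS natrM invfM mulrCA mulfV ?mulr1 //.
rewrite ltnS subSS; elim: m => [|m IH].
  by rewrite /= big_ord0 subn0 mulfV // natC_neq0 // fact_gt0.
rewrite /= big_ord_recr -/(emcoef (- k%:R) m.+1) IH opprK.
case: (ltngtP m k) => [mk|km|->].
- have d : (k - m = (k - m.+1).+1)%N by lia.
  have -> : k%:R - m%:R = (k - m.+1).+1%:R :> C by rewrite -d natrB // ltnW.
  rewrite d factS natrM; have := natC_neq0 (ltn0Sn (k - m.+1)).
  move: (_.+1%:R) => x x0; rewrite invfM [x^-1 * _]mulrC mulrA -[LHS]mulrA mulVf //.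
  by rewrite mulr1.
- exact: mul0r.
- by rewrite subrr; exact: mulr0.
Qed.

Lemma cpow_neg_exp k n x : (n <= k.+1)%N -> 0 < x ->
  cpow x (1 - - k%:R - n%:R : C) = x%:C%C ^+ (k.+1 - n).
Proof.
by move=> nk x0; rewrite opprK nat1r -natrB // cpow_nat.
Qed.

(** At s = - k the derivative of order K + 1 is zero, so [em_step] with A = 0 makes [emsum] constant
    in N. At N = 1 the recursion of [cber] leaves the single term n = k + 1: the classical value -
    B_(k+1) / (k + 1) of zeta (- k). *)
Lemma emsum_neg K k N : (0 < k)%N -> (k.+1 < K)%N -> (0 < N)%N ->
  emsum K (- k%:R) N = k`!%:R * cber R k.+1.
Proof.
move=> k0 kK N0.
have c0 : emcoef (- k%:R) K.+1 = 0 by rewrite emcoef_neg ifF //; lia.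
have sK : 2 <= Re (- k%:R : C) + K%:R.
  rewrite -(rmorph_nat (real_complex R)) -rmorphN /=.
  rewrite -lerBlDl opprK -natrD ler_nat; lia.
have K0 : (0 < K)%N by lia.
have n0 : normc (emcoef (- k%:R : C) K.+1) <= 0 by rewrite c0 normc0.
have step M : (0 < M)%N -> emsum K (- k%:R) M.+1 = emsum K (- k%:R) M.
  move=> M0; apply/eqP; rewrite -subr_eq0; apply/eqP/eq0_normc/eqP.
  rewrite eq_le normc_ge0 andbT.
  have -> : emsum K (- k%:R) M.+1 - emsum K (- k%:R) M =
      emtail K (- k%:R) M.+1%:R - emtail K (- k%:R) M%:R + cpow M%:R (- - k%:R).
    by rewrite /emsum big_nat_recr //=; ring.
  by have := em_step K0 (neg_nat_neq1 k) sK M0 n0; rewrite mulr0 mul0r.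
have -> : emsum K (- k%:R) N = emsum K (- k%:R) 1.
  by case: N N0 => // N _; elim: N => // N IH; rewrite step.
rewrite /emsum big_geq // add0r /emtail.
rewrite (eq_bigr (fun n : 'I_K.+1 => if (n <= k.+1)%N
    then k`!%:R * (cber R n / (k.+1 - n)`!%:R) else 0)); last first.
  move=> n _; rewrite /emfun emcoef_neg cpow1 mulr1; case: ifP => _.
    by rewrite mulrCA.
  by rewrite mulr0.
rewrite -big_mkcond -(@big_ord_widen _ _ _ k.+2 K.+1
  (fun n => k`!%:R * (cber R n / (k.+1 - n)`!%:R))); last by lia.
rewrite -mulr_sumr big_ord_recr /= subnn divr1; congr (_ * _).
rewrite (eq_bigr (fun n : 'I_k.+1 => cber R n / (k - n).+1`!%:R)) ?cber_rec.
  by case: k k0 {kK c0 sK n0 step} => // k _; rewrite oppr0 add0r.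
by move=> n _; rewrite subSn // -ltnS.
Qed.

(* Faulhaber *)
Lemma sum_powers k N : (0 < k)%N -> (0 < N)%N ->
  \sum_(1 <= m < N) (m%:R : C) ^+ k =
  - \sum_(n < k.+1) cber R n * (k`!%:R / (k.+1 - n)`!%:R) * N%:R ^+ (k.+1 - n).
Proof.
(* With K = k + 2 the term n = k + 1 of the tail is the constant value itself, and the term n = k +
   2 vanishes. *)
move=> k0 N0; have := @emsum_neg k.+2 k N k0 (leqnn _) N0.
rewrite /emsum.
rewrite (eq_big_nat _ _ (F2 := fun m => m%:R ^+ k)); last first.
  move=> m /andP[m0 _]; rewrite opprK cpow_nat ?ltr0n //.
  by rewrite rmorph_nat.
rewrite /emtail big_ord_recr big_ord_recr /=.
have e0 : emfun (- k%:R) k.+2 (N%:R : R) = 0.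
  by rewrite /emfun emcoef_neg ifF ?mul0r //; lia.
have e1 : emfun (- k%:R) k.+1 (N%:R : R) = k`!%:R.
  by rewrite /emfun emcoef_neg leqnn subnn divr1 cpow_neg_exp ?ltr0n // subnn mulr1.
rewrite -/(emfun (- k%:R) k.+2 N%:R) -/(emfun (- k%:R) k.+1 N%:R) e0 e1 mulr0 addr0 addrA.
move=> E; apply/eqP; rewrite -addr_eq0; apply/eqP/(addIr (cber R k.+1 * k`!%:R)).
rewrite add0r [RHS]mulrC -E; congr (_ + _ + _); apply: eq_bigr => n _.
rewrite /emfun emcoef_neg cpow_neg_exp ?ltr0n //; last by rewrite ltnW.
by rewrite ifT ?mulrA ?rmorph_nat // ltnW.
Qed.

End EulerMaclaurin.

(** * Continuation of a Dirichlet series to a negative integer *)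

Section Continuation.
Variable R : realType.
Local Notation C := (CC R).

(** [W] stands for the restriction of the multiple zeta function to a line, its inner sum having
    become the polynomial with terms p_j m ^ (e_j). Holomorphy is asked off the real axis and in a
    vertical strip around - k, which is where the path runs. *)
Variables (W : C -> C) (k d : nat) (L : R) (p : 'I_d -> C) (e : 'I_d -> nat).
Hypothesis k_gt0 : (0 < k)%N.
Hypothesis W_diff : forall s : C, Im s != 0 \/ `|Re s + k%:R| <= 2^-1 -> differentiable W s.
Hypothesis W_sum : forall s : C, L < Re s ->
  (fun N => \sum_(1 <= m < N) cpow m%:R (- s) * \sum_(j < d) p j * m%:R ^+ e j) @ \oo
    --> W s.

Let E : nat := (\max_(j < d) e j)%N.
(** Large enough for 2 <= Re (z - e_j) + K whenever Re z >= - k - 1, and for [emsum_neg] at k +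
    e_j. *)
Let K : nat := (k + E + 4)%N.

Let eE j : (e j <= E)%N. Proof. exact: leq_bigmax. Qed.

Let emc0 : 0 <= emconst R K.
Proof. by rewrite /emconst mulr_ge0 // mulr_ge0 // exprn_ge0. Qed.

(** The shifted zeta value is chosen through its explicit error bound and not as a limit: the bound
    is uniform on bounded sets of s. *)
Let zl_bound (s l : C) := forall N, (0 < N)%N ->
  normc (emsum K s N - l) <= emconst R K * (normc s + K%:R) ^+ K * N%:R^-1.
Let zl (s : C) : C := xget 0 [set l | zl_bound s l].

Let zlP (s : C) : s != 1 -> 2 <= Re s + K%:R -> zl_bound s (zl s).
Proof.
move=> s1 sK; rewrite /zl; case: xgetP => [l _ //|/(_ _) no].
have K0 : (0 < K)%N by rewrite /K; lia.
by have [l lP] := emsum_cvg K0 s1 sK (normc_emcoef K s); case: (no l).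
Qed.

(** This region contains both rectangles of the path, and no shifted argument z - e_j takes the
    polar value 1 in it. *)
Let good (z : C) := (Im z != 0 \/ `|Re z + k%:R| <= 2^-1) /\ - k%:R - 1 <= Re z.

Let Re_subn (z : C) (n : nat) : Re (z - n%:R) = Re z - n%:R.
Proof. by rewrite CReB -[(n%:R : C)](rmorph_nat (real_complex R)). Qed.

Let Im_subn (z : C) (n : nat) : Im (z - n%:R) = Im z.
Proof. by rewrite CImB -[(n%:R : C)](rmorph_nat (real_complex R)) /= subr0. Qed.

Let good_neq1 z j : good z -> z - (e j)%:R != 1.
Proof.
move=> [zg _]; apply/eqP => z1.
have := congr1 (fun z : C => Re z) z1; have := congr1 (fun z : C => Im z) z1.
rewrite /= Re_subn Im_subn => iz rz; case: zg => [/eqP//|].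
rewrite ler_norml => /andP[_]; have : 0 <= (e j)%:R :> R by [].
have : 1 <= k%:R :> R by rewrite ler1n.
lra.
Qed.

Let good_Re z j : good z -> 2 <= Re (z - (e j)%:R) + K%:R.
Proof.
move=> [_ zk]; rewrite Re_subn /K !natrD.
have : (e j)%:R <= E%:R :> R by rewrite ler_nat eE.
lra.
Qed.

Let h (z : C) : C := W z - \sum_(j < d) p j * zl (z - (e j)%:R).

Let h_approx (B : R) (eps : R) : 0 <= B -> 0 < eps -> exists h' : C -> C,
  forall z, good z -> normc z <= B -> differentiable h' z /\ normc (h z - h' z) <= eps.
Proof.
move=> B0 eps0.
pose M := \sum_(j < d) normc (p j) * (emconst R K * (B + E%:R + K%:R) ^+ K).
have M0 : 0 <= M.
  apply: sumr_ge0 => j _; rewrite mulr_ge0 ?normc_ge0 // mulr_ge0 ?emc0 //.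
  by rewrite exprn_ge0 // !addr_ge0.
pose N := (Num.bound (M / eps)).+1.
have NM : M * N%:R^-1 <= eps.
  have := archi_boundP (divr_ge0 M0 (ltW eps0)).
  rewrite ltr_pdivrMr // => MN; rewrite ler_pdivrMr ?ltr0n //.
  apply: le_trans (ltW MN) _; rewrite mulrC ler_wpM2l ?(ltW eps0) //.
  by rewrite ler_nat.
exists (fun z => W z - \sum_(j < d) p j * emsum K (z - (e j)%:R) N) => z zg zB.
split.
  apply: diffCB; first exact: W_diff zg.1.
  apply: diffC_sum => j; apply: diffCM; first exact: diffC_cst.
  apply: (@diffC_comp _ (fun z => z - (e j)%:R) (fun z => emsum K z N)).
    by apply: diffCB; [exact: diffC_id|exact: diffC_cst].
  by apply: differentiable_emsum; exact: good_neq1.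
have -> : h z - (W z - \sum_(j < d) p j * emsum K (z - (e j)%:R) N) =
    \sum_(j < d) p j * (emsum K (z - (e j)%:R) N - zl (z - (e j)%:R)).
  under [RHS]eq_bigr do rewrite mulrBr.
  by rewrite sumrB /h; ring.
apply: le_trans (normc_sum _ _ _) (le_trans _ NM).
rewrite /M mulr_suml; apply: ler_sum => j _; rewrite normcM -mulrA.
rewrite ler_wpM2l ?normc_ge0 //.
apply: le_trans (zlP (good_neq1 j zg) (good_Re j zg) (ltn0Sn _)) _.
rewrite ler_wpM2r ?invr_ge0 // ler_wpM2l ?mulr_ge0 ?exprn_ge0 //.
rewrite lerXn2r ?nnegrE ?addr_ge0 ?normc_ge0 // lerD2r.
apply: le_trans (le_normcD _ _) _; rewrite normcN normc_nat lerD //.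
by rewrite ler_nat eE.
Qed.

Let zl_cvg (s : C) : s != 1 -> 2 <= Re s + K%:R -> emsum K s @ \oo --> zl s.
Proof.
move=> s1 sK; have sP := zlP s1 sK; apply/cvgCP => eps eps0.
set M := emconst R K * (normc s + K%:R) ^+ K in sP.
have M0 : 0 <= M.
  by rewrite mulr_ge0 ?emc0 // exprn_ge0 // addr_ge0 ?normc_ge0.
exists (Num.bound (M / eps)).+1 => // N BN.
have N0 : (0 < N)%N by exact: leq_trans BN.
rewrite normcB; apply: le_lt_trans (sP N N0) _.
have := archi_boundP (divr_ge0 M0 (ltW eps0)).
rewrite ltr_pdivrMr // => MN; rewrite ltr_pdivrMr ?ltr0n //.
apply: lt_le_trans MN _; rewrite mulrC ler_wpM2l ?(ltW eps0) // ler_nat.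
exact: ltnW.
Qed.

Let h_eq0 z : L < Re z -> E%:R + 1 < Re z -> h z = 0.
Proof.
move=> zL zE; have eR j : (e j)%:R <= E%:R :> R by rewrite ler_nat eE.
have z1 j : 1 < Re (z - (e j)%:R) by rewrite Re_subn; have := eR j; lra.
have zn1 j : z - (e j)%:R != 1.
  by apply/eqP => E1; have := z1 j; rewrite E1 /= ltxx.
have zK j : 2 <= Re (z - (e j)%:R) + K%:R.
  have := z1 j; have : 1 <= K%:R :> R by rewrite ler1n /K; lia.
  lra.
apply/eqP; rewrite subr_eq0; apply/eqP.
have lim1 : (fun N => \sum_(j < d) p j * emsum K (z - (e j)%:R) N) @ \oo -->
    (\sum_(j < d) p j * zl (z - (e j)%:R) : C).
  exact (cvgn_sum (fun j => cvgnZ (zl_cvg (zn1 j) (zK j)))).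
have lim2 : (fun N : nat => \sum_(j < d) p j * emtail K (z - (e j)%:R) N%:R) @ \oo -->
    (\sum_(j < d) p j * 0 : C).
  exact (cvgn_sum (fun j => cvgnZ (emtail_cvg0 K (z1 j)))).
have := cvgnD (W_sum zL) lim2; rewrite [X in _ + X]big1 ?addr0 => [lim3|j _]; last exact: mulr0.
refine (cvgn_uniq lim3 (cvgn_ext _ lim1)) => N.
rewrite /emsum; under eq_bigr do rewrite mulrDr mulr_sumr.
rewrite big_split /=; congr (_ + _); rewrite exchange_big /= big_nat [RHS]big_nat.
apply: eq_bigr => m /andP[m0 _]; rewrite mulr_sumr; apply: eq_bigr => j _.
rewrite [RHS]mulrCA; congr (_ * _); rewrite opprB addrC cpowD; congr (_ * _).
by rewrite cpow_nat ?ltr0n // rmorph_nat.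
Qed.

Lemma continuation_value : W (- k%:R) =
  \sum_(j < d) p j * ((k + e j)`!%:R * cber R (k + e j).+1).
Proof.
have k1 : 1 <= k%:R :> R by rewrite ler1n.
pose X := Num.max L (E%:R + 1) + 1.
have XL : L < X by rewrite /X ltr_pwDr // le_max lexx.
have XE : E%:R + 1 < X by rewrite /X ltr_pwDr // le_max lexx orbT.
have X0 : 0 < X by apply: lt_trans XE; rewrite ltr_wpDl.
have h1 : 0 < 2^-1 :> R by rewrite invr_gt0.
(* Horizontal rectangle centred on Im z = 1; the half-height 1/2 keeps it off the real axis, and at
   Re z = X the two sides agree by absolute comparison of the series. *)
have line1 x : - k%:R - 1 < x <= X -> h (cxy x 1) = 0.
  move=> xx; pose g (z : C) := h (z + 'i%C).
  have gE y z : g (cxy y z) = h (cxy y (z + 1)).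
    by rewrite /g; congr h; rewrite !cxyE rmorphD /=; ring.
  have -> : h (cxy x 1) = g (cxy x 0) by rewrite gE add0r.
  apply: (@rect_uniqueness R g (- k%:R - 1) X 2^-1 h1 _ _ _ x xx); first by lra.
    move=> eps eps0.
    have B0 : 0 <= k%:R + 1 + X + 2 by lra.
    have [h' h'P] := h_approx B0 eps0; exists (fun z => h' (z + 'i%C)).
    move=> z [/andP[z1 z2] /andP[z3 z4]].
    have ReE : Re (z + 'i%C) = Re z by rewrite CReD /= addr0.
    have ImE : Im (z + 'i%C) = Im z + 1 by rewrite CImD.
    have zg : good (z + 'i%C).
      split; last by rewrite ReE.
      by left; rewrite ImE; apply/eqP; lra.
    have zB : normc (z + 'i%C) <= k%:R + 1 + X + 2.
      apply: le_trans (normc_le_ReIm _) _; rewrite ReE ImE.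
      have : `|Re z| <= k%:R + 1 + X by rewrite ler_norml; apply/andP; split; lra.
      have : `|Im z + 1| <= 2 by rewrite ler_norml; apply/andP; split; lra.
      lra.
    have [hd hn] := h'P _ zg zB; split; last exact: hn.
    apply: (@diffC_comp _ (fun z => z + 'i%C) h' z _ hd).
    by apply: diffCD; [exact: diffC_id|exact: diffC_cst].
  by move=> y yy; rewrite gE; apply: h_eq0.
(* A quarter turn: the segment from - k + i down to - k becomes horizontal, and its side at height 1
   lies on the line just settled. The left end - 1/2 leaves the target point strictly inside. *)
pose g (z : C) := h (- k%:R + 'i%C * z).
have gE x y : g (cxy x y) = h (cxy (- k%:R - y) x).
  rewrite /g; congr h; rewrite !cxyE rmorphB /= rmorphN rmorph_nat.
  rewrite mulrDr mulrA mulii; ring.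
have : g (cxy 0 0) = 0.
  apply: (@rect_uniqueness R g (- 2^-1) 1 2^-1 h1 _ _ _ 0); [by lra| | |by lra].
    move=> eps eps0.
    have B0 : 0 <= k%:R + 1 + 1 :> R by lra.
    have [h' h'P] := h_approx B0 eps0.
    exists (fun z => h' (- k%:R + 'i%C * z)) => z [/andP[z1 z2] /andP[z3 z4]].
    have zE : - k%:R + 'i%C * z = cxy (- k%:R - Im z) (Re z).
      rewrite -{1}[z]cxyRI !cxyE rmorphB /= rmorphN rmorph_nat.
      rewrite mulrDr mulrA mulii; ring.
    have zg : good (- k%:R + 'i%C * z).
      rewrite zE; split=> /=; last by lra.
      by right; rewrite ler_norml; apply/andP; split; lra.
    have zB : normc (- k%:R + 'i%C * z) <= k%:R + 1 + 1.
      rewrite zE; apply: le_trans (normc_cxy _ _) _.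
      have : `|- k%:R - Im z| <= k%:R + 1 by rewrite ler_norml; apply/andP; split; lra.
      have : `|Re z| <= 1 by rewrite ler_norml; apply/andP; split; lra.
      lra.
    have [hd hn] := h'P _ zg zB; split; last exact: hn.
    apply: (@diffC_comp _ (fun z => - k%:R + 'i%C * z) h' z _ hd).
    apply: diffCD; first exact: diffC_cst.
    by apply: diffCM; [exact: diffC_cst|exact: diffC_id].
  move=> y yy; rewrite gE; apply: line1; lra.
rewrite gE /h subr0.
have -> : cxy (- k%:R) 0 = - k%:R :> C by rewrite cxyE mulr0 addr0 rmorphN rmorph_nat.
move=> /eqP; rewrite subr_eq0 => /eqP ->.
apply: eq_bigr => j _; congr (_ * _).
have -> : - k%:R - (e j)%:R = - (k + e j)%:R :> C by rewrite natrD opprD.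
have k0 : (0 < k + e j)%N by lia.
have kK : ((k + e j).+1 < K)%N by have := eE j; rewrite /K; lia.
have sK : 2 <= Re (- (k + e j)%:R : C) + K%:R.
  rewrite -(rmorph_nat (real_complex R)) -rmorphN /=.
  rewrite -lerBlDl opprK -natrD ler_nat; lia.
refine (cvgn_uniq (zl_cvg (neg_nat_neq1 R _) sK) _).
apply/cvgnS; refine (cvgn_ext _ (cvg_cst _)) => N.
by rewrite emsum_neg.
Qed.

End Continuation.

(** * Renormalised values of depth at most two *)

Section FiniteDifference.
Variable K : comNzRingType.

Lemma fdiffS (f : nat -> K) k :
  \sum_(i < k.+2) ((-1) ^+ i *+ 'C(k.+1, i)) * f i =
  \sum_(i < k.+1) ((-1) ^+ i *+ 'C(k, i)) * (f i - f i.+1).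
Proof.
under [RHS]eq_bigr do rewrite mulrBr.
rewrite sumrB big_ord_recl [in RHS]big_ord_recl /= !bin0 !mulr1n !expr0 !mul1r.
rewrite -addrA; congr (_ + _).
have -> : \sum_(i < k.+1) ((-1) ^+ bump 0 i *+ 'C(k.+1, bump 0 i)) * f (bump 0 i) =
    \sum_(i < k.+1) ((-1) ^+ i.+1 *+ 'C(k, i.+1)) * f i.+1 -
    \sum_(i < k.+1) ((-1) ^+ i *+ 'C(k, i)) * f i.+1.
  rewrite -sumrB; apply: eq_bigr => i _; rewrite /bump /= add1n binS mulrnDr mulrDl.
  by congr (_ + _); rewrite exprS mulN1r mulNrn mulNr.
congr (_ - _); rewrite [LHS]big_ord_recr /= bin_small ?ltnSn // mulr0n mul0r addr0.
by apply: eq_bigr.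
Qed.

(** One difference step x ^ p - (x + 1) ^ p has leading term - p x ^ (p - 1); iterated, this
    produces the sign and the factorial. *)
Lemma fdiff_power (x : K) k p : (p <= k)%N ->
  \sum_(i < k.+1) ((-1) ^+ i *+ 'C(k, i)) * (x + i%:R) ^+ p =
  if p == k then (-1) ^+ k * k`!%:R else 0.
Proof.
elim: k p => [|k IH] p.
  by rewrite leqn0 => /eqP->; rewrite big_ord1 !expr0 bin0 mulr1n !mul1r.
move=> pk; rewrite (fdiffS (fun i => (x + i%:R) ^+ p)).
have -> : \sum_(i < k.+1) ((-1) ^+ i *+ 'C(k, i)) *
      ((x + i%:R) ^+ p - (x + i.+1%:R) ^+ p) =
    - \sum_(l < p) 'C(p, l)%:R *
        \sum_(i < k.+1) ((-1) ^+ i *+ 'C(k, i)) * (x + i%:R) ^+ l.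
  rewrite -sumrN; under [RHS]eq_bigr do rewrite mulr_sumr -sumrN.
  rewrite exchange_big; apply: eq_bigr => i _ /=.
  rewrite -natr1 addrA [x + i%:R + 1]addrC [(1 + _) ^+ p]exprDn big_ord_recr /=.
  rewrite subnn binn mulr1n expr0 mul1r opprD addrCA subrr addr0.
  rewrite mulrN mulr_sumr -sumrN.
  apply: eq_bigr => l _; rewrite expr1n mul1r mulrCA; congr (- (_ * _)).
  by rewrite mulr_natl.
case: (ltngtP p k.+1) pk => // [pk|->] _.
  rewrite big1 ?oppr0 // => l _; have lk : (l < k)%N by have := ltn_ord l; lia.
  by rewrite IH 1?ltnW // ltn_eqF // mulr0.
rewrite big_ord_recr big1 => [|l _] /=; last first.
  by rewrite IH 1?ltnW // ltn_eqF // mulr0.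
by rewrite /= add0r IH // eqxx binSn exprS mulN1r factS natrM mulNr mulrCA.
Qed.

End FiniteDifference.

(** * Odd Bernoulli numbers and products of kernels *)

Section Parity.
Variable R : realType.
Local Notation C := (CC R).

Lemma neq1N : (-1 : C) != 0. Proof. by rewrite oppr_eq0 oner_eq0. Qed.

Lemma lscaleAr (c : C) (a b : lser R) : a * lscale c b = lscale c (a * b).
Proof.
apply: lser_eq => n; rewrite lcoefM /= /laurent_mul mulr_fsumr.
by apply: eq_fsbigr => i _; rewrite mulrCA.
Qed.

(** The reflection makes [geomker] odd up to its constant term, which is the vanishing of the odd
    Bernoulli numbers beyond the first. *)
Lemma geomkerN (x : C) : cexp x != 1 -> geomker (- x) = -1 - geomker x.
Proof.
move=> x1; rewrite /geomker cexpN; have := cexp_neq0 x.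
have : 1 - cexp x != 0 by rewrite subr_eq0 eq_sym.
move: (cexp x) => X X1 X0; have X2 : X - 1 != 0 by rewrite -opprB oppr_eq0.
by field; rewrite X0 X1 X2.
Qed.

Lemma lgeomkerE (al : C) (n : nat) : al != 0 ->
  lgeomker al n%:Z = bercoef R n.+1 * al ^+ n.
Proof.
move=> al0; rewrite /= /lgeomker_coef (_ : n%:Z + 1 = n.+1%:Z); last by lia.
by rewrite exprSr mulrA mulfK.
Qed.

Lemma lgeomkerN (n : nat) : lgeomker (-1 : C) n%:Z = - (n == 0%N)%:R - lgeomker (1 : C) n%:Z.
Proof.
have l1 := lexp_geomker (oner_neq0 C); have lN := lexp_geomker neq1N.
have E : lexp (fun z => geomker (-1 * z%:C%C : C))
    (fun n => -1 * laurent1 R n + -1 * lgeomker (1 : C) n).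
  apply: (lexp_eq (lexpD (lexpZ (-1) (lexp1 R)) (lexpZ (-1) l1))).
  apply: filterS (near_cexp_neq1 (oner_neq0 C)) => z; rewrite mul1r => z1.
  by rewrite mulr1 !mulN1r geomkerN.
have -> : lcoef (lgeomker (-1 : C)) n%:Z = -1 * laurent1 R n + -1 * lgeomker (1 : C) n.
  by rewrite (lexp_uniq lN E).
by rewrite !mulN1r; congr (- _ - _); rewrite /laurent1; case: n => [|n].
Qed.

(** Both sequences appear so that n = 0 is covered: [bercoef 1] is - 1/2 and [cber 1] is 1/2, the
    two conventions for B_1. *)
Lemma bercoef_sign n : bercoef R n.+1 * (-1) ^+ n = - cber R n.+1.
Proof.
have := lgeomkerN n; rewrite !lgeomkerE ?oner_neq0 ?neq1N // => ->.
rewrite expr1n mulr1 /bercoef eqSS; ring.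
Qed.

Lemma bercoef_cber n : (0 < n)%N -> bercoef R n.+1 = cber R n.+1.
Proof. by case: n => // n _; rewrite /bercoef subr0. Qed.

Lemma bercoef_odd n : odd n -> (1 < n)%N -> bercoef R n = 0.
Proof.
case: n => // n /= on n0; have := bercoef_sign n.
rewrite -signr_odd (negbTE on) expr0 mulr1 -bercoef_cber; last by lia.
move=> /eqP; rewrite -addr_eq0 -mulr2n -mulr_natl mulf_eq0 => /orP[|/eqP//].
by rewrite -(rmorph_nat (real_complex R)) (fmorph_eq0 (real_complex R)) pnatr_eq0.
Qed.

(** The two extreme terms, with 1 / al and 1 / ga, carry the coefficient [bercoef d.+2], zero for
    odd d; a homogeneous polynomial of degree d remains. *)
Lemma lgeomkerM (al ga : C) (d : nat) : al != 0 -> ga != 0 -> odd d ->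
  lcoef (lgeomker al * lgeomker ga) d%:Z =
  \sum_(i < d.+1) bercoef R i.+1 * bercoef R (d - i).+1 * (al ^+ i * ga ^+ (d - i)).
Proof.
move=> al0 ga0 od; rewrite lcoefM.
rewrite (@laurent_mulE R 1 1 _ _ _ d.+3 (lgeomker_bounded al) (lgeomker_bounded ga));
  last by lia.
have d2 : bercoef R d.+2 = 0 by apply: bercoef_odd => //=; rewrite negbK.
have coef1 (b : C) (m : int) (n : nat) : m + 1 = n%:Z ->
    lcoef (lgeomker b) m = bercoef R n * b ^+ n / b.
  by move=> mn; rewrite /= /lgeomker_coef mn.
have term (i : 'I_d.+3) : lcoef (lgeomker al) (i%:Z - 1%:Z) *
    lcoef (lgeomker ga) (d%:Z - (i%:Z - 1%:Z)) =
    bercoef R i * bercoef R (d.+2 - i) * (al ^+ i / al * (ga ^+ (d.+2 - i) / ga)).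
  rewrite (coef1 al _ i) ?subrK // (coef1 ga _ (d.+2 - i)%N); last first.
    by have := ltn_ord i; lia.
  by ring.
rewrite (eq_bigr _ (fun i _ => term i)) big_ord_recl big_ord_recr.
rewrite !subn0 d2 mulr0 !mul0r add0r.
rewrite -[LHS]/(_ + _) addr0.
apply: eq_bigr => i _; rewrite lift0 subSS subSn; last by have := ltn_ord i; rewrite /=; lia.
by rewrite !exprSr !mulfK.
Qed.

Lemma lgeomker_nested (al ga : C) : al != 0 -> ga != 0 -> al + ga != 0 ->
  lgeomker al * lgeomker (al + ga) =
  lgeomker al * lgeomker ga + lgeomker (al + ga) * lgeomker (- ga).
Proof.
move=> al0 ga0 ag0; have ng0 : - ga != 0 by rewrite oppr_eq0.
apply: lser_eq => n; congr (_ n).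
have l1 := lexp_geomker al0; have l2 := lexp_geomker ga0.
have l3 := lexp_geomker ag0; have l4 := lexp_geomker ng0.
apply: (lexp_uniq (lexpM l1 l3)); apply: (lexp_eq (lexpD (lexpM l1 l2) (lexpM l3 l4))).
apply: filterS3 (near_cexp_neq1 al0) (near_cexp_neq1 ga0) (near_cexp_neq1 ag0) => z.
rewrite /geomker mulNr cexpN mulrDl cexpD.
have := cexp_neq0 (ga * z%:C%C).
move: (cexp (al * _)) (cexp (ga * _)) => X Y Y0 X1 Y1 XY1.
have X1' : 1 - X != 0 by rewrite subr_eq0 eq_sym.
have Y1' : 1 - Y != 0 by rewrite subr_eq0 eq_sym.
have Y2' : Y - 1 != 0 by rewrite subr_eq0.
have XY1' : 1 - X * Y != 0 by rewrite subr_eq0 eq_sym.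
by field; rewrite X1' Y1' Y2' XY1' Y0.
Qed.

End Parity.

(** * Renormalised values at nonsingular points *)

Section Values.
Variables (R : realType) (t : CC R).
Hypothesis t_gt0 : 0 < Re t.
Local Notation C := (CC R).
Implicit Types (a b : letter).

Lemma lettershift_neq0 a i : lettershift t a i != 0.
Proof. by apply: contraTneq (Re_lettershift t_gt0 a i) => ->; rewrite ltxx. Qed.

Lemma lettershift_diff a p : (p <= val a)%N ->
  \sum_(i < (val a).+1) lettercoef R a i * lettershift t a i ^+ p =
  if p == val a then (-1) ^+ val a * (val a)`!%:R else 0.
Proof. by move=> pa; rewrite -(fdiff_power ((val a)%:R * t) pa). Qed.

Lemma lqzker1 a (n : nat) : lqzker t [:: a] n%:Z =
  bercoef R n.+1 * \sum_(i < (val a).+1) lettercoef R a i * lettershift t a i ^+ n.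
Proof.
rewrite /lqzker lcoef_sum mulr_sumr; apply: eq_bigr => i _.
rewrite -[LHS]/(lettercoef R a i * lcoef (lgeomker (lettershift t a i) * 1) n%:Z).
by rewrite mulr1 lgeomkerE ?lettershift_neq0 // mulrCA.
Qed.

(** Below degree - 1 there is no pole, and the degrees from 0 to k - 1 are killed by the k-th finite
    difference. *)
Lemma lqzker1_low a (n : int) : n < (val a)%:Z -> n != -1 -> lqzker t [:: a] n = 0.
Proof.
move=> na n1; have [n0|n0] := ltrP n 0.
  rewrite /lqzker lcoef_sum big1 // => i _.
  rewrite -[LHS]/(lettercoef R a i * lcoef (lgeomker (lettershift t a i) * 1) n).
  rewrite mulr1 (_ : lcoef (lgeomker _) n = 0) ?mulr0 //.
  by apply: lgeomker_bounded; move/eqP: n1 => n1; lia.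
case: n na n0 n1 => // n na _ _.
rewrite lqzker1 lettershift_diff; last by lia.
by rewrite ifF ?mulr0 //; lia.
Qed.

Lemma psi_weight1 a n : psi t [:: a] n = (-1) ^+ val a * lqzker t [:: a] (n + (val a)%:Z).
Proof. by rewrite psiE // weight_cons /weight big_nil addn0. Qed.

Lemma zetaplus1 a : zetaplus t [:: a] = (val a)`!%:R * cber R (val a).+1.
Proof.
rewrite /zetaplus /bplus /polar_part ltxx subr0 /bprep big_geq // addr0.
rewrite psi_weight1 add0r lqzker1 lettershift_diff // eqxx.
rewrite bercoef_cber; last exact: (valP a).
have s2 : (-1) ^+ val a * (-1) ^+ val a = 1 :> C.
  by rewrite -exprMn mulrNN mulr1 expr1n.
by rewrite mulrCA [X in _ * X = _]mulrA s2 mul1r mulrC.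
Qed.

(** For k and l the integers of a and b, psi_- of the first letter is concentrated in degree - (k +
    1). It meets the coefficient of degree k + 1 in psi of the second, a multiple of
    [bercoef (k + l + 2)], which vanishes by parity. *)
Lemma zetaplus2_psi a b : odd (val a + val b) ->
  zetaplus t [:: a; b] = psi t [:: a; b] 0.
Proof.
move=> ab; rewrite /zetaplus /bplus /polar_part ltxx subr0 /bprep big_nat1 /=.
rewrite [laurent_mul _ _ _](_ : _ = 0) ?addr0 //.
have az (i : int) : (0 <= i) || (i != - (val a).+1%:Z) -> bminus (psi t) [:: a] i = 0.
  rewrite bminusE // /polar_part => i0; case: ifP => [iN|_]; last by rewrite oppr0.
  rewrite /bprep big_geq // addr0 psi_weight1 lqzker1_low ?mulr0 ?oppr0 //.
    by move: iN; move: (val a) => n; lia.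
  apply/eqP => ia; move: i0 ia iN => /orP[]; move: (val a) => n; last move/eqP; lia.
have bz (i : int) : i = - (val a).+1%:Z -> psi t [:: b] (0 - i) = 0.
  move=> ->; rewrite psi_weight1.
  have -> : 0 - - (val a).+1%:Z + (val b)%:Z = (val a + val b).+1%:Z by lia.
  by rewrite lqzker1 bercoef_odd ?mul0r ?mulr0 //= negbK.
rewrite /laurent_mul; apply: fsbig1 => i _.
have [ia|ia] := eqVneq i (- (val a).+1%:Z); first by
  rewrite -[X in _ * X = _]/(psi t [:: b] (0 - i)) (bz _ ia) mulr0.
by rewrite az ?mul0r // ia orbT.
Qed.

Lemma zetaplus2 a b : odd (val a + val b) ->
  zetaplus t [:: a; b] =
  \sum_(n < (val b).+1) - (cber R n * ((val b)`!%:R / ((val b).+1 - n)`!%:R)) *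
    ((val a + ((val b).+1 - n))`!%:R * cber R (val a + ((val b).+1 - n)).+1).
Proof.
move=> ab; rewrite zetaplus2_psi // psiE // add0r.
set k := val a in ab *; set l := val b in ab *; pose d := (k + l)%N.
have -> : weight [:: a; b] = d by rewrite !weight_cons /weight big_nil addn0.
have k0 : (0 < k)%N := valP a; have l0 : (0 < l)%N := valP b.
pose al (i : nat) := lettershift t a i; pose ga (j : nat) := lettershift t b j.
pose c i := lettercoef R a i; pose c' j := lettercoef R b j.
pose phi := bercoef R.
have al0 i : al i != 0 by exact: lettershift_neq0.
have ga0 i : ga i != 0 by exact: lettershift_neq0.
have ag0 i j : al i + ga j != 0.
  apply/eqP => /(congr1 (fun x : C => Re x)) /eqP; rewrite CReD /= gt_eqF //.
  by rewrite addr_gt0 // Re_lettershift.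
have -> : lcoef (lqzker t [:: a; b]) d%:Z = \sum_(i < k.+1) \sum_(j < l.+1)
    c i * c' j * \sum_(p < d.+1) phi p.+1 * phi (d - p).+1 *
      (al i ^+ p * ga j ^+ (d - p) + (al i + ga j) ^+ p * (- ga j) ^+ (d - p)).
  rewrite /lqzker lcoef_sum; apply: eq_bigr => i _.
  rewrite -[LHS]/(c i * lcoef (lnestker t (al i) [:: b]) d%:Z).
  have -> : lnestker t (al i) [:: b] = \sum_(j < l.+1)
      lscale (c' j) (lgeomker (al i) * lgeomker (al i + ga j)).
    rewrite /= mulr_sumr; apply: eq_bigr => j _.
    by rewrite mulr1 lscaleAr.
  rewrite lcoef_sum mulr_sumr; apply: eq_bigr => j _.
  rewrite -[LHS]/(c i * (c' j * lcoef (lgeomker (al i) * lgeomker (al i + ga j)) d%:Z)).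
  rewrite mulrA lgeomker_nested // lcoefD !lgeomkerM ?oppr_eq0 // -big_split /=.
  by congr (_ * _); apply: eq_bigr => p _; rewrite -mulrDr.
(* The double finite difference of orders k and l. On homogeneous polynomials of degree d = k + l it
   reads off the coefficient of x ^ k y ^ l, times (-1) ^ d k! l!. *)
pose D h : C := \sum_(i < k.+1) \sum_(j < l.+1) c i * c' j * h (al i) (ga j).
have Dmono p q : (p + q = d)%N -> D (fun x y => x ^+ p * y ^+ q) =
    if p == k then (-1) ^+ d * (k`!%:R * l`!%:R) else 0.
  move=> pq; rewrite /D.
  have -> : \sum_(i < k.+1) \sum_(j < l.+1) c i * c' j * (al i ^+ p * ga j ^+ q) =
      (\sum_(i < k.+1) c i * al i ^+ p) * (\sum_(j < l.+1) c' j * ga j ^+ q).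
    rewrite mulr_suml; apply: eq_bigr => i _; rewrite mulr_sumr.
    by apply: eq_bigr => j _; rewrite mulrACA.
  have [pk|kp|pk] := ltngtP p k.
  - by rewrite lettershift_diff ?(ltnW pk) // ltn_eqF // mul0r.
  - have ql : (q < l)%N by rewrite /d in pq; lia.
    by rewrite [X in _ * X]lettershift_diff ?(ltnW ql) // ltn_eqF // mulr0.
  - have ql : q = l by rewrite /d in pq; lia.
    by rewrite pk ql !lettershift_diff // !eqxx mulrACA -exprD.
clearbody c c' al ga.
have Dbin p : (p <= d)%N -> D (fun x y => (x + y) ^+ p * (- y) ^+ (d - p)) =
    (-1) ^+ (d - p) * ((-1) ^+ d * (k`!%:R * l`!%:R)) *+ 'C(p, k).
  move=> pd.
  have -> : D (fun x y => (x + y) ^+ p * (- y) ^+ (d - p)) =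
      \sum_(m < p.+1) (-1) ^+ (d - p) * D (fun x y => x ^+ (p - m) * y ^+ (m + (d - p)))
        *+ 'C(p, m).
    rewrite /D; under [RHS]eq_bigr do rewrite mulr_sumr -sumrMnl.
    rewrite [RHS]exchange_big; apply: eq_bigr => i _ /=.
    under [RHS]eq_bigr do rewrite mulr_sumr -sumrMnl.
    rewrite [RHS]exchange_big; apply: eq_bigr => j _ /=.
    rewrite exprDn mulr_suml mulr_sumr; apply: eq_bigr => m _.
    rewrite [(- ga j) ^+ _]exprNn exprD !mulrnAl !mulrnAr; congr (_ *+ _); ring.
  have [kp|pk] := leqP k p; last first.
    rewrite bin_small // mulr0n big1 // => m _; rewrite Dmono; last by have := ltn_ord m; lia.
    by rewrite ltn_eqF /= ?mulr0 ?mul0rn //; lia.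
  have mk : (p - k < p.+1)%N by lia.
  rewrite (bigD1 (Ordinal mk)) //= big1 ?addr0 => [|m mn].
    rewrite Dmono; last by lia.
    by rewrite ifT ?bin_sub //; lia.
  rewrite Dmono; last by have := ltn_ord m; lia.
  rewrite ifF ?mulr0 ?mul0rn //; apply/negbTE; apply: contra mn => /eqP mk'.
  by apply/eqP/val_inj => /=; have := ltn_ord m; lia.
have -> : \sum_(i < k.+1) \sum_(j < l.+1) c i * c' j * \sum_(p < d.+1)
      phi p.+1 * phi (d - p).+1 *
      (al i ^+ p * ga j ^+ (d - p) + (al i + ga j) ^+ p * (- ga j) ^+ (d - p)) =
    \sum_(p < d.+1) phi p.+1 * phi (d - p).+1 *
      (D (fun x y => x ^+ p * y ^+ (d - p)) +
       D (fun x y => (x + y) ^+ p * (- y) ^+ (d - p))).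
  rewrite /D; under [RHS]eq_bigr do rewrite -big_split /= mulr_sumr.
  rewrite [RHS]exchange_big; apply: eq_bigr => i _ /=.
  under [RHS]eq_bigr do rewrite -big_split /= mulr_sumr.
  rewrite [RHS]exchange_big; apply: eq_bigr => j _ /=.
  by rewrite mulr_sumr; apply: eq_bigr => p _; rewrite -mulrDr mulrCA.
(* The contribution of (x + y) ^ (d - m) (- y) ^ m. Its binomial coefficient is zero for m > l,
   which cuts the sum down to the range of Faulhaber's formula. *)
pose Q m : C := - (bercoef R (d - m).+1 * cber R m.+1) * (k`!%:R * l`!%:R *+ 'C(d - m, k)).
have s2 : (-1) ^+ d * (-1) ^+ d = 1 :> C by rewrite -exprMn mulrNN mulr1 expr1n.
have -> : \sum_(p < d.+1) phi p.+1 * phi (d - p).+1 *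
      (D (fun x y => x ^+ p * y ^+ (d - p)) +
       D (fun x y => (x + y) ^+ p * (- y) ^+ (d - p))) =
    (-1) ^+ d * (phi k.+1 * phi l.+1 * (k`!%:R * l`!%:R) + \sum_(m < d.+1) Q m).
  under eq_bigr do rewrite mulrDr.
  rewrite big_split mulrDr; congr (_ + _).
    have kd : (k < d.+1)%N by rewrite /d; lia.
    rewrite (bigD1 (Ordinal kd)) //= big1 ?addr0 => [|p pk].
      rewrite Dmono; last by rewrite /d; lia.
      by rewrite eqxx mulrCA (_ : d - k = l)%N //; rewrite /d; lia.
    rewrite Dmono; last by have := ltn_ord p; lia.
    by rewrite ifF ?mulr0 //; apply/negbTE; apply: contra pk => /eqP pk; apply/eqP/val_inj.
  rewrite (reindex_inj rev_ord_inj) mulr_sumr; apply: eq_bigr => m _.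
  have -> : rev_ord m = (d - m)%N :> nat by rewrite /= subSS.
  have md : (m <= d)%N by rewrite -ltnS.
  rewrite Dbin ?leq_subr // subKn // /Q.
  have -> : cber R m.+1 = - (bercoef R m.+1 * (-1) ^+ m) by rewrite bercoef_sign opprK.
  by rewrite /phi -!mulrnAr; ring.
rewrite mulrA s2 mul1r.
have -> : \sum_(m < d.+1) Q m = \sum_(m < l.+1) Q m.
  rewrite (@big_ord_widen _ _ _ l.+1 d.+1 Q); last by rewrite /d; lia.
  rewrite [LHS](bigID (fun m : 'I_d.+1 => (m < l.+1)%N)) /= [X in _ + X]big1 ?addr0 // => m ml.
  have dm : (d - m < k)%N by move: ml; rewrite -leqNgt /d => ml; lia.
  by rewrite /Q bin_small ?mulr0n ?mulr0.
(* On the left the term m = l cancels the contribution of the first product; on the right the term n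
   = 0 vanishes by parity. The others match under n = m + 1. *)
rewrite big_ord_recr [RHS]big_ord_recl /=.
have -> : cber R (k + (l.+1 - 0)).+1 = 0.
  rewrite -bercoef_cber; last by lia.
  by apply: bercoef_odd => //; move: ab; rewrite subn0; lia.
rewrite !mulr0 add0r /Q (_ : d - l = k)%N; last by rewrite /d; lia.
rewrite binn mulr1n -(bercoef_cber R l0) /phi addrCA mulNr subrr addr0.
apply: eq_bigr => m _; rewrite subSS.
have ml := ltn_ord m; have -> : (k + (l - m) = d - m)%N by rewrite /d; lia.
rewrite bercoef_cber; last by rewrite /d; lia.
have E : k`!%:R * l`!%:R *+ 'C(d - m, k) = l`!%:R / (l - m)`!%:R * (d - m)`!%:R :> C.
  have kdm : (k <= d - m)%N by rewrite /d; lia.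
  rewrite -(bin_fact kdm) (_ : d - m - k = l - m)%N; last by rewrite /d; lia.
  rewrite -mulr_natr !natrM; have : (l - m)`!%:R != 0 :> C.
    by rewrite -normc_gt0 normc_nat ltr0n fact_gt0.
  by move=> f0; field.
by rewrite E; ring.
Qed.

End Values.

(** * Comparison with the continuation *)

Section ContinuationValues.
Variable R : realType.
Local Notation C := (CC R).

Definition line n (c : 'rV[C]_n.+1) (s : C) : 'rV[C]_n.+1 := s *: delta_mx 0 0 + c.

Lemma differentiable_line n (c : 'rV[C]_n.+1) s : differentiable (line c) s.
Proof.
have H : differentiable (fun z : C => z *: delta_mx 0 0 : 'rV[C]_n.+1) s.
  exact: (@differentiableZl _ C 'rV[C]_n.+1 (fun z => z) _ s (diffC_id s)).
exact: (@differentiableD _ C 'rV[C]_n.+1 _ _ _ H (@differentiable_cst _ C 'rV[C]_n.+1 c s)).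
Qed.

Lemma differentiable_slice n (Z : 'rV[C]_n.+1 -> C) (c : 'rV[C]_n.+1) s :
  differentiable Z (line c s) -> differentiable (fun z => Z (line c z)) s.
Proof. by move=> ZD; exact: (differentiable_comp (differentiable_line c s) ZD). Qed.

Lemma lineE1 (s : C) : line (0 : 'rV[C]_1) s 0 0 = s.
Proof. by rewrite !mxE eqxx mulr1 addr0. Qed.

Definition depth2 (b : letter) : 'rV[C]_2 := \row_(i < 2) (if i == 0 then 0 else - (val b)%:R).

Lemma lineE20 b (s : C) : line (depth2 b) s 0 0 = s.
Proof. by rewrite !mxE /= mulr1 addr0. Qed.

Lemma lineE21 b (s : C) i : line (depth2 b) s 0 (lift 0 i) = - (val b)%:R.
Proof. by rewrite !mxE /= mulr0 add0r. Qed.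

Lemma psum1 n (x : 'rV[C]_n.+1) : psum x 1 = x 0 0.
Proof. by rewrite /psum big_mkcond big_ord_recl /= big1 ?addr0. Qed.

Lemma psum2 (x : 'rV[C]_2) : psum x 2 = x 0 0 + x 0 (lift 0 0).
Proof. by rewrite /psum big_mkcond !big_ord_recl big_ord0 /= addr0. Qed.

Lemma ReN (s : C) : Re (- s) = - Re s. Proof. by case: s. Qed.
Lemma ImN (s : C) : Im (- s) = - Im s. Proof. by case: s. Qed.

Lemma Re_nat n : Re (n%:R : C) = n%:R.
Proof. by rewrite -(rmorph_nat (real_complex R)). Qed.

Lemma Im_nat n : Im (n%:R : C) = 0.
Proof. by rewrite -(rmorph_nat (real_complex R)). Qed.

(* The points at which continuation_value requires holomorphy. *)
Definition near_real_neg (k : nat) (s : C) := Im s != 0 \/ `|Re s + k%:R| <= 2^-1.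

Lemma near_real_neg_nat k n (s : C) : (0 < k)%N -> near_real_neg k s -> s != n%:R.
Proof.
move=> k0; apply: contraPneq => ->; rewrite /near_real_neg Im_nat Re_nat eqxx.
case=> //; apply/negP; rewrite -ltNge -natrD ger0_norm ?ler0n //.
apply: (@lt_le_trans _ _ 1); first by lra.
by rewrite ler1n addn_gt0 k0 orbT.
Qed.

Lemma continuation_depth1 (Z : 'rV[C]_1 -> C) (a : letter) : is_mzf_continuation Z ->
  Z (neg_point R [tuple a]) = (val a)`!%:R * cber R (val a).+1.
Proof.
case=> Zsum Zdiff _.
have -> : neg_point R [tuple a] = line 0 (- (val a)%:R).
  by apply/rowP => i; rewrite ord1 lineE1 mxE.
rewrite (@continuation_value R (fun s => Z (line 0 s)) (val a) 1 1 (fun=> 1) (fun=> 0%N) (valP a)).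
- by rewrite big_ord1 mul1r addn0.
- move=> s sn; apply/differentiable_slice/Zdiff.
  rewrite /mzf_sing /= psum1 lineE1 => -[[_ s1]|[]//|[j []]]; last by case: j => [|[|[]]].
  by have := near_real_neg_nat 1 (valP a) sn; rewrite s1 eqxx.
- move=> s s1; have sD : mzf_domain (line 0 s : 'rV[C]_1).
    move=> j /= j1; rewrite (_ : j = 1%N) ?psum1 ?lineE1 //; lia.
  refine (cvgn_ext _ (Zsum _ sD)) => N.
  rewrite enum_ordSl /= (_ : enum 'I_0 = [::]); last exact: size0nil (size_enum_ord 0).
  by apply: eq_bigr => m _; rewrite lineE1 big_ord1 expr0 mulr1.
Qed.

Lemma continuation_depth2 (Z : 'rV[C]_2 -> C) (a b : letter) :
  odd (val a + val b) -> is_mzf_continuation Z ->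
  Z (neg_point R [tuple a; b]) =
  \sum_(n < (val b).+1) - (cber R n * ((val b)`!%:R / ((val b).+1 - n)`!%:R)) *
    ((val a + ((val b).+1 - n))`!%:R * cber R (val a + ((val b).+1 - n)).+1).
Proof.
move=> ab [Zsum Zdiff _].
have -> : neg_point R [tuple a; b] = line (depth2 b) (- (val a)%:R).
  apply/rowP => i; case: (unliftP 0 i) => [j|] ->; last by rewrite lineE20 mxE.
  by rewrite lineE21 ord1 mxE.
(* The bound Re s_1 > l + 2, for l the integer of b, ensures Re (s_1 + s_2) > 2; the inner sum over
   m_2 is Faulhaber's polynomial in m_1, with exponents l + 1 - n. *)
apply: (@continuation_value R (fun s => Z (line (depth2 b) s)) (val a) (val b).+1
  ((val b).+2)%:R _ (fun n => (val b).+1 - n)%N (valP a)).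
- move=> s sn; apply/differentiable_slice/Zdiff.
  have nn n := near_real_neg_nat n (valP a) sn.
  have sB x : s - (val b)%:R = x -> s = x + (val b)%:R by move=> <-; rewrite subrK.
  rewrite /mzf_sing /= psum1 psum2 lineE20 lineE21.
  case=> [[_ s1]|[_ []]|[j []]]; last by case: j => [|[|[]]].
  + by have := nn 1%N; rewrite s1 eqxx.
  + by move=> /sB s2; have := nn (2 + val b)%N; rewrite natrD s2 eqxx.
  + by move=> /sB s2; have := nn (1 + val b)%N; rewrite natrD s2 eqxx.
  (* The remaining singular points s_1 = l - 2 m differ from - k by an odd integer, k being the
     integer of a, so they lie at distance at least 1 and miss the strip of half-width 1/2. *)
  + case=> m /sB s2; move: sn; rewrite s2 CImD CReD ImN ReN !Im_nat !Re_nat oppr0 addr0 eqxx.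
    case=> // /ler_normlP[].
    have : (val a + val b != m.*2)%N.
      by apply: contraTneq ab => ->; rewrite odd_double.
    rewrite neq_ltn => /orP[]; rewrite -(ler_nat R) -natr1 natrD; lra.
- move=> s sL; have sD : mzf_domain (line (depth2 b) s : 'rV[C]_2).
    move=> j /= /andP[j1 j2].
    have [->|->] : j = 1%N \/ j = 2%N by lia.
      by rewrite psum1 lineE20; apply: le_lt_trans sL; rewrite ler_nat.
    rewrite psum2 lineE20 lineE21 CReD ReN Re_nat ltrBrDr -natrD.
    by apply: le_lt_trans sL; rewrite ler_nat; lia.
  refine (cvgn_ext _ (Zsum _ sD)) => N.
  rewrite !enum_ordSl /= (_ : enum 'I_0 = [::]); last exact: size0nil (size_enum_ord 0).
  apply: eq_big_nat => m /andP[m0 _]; rewrite lineE20; congr (_ * _).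
  transitivity (\sum_(1 <= i < m) (i%:R : C) ^+ val b).
    apply: eq_big_nat => i /andP[i0 _]; rewrite lineE21 opprK mulr1 cpow_nat ?ltr0n //.
    by rewrite rmorph_nat.
  rewrite (sum_powers R (valP b) m0) -sumrN; apply: eq_bigr => n _.
  by rewrite mulNr.
Qed.

Lemma zetaplus_continuation (t : C) n (Z : 'rV[C]_n -> C) : 0 < Re t -> (1 <= n)%N ->
  is_mzf_continuation Z -> forall k : n.-tuple letter, ~ mzf_sing (neg_point R k) ->
  zetaplus t k = Z (neg_point R k) /\ exists r : rat, Z (neg_point R k) = ratr r.
Proof.
move=> t0; case: n Z => [|[|[|n]]] Z // _ HZ k.
- case/tupleP: k => a k; rewrite (tuple0 k) => _.
  rewrite continuation_depth1 // zetaplus1 //; split=> //.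
  by exists ((val a)`!%:R * ber (val a).+1); rewrite rmorphM rmorph_nat.
- case/tupleP: k => a k; case/tupleP: k => b k; rewrite (tuple0 k) => ns.
  have ab : odd (val a + val b).
    apply: contra_notT ns => /even_halfK ab; apply: Or32; split=> //; apply: Or33.
    exists (val a + val b)./2; rewrite ab psum2 !mxE (tnth_nth a) natrD opprD.
    by rewrite (tnth_nth a).
  rewrite continuation_depth2 // zetaplus2 //; split=> //.
  exists (\sum_(n < (val b).+1) - (ber n * ((val b)`!%:R / ((val b).+1 - n)`!%:R)) *
    ((val a + ((val b).+1 - n))`!%:R * ber (val a + ((val b).+1 - n)).+1)).
  rewrite rmorph_sum; apply: eq_bigr => n _.
  by rewrite /cber !(rmorphM, rmorphN, fmorphV, rmorph_nat).
- case; apply: Or33; exists 3%N; split=> //.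
  exists (- (\sum_(i < n.+3 | (i < 3)%N) val (tnth k i))%N%:Z); split; first by lia.
  rewrite mulrNz -pmulrn natr_sum -sumrN; apply: eq_bigr => i _.
  by rewrite mxE.
Qed.

End ContinuationValues.

Theorem theorem4p2 (R : realType) :
  [/\ (forall t : CC R, 0 < complex.Re t ->
        forall (n : nat) (Z : 'rV[CC R]_n -> CC R), (1 <= n)%N ->
        is_mzf_continuation Z ->
        forall k : n.-tuple letter, ~ mzf_sing (neg_point R k) ->
        zetaplus t k = Z (neg_point R k) /\
        exists r : rat, Z (neg_point R k) = ratr r),
      (forall t : CC R, 0 < complex.Re t -> is_qsh_morphism (zetaplus_lin t)) &
      (forall w : word, w != [::] ->
        exists p q : {poly rat},
          (forall t : CC R, 0 < complex.Re t -> (map_poly ratr q).[t] != 0) /\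
          (forall t : CC R, 0 < complex.Re t ->
            zetaplus t w = (map_poly ratr p).[t] / (map_poly ratr q).[t]))].
Proof.
split=> [t t0 n Z n0 HZ k ns|t t0|w _].
- exact: zetaplus_continuation.
- exact: zetaplus_lin_morphism.
- exact: (zetaplus_rational R w).
Qed.
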